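(* Let $\psi\in(0,\pi/2]$, let $r$ be an $\mathcal{A}(\psi)$-stable rational function with $|r(\infty)|<1$, and let $\theta\in(0,\psi)$. Then there exists a constant $C$, depending only on $r$, $\psi$ and $\theta$, such that, for every complex Banach space $X$, every operator $A$ on $X$ with $A\in\operatorname{Sect}(\varphi)$ for some $\varphi\in(0,\theta)$, and every finite sequence $(k_j)_{j=1}^n\subset(0,\infty)$ (of any length $n\in\mathbb{N}$), $$\bigg\|\prod_{j=1}^n r(k_jA)\bigg\|\le C\,M_\theta(A).$$
   Context: $\mathbb{N}=\{1,2,\dots\}$. For $\alpha\in(0,\pi)$, $\Sigma_\alpha=\{\lambda\in\mathbb{C}\setminus\{0\}:|\arg\lambda|<\alpha\}$. A rational function $r$ is $\mathcal{A}(\psi)$-stable if $|r(\lambda)|\le1$ for all $\lambda\in\Sigma_\psi$; then $r(\infty)=\lim_{z\to\infty}r(z)$ exists in $\mathbb{C}$ and $|r(\infty)|\le1$. For $\varphi\in(0,\pi)$, a closed densely defined operator $A$ on $X$ belongs to $\operatorname{Sect}(\varphi)$ if $\sigma(A)\subset\overline{\Sigma}_\varphi$ and for every $\theta\in(\varphi,\pi)$, $$M_\theta(A):=\sup\{\|\lambda(\lambda+A)^{-1}\|:\lambda\in\Sigma_{\pi-\theta}\}<\infty.$$ For a rational function $r$ which is bounded on $\Sigma_\psi$ and an operator $B\in\operatorname{Sect}(\varphi)$ with $\varphi<\psi$, $r(B)$ is the bounded operator given by the natural definition for rational functions (via resolvents and partial fractions). *)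

(* Defs.v *)
From HB Require Import structures.
From mathcomp Require Import all_boot all_order all_algebra.
From mathcomp Require Import complex.
From mathcomp Require Import all_classical all_reals all_analysis.
From mathcomp Require Import ring.

Set Implicit Arguments.
Unset Strict Implicit.
Unset Printing Implicit Defensive.

Import Order.TTheory GRing.Theory Num.Theory.
Import numFieldNormedType.Exports.

Local Open Scope classical_set_scope.
Local Open Scope ring_scope.
Local Open Scope complex_scope.

Notation "x %:F" := (@FracField.tofrac _ x) : ring_scope.

Section RationalFunctions.
Variable F : closedFieldType.
Implicit Types (r : {fraction {poly F}}) (p : {poly F}) (s : seq F).

(* [repr r] is an arbitrary representative, hence the division by the gcd:
   evaluation and poles only make sense for the reduced form. *)
Definition rat_num r : {poly F} :=
  let: (n, d) := frac (repr r) in n %/ gcdp n d.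
Definition rat_den r : {poly F} :=
  let: (n, d) := frac (repr r) in d %/ gcdp n d.

Definition rat_eval r (z : F) : F := (rat_num r).[z] / (rat_den r).[z].

Definition rat_poles r : seq F :=
  undup (sval (closed_field_poly_normal (rat_den r))).

(* [d.1] is the constant term and [d.2 l m] the coefficient of [(X - l)^-m];
   there is no polynomial part, so only an [r] that is finite at infinity has
   such an expansion (see [partial_fraction_exists]). *)
Definition is_partial_fraction r (d : F * (F -> nat -> F)) : Prop :=
  r = (d.1%:P)%:F +
      \sum_(l <- rat_poles r) \sum_(1 <= m < (mup l (rat_den r)).+1)
        ((d.2 l m)%:P)%:F / (('X - l%:P) ^+ m)%:F.

(* The coefficients that occur in [is_partial_fraction r] are determined by
   [r]; the choice only concerns those that do not occur. *)
Definition partial_fraction r : F * (F -> nat -> F) :=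
  xget (0, fun _ _ => 0) [set d | is_partial_fraction r d].

Lemma rat_den_neq0 r : rat_den r != 0.
Proof.
rewrite /rat_den; case: (repr r) => -[n d] /= d0.
have g0 : gcdp n d != 0 by rewrite gcdp_eq0 negb_and d0 orbT.
by apply: contraNneq d0 => dg; rewrite -(divpK (dvdp_gcdr n d)) dg mul0r.
Qed.

Lemma coprime_rat_num_den r : coprimep (rat_num r) (rat_den r).
Proof.
rewrite /rat_num /rat_den; case: (repr r) => -[n d] /= d0.
by rewrite coprimep_div_gcd // d0 orbT.
Qed.

Lemma rat_numdenE r : r = (rat_num r)%:F / (rat_den r)%:F.
Proof.
have rE : r = (frac (repr r)).1%:F / (frac (repr r)).2%:F.
  have d0 := denom_ratioP (repr r).
  apply: (mulIf (x := (frac (repr r)).2%:F)); first by rewrite tofrac_eq0.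
  rewrite divfK ?tofrac_eq0 //.
  rewrite -{1}[r]generic_quotient.reprK; unlock FracField.tofrac.
  rewrite -[LHS]FracField.pi_mul; apply/generic_quotient.eqmodP.
  rewrite /= FracField.equivfE /FracField.mulf.
  by rewrite !numden_Ratio ?mulr1 ?oner_neq0 // mulrC.
rewrite {1}rE /rat_num /rat_den; case: (repr r) => -[n d] /= d0.
have g0 : gcdp n d != 0 by rewrite gcdp_eq0 negb_and d0 orbT.
set g := gcdp n d in g0 *.
have nE : n = n %/ g * g by rewrite divpK // dvdp_gcdl.
have dE : d = d %/ g * g by rewrite divpK // dvdp_gcdr.
by rewrite [in LHS]nE [in LHS]dE !rmorphM -mulf_div divff ?mulr1 // tofrac_eq0.
Qed.

Let div_decomp (K : fieldType) (x y w u v : K) : x != 0 -> y != 0 -> w != 0 ->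
  (u * x + v * w) / (x * (y * w)) = v / (x * y) + u / (y * w).
Proof. by move=> x0 y0 w0; field; rewrite x0 y0 w0. Qed.

Lemma prod_XsubC_pfrac s p : (size p <= (size s).+1)%N ->
  exists d : F * (F -> nat -> F),
    p%:F / (\prod_(z <- s) ('X - z%:P))%:F = (d.1%:P)%:F +
      \sum_(l <- undup s) \sum_(1 <= m < (count_mem l s).+1)
        ((d.2 l m)%:P)%:F / (('X - l%:P) ^+ m)%:F.
Proof.
elim: s p => [|z s IH] p sp.
  exists (p`_0, fun _ _ => 0); rewrite !big_nil addr0 rmorph1 divr1 /=.
  by rewrite [in LHS](size1_polyC sp).
set k := count_mem z s; set q := \prod_(w <- s | w != z) ('X - w%:P).
have prodE : \prod_(w <- s) ('X - w%:P) = ('X - z%:P) ^+ k * q.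
  rewrite (bigID (pred1 z)) /=; congr (_ * _).
  rewrite (eq_bigr (fun=> 'X - z%:P)); last by move=> w /eqP ->.
  by rewrite big_const_seq /= iter_mulr_1.
have qz : q.[z] != 0.
  rewrite horner_prod prodf_seq_neq0; apply/allP => w _ /=; apply/implyP => wz.
  by rewrite hornerXsubC subr_eq0 eq_sym.
pose b := p.[z] / q.[z].
have : root (p - b *: q) z by rewrite rootE !hornerE mulfVK // subrr.
rewrite -dvdp_XsubCl => /dvdpP[p1 p1E]; clearbody b.
have sq : (size q <= (size s).+1)%N.
  rewrite /q -big_filter size_prod_XsubC ltnS size_filter; exact: count_size.
have sp1 : (size p1 <= (size s).+1)%N.
  have [->|p10] := eqVneq p1 0; first by rewrite size_poly0.
  rewrite -ltnS.
  have -> : (size p1).+1 = size (p1 * ('X - z%:P)) by rewrite size_mul ?polyXsubC_eq0 // size_XsubC addn2.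
  rewrite -p1E (leq_trans (size_polyD _ _)) // geq_max sp size_polyN.
  by rewrite (leq_trans (size_scale_leq _ _)) // ltnW.
have [[c a] /= IHd] := IH _ sp1.
exists (c, fun l m => if (l == z) && (m == k.+1) then b else a l m).
have Xz w : ('X - w%:P)%:F != 0 :> {fraction {poly F}}.
  by rewrite tofrac_eq0 polyXsubC_eq0.
have qF : q%:F != 0 :> {fraction {poly F}}.
  rewrite tofrac_eq0; apply: contraNneq qz => ->; by rewrite horner0.
have -> : p%:F / (\prod_(w <- z :: s) ('X - w%:P))%:F =
    (b%:P)%:F / (('X - z%:P) ^+ k.+1)%:F +
    p1%:F / (\prod_(w <- s) ('X - w%:P))%:F.
  have -> : p = p1 * ('X - z%:P) + b%:P * q by rewrite -p1E mul_polyC subrK.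
  rewrite big_cons prodE exprS !rmorphM rmorphD !rmorphM !rmorphXn /=.
  by rewrite (div_decomp _ _ (Xz z) (expf_neq0 k (Xz z)) qF).
rewrite IHd addrCA; congr (_ + _).
set G := RHS; pose t l m : {fraction {poly F}} :=
  (((if (l == z) && (m == k.+1) then b else a l m)%:P)%:F
    / (('X - l%:P) ^+ m)%:F).
pose H l := \sum_(1 <= m < (count_mem l s).+1)
  ((a l m)%:P)%:F / (('X - l%:P) ^+ m)%:F : {fraction {poly F}}.
have tH l : \sum_(1 <= m < (count_mem l s).+1) t l m = H l.
  apply: eq_big_nat => m /andP[_ mk]; rewrite /t.
  by case: eqP => //= lz; rewrite lz -/k in mk *; rewrite ltn_eqF.
have tz : \sum_(1 <= m < (count_mem z (z :: s)).+1) t z m =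
    (b%:P)%:F / (('X - z%:P) ^+ k.+1)%:F + H z.
  by rewrite /= eqxx add1n big_nat_recr //= tH addrC /t !eqxx.
have tN l : l != z -> \sum_(1 <= m < (count_mem l (z :: s)).+1) t l m = H l.
  by move=> lz; rewrite /= [z == l]eq_sym (negbTE lz) tH.
rewrite /G /=; case: ifPn => zs.
  rewrite !(bigD1_seq z) ?mem_undup ?undup_uniq //= addrA; congr (_ + _).
    exact/esym/tz.
  by apply: eq_bigr => l lz; apply/esym/tN.
rewrite big_cons; congr (_ + _).
  have Hz : H z = 0 by rewrite /H (count_memPn zs) big_geq.
  by move: tz; rewrite Hz addr0 => /esym.
rewrite [LHS]big_seq [RHS]big_seq; apply: eq_bigr => l; rewrite mem_undup => ls.
by apply/esym/tN; apply: contraNneq zs => <-.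
Qed.

(* The hypothesis says that [r] is bounded at infinity. *)
Lemma partial_fraction_exists r : (size (rat_num r) <= size (rat_den r))%N ->
  is_partial_fraction r (partial_fraction r).
Proof.
move=> nd; rewrite /partial_fraction; case: xgetP => [? _ //|/forallNP]; apply.
set q := rat_den r in nd *; have q0 : q != 0 := rat_den_neq0 r.
have := erefl (rat_poles r); rewrite {2}/rat_poles -/q.
case: closed_field_poly_normal => s /= qE.
have lc0 : lead_coef q != 0 by rewrite lead_coef_eq0.
move: (lead_coef q) qE lc0 => lc qE lc0.
have c0 : lc^-1 != 0 by rewrite invr_eq0.
have sz : (size (lc^-1 *: rat_num r) <= (size s).+1)%N.
  by rewrite size_scale // (leq_trans nd) // qE size_scale // size_prod_XsubC.
have [d dE] := prod_XsubC_pfrac sz => polesE.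
exists d; rewrite /is_partial_fraction polesE -/q.
have -> : r = (lc^-1 *: rat_num r)%:F
              / (\prod_(z <- s) ('X - z%:P))%:F.
  have -> : \prod_(z <- s) ('X - z%:P) = lc^-1 *: q.
    by rewrite [in RHS]qE scalerA mulVf // scale1r.
  rewrite -!mul_polyC !rmorphM /= -mulf_div divff ?mul1r ?tofrac_eq0 ?polyC_eq0//.
  exact: rat_numdenE.
rewrite dE; congr (_ + _); apply: eq_bigr => l _.
congr (\sum_(1 <= m < _.+1) _); rewrite [in RHS]qE.
by rewrite -mul_polyC mupMr ?rootC // mu_prod_XsubC.
Qed.
End RationalFunctions.

Section Sectors.
Variable R : realType.
Implicit Types (z : R[i]) (al : R).

(* The principal argument, in ]-pi, pi]; only meaningful for [z != 0]. *)
Definition carg z : R :=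
  let t := acos (complex.Re z / Normc.normc z) in
  if 0 <= complex.Im z then t else - t.

Lemma cargP z : z != 0 -> [/\ - pi < carg z, carg z <= pi &
  z = (Normc.normc z)%:C * (cos (carg z) +i* sin (carg z))].
Proof.
move=> z0; set n := Normc.normc z.
have n0 : 0 < n.
  rewrite lt_neqAle eq_sym; apply/andP; split.
    by apply: contraNneq z0 => /Normc.eq0_normc ->.
  by rewrite /n; case: (z) => a b; exact: sqrtr_ge0.
have nn : n ^+ 2 = complex.Re z ^+ 2 + complex.Im z ^+ 2.
  by rewrite /n; case: (z) => a b /=; rewrite sqr_sqrtr // addr_ge0 ?sqr_ge0.
set x := complex.Re z / n.
have x2 : 1 - x ^+ 2 = (complex.Im z / n) ^+ 2.
  rewrite /x !expr_div_n -{1}(@divff _ (n ^+ 2)) ?expf_neq0 ?gt_eqF //.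
  by rewrite -mulrBl {1}nn addrAC subrr add0r.
have x1 : -1 <= x <= 1.
  by rewrite -ler_norml -[leRHS]sqrtr1 -sqrtr_sqr ler_wsqrtr // -subr_ge0 x2
    sqr_ge0.
have acosx : cos (acos x) = x by rewrite acosK // in_itv.
have sinx : sin (acos x) = `|complex.Im z| / n.
  by rewrite sin_acos // x2 sqrtr_sqr normrM normfV (gtr0_norm n0).
have zE s : s = complex.Im z / n -> z = n%:C * (x +i* s).
  move=> ->; rewrite /x; case: (z) => a b /=; simpc.
  by rewrite ![n * _]mulrC !divfK ?gt_eqF.
rewrite /carg -/n -/x; case: ifPn => [i0|].
  split; last by rewrite acosx; apply: zE; rewrite sinx ger0_norm.
    by rewrite (lt_le_trans _ (acos_ge0 x1)) // oppr_lt0 pi_gt0.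
  exact: acos_lepi.
rewrite -ltNge => i0; split.
- rewrite ltrN2 acos_ltpi // (andP x1).2 andbT lt_neqAle (andP x1).1 andbT.
  apply/eqP => xN; move: x2; rewrite -xN sqrrN expr1n subrr => /esym/eqP.
  by rewrite expf_eq0 /= mulf_eq0 invr_eq0 (lt_eqF i0) (gt_eqF n0).
- by rewrite (le_trans _ (pi_ge0 _)) // oppr_le0 acos_ge0.
- rewrite cosN sinN acosx; apply: zE; rewrite sinx ltr0_norm //.
  by rewrite mulNr opprK.
Qed.

Definition sector al : set R[i] := [set z | z != 0 /\ `|carg z| < al].

(* [R[i]^o] is [R[i]] equipped with its usual topology. *)
Definition closed_sector al : set R[i] := closure (sector al : set R[i]^o).

(* Neighbourhoods of the point at infinity of the Riemann sphere. *)
Definition cinfty : set_system R[i] :=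
  filter_from [set: R] (fun M => [set z | M%:C < `|z|]).

Definition rat_infty (r : {fraction {poly R[i]}}) : R[i] :=
  lim ((rat_eval r z : R[i]^o) @[z --> cinfty]).

Definition Astable (psi : R) (r : {fraction {poly R[i]}}) : Prop :=
  forall z, sector psi z -> (rat_den r).[z] != 0 /\ `|rat_eval r z| <= 1.

End Sectors.

Section Operators.
Variables (R : realType) (X : completeNormedModType R[i]).

(* Linear operators defined on a linear subspace of [X]; the values of
   [op_fun] outside [op_dom] are irrelevant. *)
Record operator := Operator {
  op_dom : set X;
  op_fun :> X -> X;
  op_dom0 : op_dom 0;
  op_domP : forall (a : R[i]) x y,
    op_dom x -> op_dom y -> op_dom (a *: x + y);
  op_funP : forall (a : R[i]) x y,
    op_dom x -> op_dom y -> op_fun (a *: x + y) = a *: op_fun x + op_fun y }.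

Implicit Types A B : operator.

Program Definition shift_op (l : R[i]) A : operator :=
  @Operator (op_dom A) (fun x => l *: x + A x) (op_dom0 A) (@op_domP A) _.
Next Obligation.
move=> l A a x y Ax Ay /=; rewrite op_funP // !scalerDr !scalerA [l * a]mulrC.
by rewrite addrACA.
Qed.

Program Definition scale_op (c : R[i]) A : operator :=
  @Operator (op_dom A) (fun x => c *: A x) (op_dom0 A) (@op_domP A) _.
Next Obligation.
by move=> c A a x y Ax Ay /=; rewrite op_funP // scalerDr !scalerA [c * a]mulrC.
Qed.

Definition op_inv A : X -> X := pinv (op_dom A) A.

Definition boundedly_invertible A : Prop :=
  set_bij (op_dom A) setT A /\ continuous (op_inv A).

Definition spectrum A : set R[i] :=
  [set l | ~ boundedly_invertible (shift_op (- l) A)].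

Definition closed_op A : Prop :=
  closed [set p : X * X | op_dom A p.1 /\ p.2 = A p.1].

(* The norm of [X] takes its values in [R[i]] (it is real and nonnegative). *)
Definition opnorm (T : X -> X) : \bar R :=
  ereal_sup [set (complex.Re `|T x|)%:E | x in [set x : X | `|x| <= 1]].

Definition Msect (theta : R) A : \bar R :=
  ereal_sup [set opnorm (fun x => l *: op_inv (shift_op l A) x)
            | l in sector (pi - theta)].

Definition sectorial (phi : R) A : Prop :=
  [/\ closed_op A, dense (op_dom A), spectrum A `<=` closed_sector phi &
      forall theta, phi < theta < pi -> (Msect theta A < +oo)%E].

(* [r(A)], obtained by replacing [(X - l)^-m] with [(A - l)^-m] in the partial
   fraction expansion of [r]. *)
Definition rat_op (r : {fraction {poly R[i]}}) A (x : X) : X :=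
  let: (c, a) := partial_fraction r in
  c *: x + \sum_(l <- rat_poles r) \sum_(1 <= m < (mup l (rat_den r)).+1)
             a l m *: iter m (op_inv (shift_op (- l) A)) x.

End Operators.

(* Main.v *)
Require Import Defs.
From HB Require Import structures.
From mathcomp Require Import all_boot all_order all_algebra.
From mathcomp Require Import complex.
From mathcomp Require Import all_classical all_reals all_analysis.
From mathcomp Require Import ring lra.
From Stdlib Require PeanoNat.

Set Implicit Arguments.
Unset Strict Implicit.
Unset Printing Implicit Defensive.

Import Order.TTheory GRing.Theory Num.Theory.
Import numFieldNormedType.Exports.
Local Open Scope classical_set_scope.
Local Open Scope ring_scope.
Local Open Scope complex_scope.

(** The function [f(z) = \prod_j r(k_j z)] has modulus at most 1, but on the rays
    [arg z = +- be], with [theta < be < psi], its integral for [d|z| / |z|] is not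
    bounded uniformly in the [k_j], even after subtraction of its values at 0 and
    at infinity: if the [k_j] are widely spread, it has many intermediate
    plateaus.

    Two ideas give a bound that is uniform in the [k_j] and linear in the
    constant [M] of [A].

    The scalar part orders the steps decreasingly and replaces, one factor at a
    time, [r(k_j z)] by [r(oo)] ([sorted_decomposition]). Each replacement costs
    a product whose largest factor decays at infinity, and such a product is a
    multiple of [1 / (1 + tau z)] plus a function whose integral along the rays
    is bounded by a constant ([largest_step]). The costs are weighted by powers
    of [|r(oo)| < 1], so their sum is bounded. The integrability near 0 rests on
    the local behaviour of [r] there: if [|r(0)| = 1], then on rays inside the
    sector [|r(z)| <= 1 - c |z|^p] near 0, where [p] is the order to which [r]
    takes the value [r(0)] ([vertex_bound]); away from 0 the maximum principle
    gives [|r| < 1] ([stable_lt1]).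

    The operator part shows [|g(A) x| <= C M (\int |g| d|z| / |z|) |x|] when [g]
    vanishes at 0 and at infinity ([fcalc_bound]). This is the bound that
    Cauchy's integral formula gives, but no vector-valued integral is used:
    contour integrals are finite sums over geometric grids, and Cauchy's theorem
    becomes the statement that, for a regular function that decays at 0 and at
    infinity, the sums over two rays of the [s]-th grid differ by [O(1/s)],
    because the sum around a cell of a polar mesh is of third order
    ([rotation]). That [g(A)] is computed by the contour sums is encoded in the
    predicate [fcalc], which holds for resolvents and is stable under sums and
    products. The constant [2 i pi] is replaced by a scalar contour sum that is
    only bounded from below ([kern_sum]). *)

(** * The norm as a real number *)

Section RealNorm.
Context {R : realType}.

(** The norm of [R[i]]-normed modules is [R[i]]-valued; [nrm] is the same
    number seen in [R]. *)
Definition nrm {V : normedZmodType R[i]} (x : V) : R := complex.Re `|x|.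

Section Zmod.
Context {V : normedZmodType R[i]}.
Implicit Types x y : V.

Lemma nrmE x : `|x| = (nrm x)%:C.
Proof. by rewrite /nrm RRe_real // ger0_real. Qed.

Lemma nrm_ge0 x : 0 <= nrm x.
Proof. by rewrite -ler0c -nrmE. Qed.

Lemma nrmD x y : nrm (x + y) <= nrm x + nrm y.
Proof. by rewrite -lecR rmorphD /= -!nrmE ler_normD. Qed.

Lemma nrmN x : nrm (- x) = nrm x.
Proof. by rewrite /nrm normrN. Qed.

Lemma nrmB x y : nrm (x - y) <= nrm x + nrm y.
Proof. by rewrite -(nrmN y) nrmD. Qed.

Lemma nrm_distC x y : nrm (x - y) = nrm (y - x).
Proof. by rewrite -nrmN opprB. Qed.

Lemma nrm0 : nrm (0 : V) = 0.
Proof. by rewrite /nrm normr0. Qed.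

Lemma nrm_eq0 x : (nrm x == 0) = (x == 0).
Proof. by rewrite -(normr_eq0 x) nrmE eq_complex /= eqxx andbT. Qed.

Lemma nrm_gt0 x : (0 < nrm x) = (x != 0).
Proof. by rewrite lt_def nrm_ge0 andbT nrm_eq0. Qed.

Lemma nrm_sum (I : Type) (s : seq I) (F : I -> V) :
  nrm (\sum_(i <- s) F i) <= \sum_(i <- s) nrm (F i).
Proof.
elim: s => [|i s IH]; first by rewrite !big_nil nrm0.
by rewrite !big_cons (le_trans (nrmD _ _)) // lerD2l.
Qed.
End Zmod.

Lemma nrmZ {V : normedModType R[i]} (a : R[i]) (x : V) :
  nrm (a *: x) = nrm a * nrm x.
Proof. by rewrite {1}/nrm normrZ !nrmE -rmorphM. Qed.

Lemma nrm1 : nrm (1 : R[i]) = 1.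
Proof. by rewrite /nrm normr1. Qed.

Implicit Types (z w : R[i]) (t : R).

Lemma nrmM z w : nrm (z * w) = nrm z * nrm w.
Proof. by rewrite {1}/nrm normrM !nrmE -rmorphM. Qed.

Lemma nrmV z : nrm z^-1 = (nrm z)^-1.
Proof. by rewrite {1}/nrm normfV !nrmE -fmorphV. Qed.

Lemma nrm_div z w : nrm (z / w) = nrm z / nrm w.
Proof. by rewrite nrmM nrmV. Qed.

Lemma nrmX z n : nrm (z ^+ n) = nrm z ^+ n.
Proof. by rewrite {1}/nrm normrX !nrmE -rmorphXn. Qed.

Lemma nrm_real t : nrm (t%:C) = `|t|.
Proof. by rewrite /nrm normc_def /= expr0n /= addr0 sqrtr_sqr. Qed.

Lemma nrm_sqr z : nrm z ^+ 2 = complex.Re z ^+ 2 + complex.Im z ^+ 2.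
Proof.
by rewrite /nrm normc_def /= sqr_sqrtr // addr_ge0 // sqr_ge0.
Qed.

Lemma nrmEnormc z : nrm z = Normc.normc z.
Proof. by []. Qed.

Lemma Re_le_nrm z : `|complex.Re z| <= nrm z.
Proof.
rewrite -(ler_sqr (normr_ge0 _) (nrm_ge0 _)) -normrX ger0_norm ?sqr_ge0 //.
by rewrite nrm_sqr lerDl sqr_ge0.
Qed.

Lemma Im_le_nrm z : `|complex.Im z| <= nrm z.
Proof.
rewrite -(ler_sqr (normr_ge0 _) (nrm_ge0 _)) -normrX ger0_norm ?sqr_ge0 //.
by rewrite nrm_sqr lerDr sqr_ge0.
Qed.

Lemma nrmDZl z w : nrm z - nrm w <= nrm (z + w).
Proof.
by rewrite lerBlDr -{1}(addrK w z); apply: (le_trans (nrmB _ _)).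
Qed.

End RealNorm.

(** * Sectors of the complex plane *)

Section Sectors.
Context {R : realType}.
Implicit Types (t s rho : R) (z w : R[i]).

(** The point of the unit circle at angle [t]. *)
Definition cis t : R[i] := cos t +i* sin t.

Lemma cisD t s : cis (t + s) = cis t * cis s.
Proof. by rewrite /cis cosD sinD; simpc; congr (_ +i* _); ring. Qed.

Lemma cis0 : cis 0 = 1.
Proof. by rewrite /cis cos0 sin0. Qed.

Lemma cisX t n : cis t ^+ n = cis (n%:R * t).
Proof.
elim: n => [|n IH]; first by rewrite mul0r cis0.
by rewrite exprS IH -cisD; congr cis; rewrite -natr1; ring.
Qed.

Lemma nrm_cis t : nrm (cis t) = 1.
Proof.
apply/eqP; rewrite -(@eqrXn2 _ 2) ?nrm_ge0 //.
by rewrite nrm_sqr /= cos2Dsin2 expr1n.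
Qed.

Lemma nrm_polar rho t : 0 < rho -> nrm (rho%:C * cis t) = rho.
Proof. by move=> r0; rewrite nrmM nrm_cis nrm_real mulr1 gtr0_norm. Qed.

Lemma polarP z : z != 0 -> exists t, [/\ `|t| <= pi, t = carg z &
  z = (nrm z)%:C * cis t].
Proof.
move=> z0; have [a b c] := cargP z0; exists (carg z); split=> //.
by rewrite ler_norml (ltW a) b.
Qed.

Lemma sin_le t : 0 <= t -> sin t <= t.
Proof.
rewrite le_eqVlt => /predU1P[<-|t0]; first by rewrite sin0.
have [c _] : exists2 c, c \in `]0, t[ & sin t - sin 0 = cos c * (t - 0).
  apply: (@MVT R sin cos 0 t t0).
  by apply: continuous_subspaceT => x; exact: continuous_sin.
rewrite sin0 !subr0 => ->; rewrite ger_pMl //; exact: cos_le1.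
Qed.

Lemma sin_norm_le t : `|sin t| <= `|t|.
Proof.
have P (u : R) : 0 <= u -> `|sin u| <= u.
  move=> u0; rewrite ler_norml. rewrite sin_le // andbT.
  have [u1|u1] := leP 1 u.
    by apply: le_trans (sin_geN1 u); rewrite lerN2.
  rewrite (@le_trans _ _ 0) // ?oppr_le0 // sin_ge0_pi // u0 /=.
  by have := pi_ge2 R; lra.
have [t0|t0] := leP 0 t; first by rewrite [`|t|]ger0_norm ?P.
rewrite -[t in sin t]opprK sinN normrN [`|t|]ltr0_norm //.
by apply: P; rewrite oppr_ge0 ltW.
Qed.

Lemma cis_near1 t : nrm (cis t - 1) <= `|t|.
Proof.
rewrite -(ler_sqr (nrm_ge0 _) (normr_ge0 _)) nrm_sqr /= subr0.
have -> : (cos t - 1) ^+ 2 + sin t ^+ 2 = (2 * sin (t / 2)) ^+ 2.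
  have e := cos2Dsin2 t.
  have : cos t = 1 - 2 * sin (t / 2) ^+ 2.
    have -> : cos t = cos (t/2 + t/2) by congr cos; field.
    rewrite cosD; have := cos2Dsin2 (t/2); nra.
  have -> : (cos t - 1) ^+ 2 + sin t ^+ 2 = 2 - 2 * cos t by nra.
  by move=> ->; ring.
rewrite -[leLHS]real_normK ?num_real // ler_sqr ?nnegrE ?normr_ge0 //.
rewrite normrM ger0_norm // -ler_pdivlMl // mulrC.
by rewrite (le_trans (sin_norm_le _)) // normrM [`|2^-1|]ger0_norm // invr_ge0.
Qed.

(** A linear functional separating sectors: on the ray at angle [t] it equals
    [|z| * sin (al - |t|)]. *)
Definition sepf al z : R :=
  sin al * complex.Re z - cos al * `|complex.Im z|.

Lemma sepf_polar al rho t : 0 <= rho -> `|t| <= pi ->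
  sepf al (rho%:C * cis t) = rho * sin (al - `|t|).
Proof.
move=> r0 tpi; rewrite /sepf /cis; simpc => /=.
rewrite normrM ger0_norm // sinB.
rewrite cos_norm; have -> : sin `|t| = `|sin t|.
  have [t0|t0] := leP 0 t.
    by rewrite !ger0_norm // sin_ge0_pi // t0 (le_trans (ler_norm t)).
  rewrite ltr0_norm // sinN ler0_norm // -oppr_ge0 -sinN sin_ge0_pi //.
  by rewrite oppr_ge0 ltW //= -(ltr0_norm t0).
ring.
Qed.

Lemma sepfZ al c z : 0 <= c -> sepf al (c%:C * z) = c * sepf al z.
Proof.
move=> c0; case: z => x y; rewrite /sepf; simpc => /=.
by rewrite normrM ger0_norm //; ring.
Qed.

Lemma sepfN al z : sepf (pi - al) (- z) = - sepf al z.
Proof.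
rewrite /sepf [pi - al]addrC sinDpi cosDpi sinN cosN.
by case: z => x y /=; rewrite normrN; ring.
Qed.

Lemma sepf_lip al z w : sepf al z - sepf al w <= 2 * nrm (z - w).
Proof.
have H1 := Re_le_nrm (z - w); have H2 := Im_le_nrm (z - w).
have s1 := sin_geN1 al; have s2 := sin_le1 al.
have c1 := cos_geN1 al; have c2 := cos_le1 al.
have := lerB_dist (complex.Im z) (complex.Im w).
have := lerB_dist (complex.Im w) (complex.Im z).
rewrite [X in _ <= X]distrC.
case: z w H1 H2 => a b [c d] /=; rewrite /sepf /=.
set n := nrm _; rewrite !ler_norml => /andP[u1 u2] /andP[v1 v2].
move: s1 s2 c1 c2; set S := sin _; set C := cos _ => s1 s2 c1 c2.
set p := `|b|; set q := `|d|; set m := `|b - d| => h1 h2.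
have m1 : m <= n by rewrite /m ler_norml v1.
have hh : `|p - q| <= n by rewrite ler_norml; lra.
have kk : `|a - c| <= n by rewrite ler_norml; lra.
have -> : S * a - C * p - (S * c - C * q) = S * (a - c) - C * (p - q) by ring.
have A1 : S * (a - c) <= n.
  apply: le_trans (ler_norm _) _; rewrite normrM -[leRHS]mul1r ler_pM //.
  by rewrite ler_norml s1 s2.
have A2 : - (C * (p - q)) <= n.
  rewrite -mulNr; apply: le_trans (ler_norm _) _.
  rewrite normrM normrN -[leRHS]mul1r ler_pM //.
  by rewrite ler_norml c1 c2.
lra.
Qed.

Lemma sectorP (al : R) z : 0 < al < pi -> (sector al z) <-> 0 < sepf al z.
Proof.
move=> /andP[a0 api]; split.
  move=> [z0 za]; have [t [tpi te ->]] := polarP z0.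
  rewrite sepf_polar ?nrm_ge0 // mulr_gt0 ?nrm_gt0 //.
  by rewrite sin_gt0_pi // te; have := normr_ge0 (carg z); lra.
move=> h; have z0 : z != 0.
  by apply: contraTneq h => ->; rewrite /sepf /= normr0 !mulr0 subrr ltxx.
split=> //; have [t [tpi te ze]] := polarP z0.
rewrite -te ltNge; apply: contraTN h => le; rewrite -leNgt ze.
rewrite sepf_polar ?nrm_ge0 // mulr_ge0_le0 ?nrm_ge0 //.
rewrite -[al - _]opprB sinN oppr_le0 sin_ge0_pi //.
lra.
Qed.

Lemma sin_lower (a b : R) : 0 < a -> b < pi ->
  exists2 c : R, 0 < c & forall x : R, a <= x -> x <= b -> c <= sin x.
Proof.
move=> a0 bpi; have p0 := pi_gt0 R; have [ab|ab] := leP a b; last first.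
  by exists 1 => // x ax xb; have := le_trans ax xb; lra.
pose m : R := Num.max `|a - pi / 2| `|b - pi / 2|.
have m0 : 0 <= m by rewrite le_max normr_ge0.
have mp : m < pi / 2.
  by rewrite gt_max !ltr_norml; do 2?[apply/andP; split]; lra.
exists (cos m) => [|x ax xb].
  by rewrite cos_gt0_pihalf // mp andbT; lra.
have -> : sin x = cos `|x - pi / 2| by rewrite cos_norm cosBpihalf.
have xm : `|x - pi / 2| <= m.
  have ma : - (a - pi / 2) <= m by rewrite le_max -normrN ler_norm.
  have mb : b - pi / 2 <= m by rewrite le_max ler_norm orbT.
  by rewrite ler_norml; apply/andP; split; lra.
have xp : `|x - pi / 2| <= pi by lra.
rewrite leNgt ltr_cos -?leNgt ?in_itv /= ?normr_ge0 ?xp //.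
by rewrite m0; lra.
Qed.

(** Points in a sector keep away, relative to their size, from points outside
    a larger sector. *)
Lemma sector_dist (al be : R) : 0 <= al -> al < be -> be <= pi ->
  exists2 c : R, 0 < c & forall rho t sg s : R, 0 <= rho -> 0 <= sg ->
    `|t| <= al -> be <= `|s| <= pi ->
    c * (rho + sg) <= nrm (rho%:C * cis t - sg%:C * cis s).
Proof.
move=> a0 ab bpi; pose g : R := (al + be) / 2.
have gE : g = (al + be) / 2 by [].
have g1 : 0 < g - al by lra.
have g2 : 0 < be - g by lra.
have g3 : g < pi by lra.
have g4 : pi - g < pi by lra.
have [c1 c10 H1] := sin_lower g1 g3.
have [c2 c20 H2] := sin_lower g2 g4.
exists (Num.min c1 c2 / 2); first by rewrite divr_gt0 // lt_min c10.
move=> rho t sg s rho0 sg0 ta /andP[sb spi].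
have tpi : `|t| <= pi by lra.
have := sepf_lip g (rho%:C * cis t) (sg%:C * cis s); rewrite !sepf_polar //.
have {}H1 : c1 <= sin (g - `|t|).
  by apply: H1; have := normr_ge0 t; lra.
have {}H2 : c2 <= - sin (g - `|s|).
  by rewrite -sinN; apply: H2; lra.
have : Num.min c1 c2 <= c1 by rewrite ge_min lexx.
have : Num.min c1 c2 <= c2 by rewrite ge_min lexx orbT.
move: (Num.min _ _) (sin _) (sin _) H1 H2 => m u v; nra.
Qed.
End Sectors.

(** * Linear combinations of vectors *)

(** Equalities between linear combinations of vectors are reduced by reflection
    to equalities between their scalar coefficients. *)
Inductive vexp (K : Type) :=
  | VVar of nat | VZero | VAdd of vexp K & vexp K | VOpp of vexp K
  | VScale of K & vexp K.
Arguments VVar {K}.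
Arguments VZero {K}.

Section Vexp.
Variables (K : pzRingType) (V : lmodType K).

Fixpoint veval (env : seq V) (e : vexp K) : V := match e with
  | VVar n => env`_n
  | VZero => 0
  | VAdd e1 e2 => veval env e1 + veval env e2
  | VOpp e => - veval env e
  | VScale a e => a *: veval env e
  end.

Fixpoint vcoef (e : vexp K) (n : nat) : K := match e with
  | VVar m => if Nat.eqb m n then 1 else 0
  | VZero => 0
  | VAdd e1 e2 => vcoef e1 n + vcoef e2 n
  | VOpp e => - vcoef e n
  | VScale a e => a * vcoef e n
  end.

Fixpoint vcoef_eq (n : nat) (e1 e2 : vexp K) : Prop := match n with
  | 0%N => True
  | S n => vcoef e1 n = vcoef e2 n /\ vcoef_eq n e1 e2
  end.

Lemma vevalE env e : veval env e = \sum_(i < size env) vcoef e i *: env`_i.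
Proof.
elim: e => [n| |e1 IH1 e2 IH2|e IH|a e IH] /=.
- have [nE|nE] := ltnP n (size env); last first.
    rewrite nth_default // big1 // => i _; case: PeanoNat.Nat.eqb_spec => [ni|_].
      by move: nE; rewrite ni leqNgt ltn_ord.
    by rewrite scale0r.
  rewrite (bigD1 (Ordinal nE)) //= PeanoNat.Nat.eqb_refl scale1r big1 ?addr0 // => i ni.
  case: PeanoNat.Nat.eqb_spec => [ni'|_]; last by rewrite scale0r.
  by case/eqP: ni; apply: val_inj.
- by rewrite big1 // => i _; rewrite scale0r.
- by rewrite IH1 IH2 -big_split; apply: eq_bigr => i _; rewrite scalerDl.
- by rewrite IH -sumrN; apply: eq_bigr => i _; rewrite scaleNr.
- by rewrite IH scaler_sumr; apply: eq_bigr => i _; rewrite scalerA.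
Qed.

Lemma veval_eq env e1 e2 : vcoef_eq (size env) e1 e2 ->
  veval env e1 = veval env e2.
Proof.
move=> h; rewrite !vevalE; apply: eq_bigr => i _; congr (_ *: _).
move: h (ltn_ord i); move: (size env) (nat_of_ord i) => n m.
elim: n => // n IH /= [h1 h2]; rewrite ltnS leq_eqVlt => /predU1P[->//|].
exact: IH.
Qed.
End Vexp.

Ltac vmem x l := lazymatch l with
  | nil => constr:(false)
  | cons x _ => constr:(true)
  | cons _ ?l' => vmem x l'
  end.
Ltac vidx x l := lazymatch l with
  | cons x _ => constr:(O)
  | cons _ ?l' => let n := vidx x l' in constr:(S n)
  end.
Ltac vatoms e l := lazymatch e with
  | Algebra.add ?a ?b => let l1 := vatoms a l in vatoms b l1
  | Algebra.opp ?a => vatoms a l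
  | Algebra.zero => l
  | GRing.scale _ ?a => vatoms a l
  | _ => lazymatch vmem e l with true => l | false => constr:(cons e l) end
  end.
Ltac vreify K e l := lazymatch e with
  | Algebra.add ?a ?b => let u := vreify K a l in let v := vreify K b l in
      constr:(VAdd u v)
  | Algebra.opp ?a => let u := vreify K a l in constr:(VOpp u)
  | Algebra.zero => constr:(@VZero K)
  | GRing.scale ?c ?a => let u := vreify K a l in constr:(VScale c u)
  | _ => let n := vidx e l in constr:(@VVar K n)
  end.
Ltac vstep := lazymatch goal with
  | R : realType |- @eq ?T ?a ?b =>
    let K := constr:(R[i] : Type) in
    let l0 := vatoms a (@nil T) in let l := vatoms b l0 in
    let u := vreify K a l in let v := vreify K b l in
    apply: (@veval_eq _ _ l u v);
    cbn [vcoef_eq vcoef size Nat.eqb]; repeat split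
  end.
Ltac vring := vstep; ring.
Ltac vfield := vstep; field.

(** * Regular functions on sectors *)

Section Rotation.
Context {R : realType}.
Implicit Types (a z w : R[i]) (b L : R).

(** The closed sector of half-angle [b], without its vertex. *)
Definition sec b z : Prop :=
  exists rho t : R, [/\ 0 < rho, `|t| <= b & z = rho%:C * cis t].

(** [F] is bounded on [S] and has, with respect to multiplicative increments,
    a first-order Taylor expansion with a uniform quadratic remainder. *)
Definition nice (S : R[i] -> Prop) (V : normedModType R[i]) (F : R[i] -> V) :=
  exists (L : R) (K : R[i] -> V), 0 <= L /\ forall z, S z ->
    [/\ nrm (F z) <= L, nrm (K z) <= L &
     forall a, nrm a <= 1 / 2 -> S ((1 + a) * z) ->
       nrm (F ((1 + a) * z) - F z - a *: K z) <= L * nrm a ^+ 2].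

Section Nice.
Variables (S : R[i] -> Prop) (V : normedModType R[i]).
Implicit Types (F G : R[i] -> V) (f : R[i] -> R[i]^o).

Lemma nice_cst (v : V) : nice S (fun=> v).
Proof.
exists (nrm v), (fun=> 0); split=> [|z _]; first exact: nrm_ge0.
split=> // [|a _ _]; first by rewrite nrm0 nrm_ge0.
by rewrite subrr scaler0 subrr nrm0 mulr_ge0 // ?sqr_ge0 ?nrm_ge0.
Qed.

Lemma nice_ext F G : (forall z, S z -> F z = G z) -> nice S F -> nice S G.
Proof.
move=> FG [L [K [L0 H]]]; exists L, K; split=> // z Sz.
have [h1 h2 h3] := H z Sz; split; rewrite -?FG // => a ha Sa.
by rewrite -!FG // h3.
Qed.

Lemma nice_add F G : nice S F -> nice S G -> nice S (fun z => F z + G z).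
Proof.
move=> [L [K [L0 H]]] [L' [K' [L0' H']]].
exists (L + L'), (fun z => K z + K' z); split=> [|z Sz]; first exact: addr_ge0.
have [h1 h2 h3] := H z Sz; have [h1' h2' h3'] := H' z Sz.
split; [exact: le_trans (nrmD _ _) (lerD _ _)..|].
move=> a ha Sa; rewrite scalerDr.
have -> : F ((1 + a) * z) + G ((1 + a) * z) - (F z + G z) - (a *: K z + a *: K' z)
  = (F ((1 + a) * z) - F z - a *: K z) + (G ((1 + a) * z) - G z - a *: K' z).
  by vring.
by rewrite [leRHS]mulrDl; apply: le_trans (nrmD _ _) _; apply: lerD; auto.
Qed.

Lemma nice_scale f F : nice S f -> nice S F -> nice S (fun z => f z *: F z).
Proof.
move=> [L [K [L0 H]]] [L' [K' [L0' H']]].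
exists (4 * L * L'), (fun z => K z *: F z + f z *: K' z).
split=> [|z Sz]; first by rewrite !mulr_ge0.
have [h1 h2 h3] := H z Sz; have [h1' h2' h3'] := H' z Sz.
have P u (x : V) l l' : nrm u <= l -> nrm x <= l' -> nrm (u *: x) <= l * l'.
  by move=> hu hx; rewrite nrmZ ler_pM ?nrm_ge0.
have LL : 0 <= L * L' by exact: mulr_ge0.
split.
- by apply: le_trans (P _ _ _ _ h1 h1') _; lra.
- apply: le_trans (nrmD _ _) _.
  have := P _ _ _ _ h2 h1'; have := P _ _ _ _ h1 h2'; lra.
move=> a ha Sa; set w := (1 + a) * z.
have [g1 g2 _] := H w Sa; have [g1' g2' _] := H' w Sa.
have d1 := h3 a ha Sa; have d2 := h3' a ha Sa; rewrite -/w in d1 d2.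
have -> : f w *: F w - f z *: F z - a *: (K z *: F z + f z *: K' z) =
   f w *: (F w - F z - a *: K' z) + (f w - f z - a * K z) *: F z +
   (a * (f w - f z)) *: K' z.
  by vring.
have da : nrm (f w - f z) <= L + L by apply: le_trans (nrmB _ _) (lerD _ _).
apply: le_trans (nrmD _ _) _; apply: le_trans (lerD (nrmD _ _) (lexx _)) _.
have e1 := P _ _ _ _ g1 d2; have e2 := P _ _ _ _ d1 h1'.
have df : nrm (f w - f z) <= nrm a * (2 * L).
  have -> : f w - f z = (f w - f z - a * K z) + a * K z by rewrite subrK.
  apply: le_trans (nrmD _ _) _; rewrite nrmM.
  have d1' : nrm (f w - f z - a * K z) <= L * nrm a ^+ 2 := d1.
  apply: le_trans (lerD d1' (ler_wpM2l (nrm_ge0 a) h2)) _.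
  have := nrm_ge0 a; have := mulr_ge0 L0 (nrm_ge0 a); nra.
have e3 : nrm ((a * (f w - f z)) *: K' z) <= nrm a * (nrm a * (2 * L)) * L'.
  apply: P => //; rewrite nrmM ler_wpM2l ?nrm_ge0 //.
apply: le_trans (lerD (lerD e1 e2) e3) _.
by rewrite le_eqVlt; apply/orP; left; apply/eqP; ring.
Qed.
End Nice.

End Rotation.

(** * Discretised contours and Cauchy's theorem *)

Section Rotation.
Context {R : realType}.
Implicit Types (a z w : R[i]) (b L : R).

Section Grid.
Implicit Types (s : nat) (j : nat).

(** The ratio of the grid. *)
Definition gstep s : R := 1 + (s%:R ^+ 2)^-1.

(** A geometric grid on the half-line, for [0 <= j <= 2 * s ^ 3], with ratio
    [1 + s ^ -2] and centred at 1. As [s] grows it gets finer and, since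
    [(1 + s ^ -2) ^ (s ^ 3) >= s], exhausts the half-line. *)
Definition gpt s j : R := gstep s ^+ j / gstep s ^+ (s ^ 3).

(** [s ^ -2] times this sum is a Riemann sum for the integral of [F] with
    respect to the scale-invariant measure [d rho / rho]. *)
Definition grid s {V : nmodType} (F : R -> V) : V :=
  \sum_(j < 2 * s ^ 3) F (gpt s j).

Lemma gstep_gt1 s : (0 < s)%N -> 1 < gstep s.
Proof. by move=> s0; rewrite ltrDl invr_gt0 exprn_gt0 // ltr0n. Qed.

Lemma gstep_gt0 s : 0 < gstep s.
Proof. by rewrite ltr_pwDl // invr_ge0 sqr_ge0. Qed.

Lemma gpt_gt0 s j : 0 < gpt s j.
Proof. by rewrite divr_gt0 // exprn_gt0 // gstep_gt0. Qed.

Lemma gptS s j : gpt s j.+1 = gstep s * gpt s j.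
Proof. by rewrite /gpt exprS mulrA. Qed.

Lemma gpt_exhaust s : (0 < s)%N -> s%:R <= gstep s ^+ (s ^ 3).
Proof.
move=> s0; have s1 : 0 < s%:R :> R by rewrite ltr0n.
have bern x n : 0 <= x -> 1 + n%:R * x <= (1 + x) ^+ n :> R.
  move=> x0; elim: n => [|n IH]; first by rewrite mul0r addr0 expr0.
  rewrite exprS -natr1; have := ler0n R n.
  have := exprn_ge0 n (addr_ge0 ler01 x0); nra.
apply: le_trans (bern _ _ _); last by rewrite invr_ge0 sqr_ge0.
have -> : (s ^ 3)%:R * (s%:R ^+ 2)^-1 = s%:R :> R.
  by rewrite natrX; field; rewrite gt_eqF.
by rewrite lerDr.
Qed.

Lemma gstep_sub1 s : gstep s - 1 = (s%:R ^+ 2)^-1.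
Proof. by rewrite /gstep addrAC subrr add0r. Qed.

Lemma gpt0 s : gpt s 0 = (gstep s ^+ (s ^ 3))^-1.
Proof. by rewrite /gpt expr0 mul1r. Qed.

Lemma gpt_last s : gpt s (2 * s ^ 3) = gstep s ^+ (s ^ 3).
Proof.
rewrite /gpt mul2n -addnn exprD mulfK // gt_eqF //.
by rewrite exprn_gt0 // gstep_gt0.
Qed.

Lemma grid_add s (V : nmodType) (F G : R -> V) :
  grid s (fun x => F x + G x) = grid s F + grid s G.
Proof. exact: big_split. Qed.

Lemma grid_nrm s (V : normedModType R[i]) (F : R -> V) :
  nrm (grid s F) <= grid s (fun x => nrm (F x)).
Proof. exact: nrm_sum. Qed.

Lemma grid_le s (F G : R -> R) :
  (forall x, 0 < x -> F x <= G x) -> grid s F <= grid s G.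
Proof. by move=> h; apply: ler_sum => j _; apply: h; exact: gpt_gt0. Qed.

Lemma grid_scale s c (F : R -> R) : grid s (fun x => c * F x) = c * grid s F.
Proof. by rewrite /grid mulr_sumr. Qed.

(** On the grid the points form a geometric progression, so that this sum is
    dominated by a telescoping one. *)
Lemma grid_bump s (tau : R) : (0 < s)%N -> 0 < tau ->
  (s%:R ^+ 2)^-1 * grid s (fun x => tau * x / (1 + tau * x) ^+ 2) <= 2.
Proof.
move=> s0 tau0; pose psi (x : R) : R := tau * x / (1 + tau * x).
set q := gstep s; have q1 : 1 < q by exact: gstep_gt1.
have q2 : q <= 2.
  rewrite /q /gstep; suff : (s%:R ^+ 2)^-1 <= 1 :> R by lra.
  by rewrite invf_le1 ?exprn_gt0 ?ltr0n // exprn_ege1 // ler1n.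
rewrite -gstep_sub1 -/q.
have step x : 0 < x ->
    (q - 1) * (tau * x / (1 + tau * x) ^+ 2) <= q * (psi (q * x) - psi x).
  move=> x0; have y0 : 0 < tau * x by exact: mulr_gt0.
  rewrite /psi [tau * (q * x)]mulrCA; move: (tau * x) y0 => y y0.
  have h1 : 0 < 1 + y by lra.
  have h2 : 0 < 1 + q * y by nra.
  have -> : q * (q * y / (1 + q * y) - y / (1 + y)) =
     (q - 1) * (y / (1 + y) ^+ 2) * (q * (1 + y) / (1 + q * y)).
    by field; rewrite !gt_eqF.
  rewrite ler_peMr //; last by rewrite ler_pdivlMr // mul1r; lra.
  rewrite mulr_ge0 ?subr_ge0 ?(ltW q1) // divr_ge0 ?(ltW y0) //.
  by rewrite exprn_ge0 // ltW.
rewrite -grid_scale; apply: (@le_trans _ _ (q * 1)); last by rewrite mulr1.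
apply: (@le_trans _ _ (q * \sum_(j < 2 * s ^ 3) (psi (gpt s j.+1) - psi (gpt s j)))).
  rewrite mulr_sumr; apply: ler_sum => j _; rewrite gptS.
  exact/step/gpt_gt0.
rewrite ler_wpM2l; [by []|by lra|].
rewrite -(big_mkord xpredT (fun j => psi (gpt s j.+1) - psi (gpt s j))).
rewrite telescope_sumr //.
have psi0 x : 0 < x -> 0 <= psi x <= 1.
  move=> x0; have y0 : 0 < tau * x by exact: mulr_gt0.
  rewrite /psi divr_ge0 /=; try lra.
  by rewrite ler_pdivrMr; lra.
have := psi0 _ (gpt_gt0 s (2 * s ^ 3)); have := psi0 _ (gpt_gt0 s 0); lra.
Qed.
End Grid.

Section Rotate.
Variables (V : normedModType R[i]).
Implicit Type H : R[i] -> V.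

(** Discrete form of Cauchy's theorem in a sector: the sums over the two
    bounding rays nearly agree, because the sum around each small cell of a
    polar mesh is of third order in the mesh size. *)
Lemma rotation (b L : R) H : 0 < b -> nice (sec b) H ->
  (forall z, sec b z -> nrm (H z) <= L * nrm z /\ nrm (H z) * nrm z <= L) ->
  exists C : R, exists s0 : nat, forall s, (s0 <= s)%N -> (0 < s)%N ->
    nrm (((s%:R ^+ 2)^-1)%:C *: grid s (fun x => H (x%:C * cis b)
       - H (x%:C * cis (- b)))) <= C / s%:R.
Proof.
move=> b0 [L' [K [L'0 HK]]] Hd.
exists (4 * b * L + 4 * L' * (b + 2 * b ^+ 2)).
have [s0 s0b] : exists s0 : nat, 4 * b + 2 <= s0%:R.
  exists (Num.bound (4 * b + 2)); apply/ltW.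
  by apply: archi_boundP; lra.
exists s0 => s ss s1.
have sR : 1 <= s%:R :> R by rewrite ler1n.
have sb : 4 * b + 2 <= s%:R by apply: le_trans s0b _; rewrite ler_nat.
set a : R := (s%:R ^+ 2)^-1.
have a0 : 0 < a by rewrite invr_gt0 exprn_gt0 //; lra.
have as2 : a * s%:R ^+ 2 = 1 by rewrite mulVf // gt_eqF // exprn_gt0 //; lra.
pose m := (s ^ 2)%N; pose N := (2 * s ^ 3)%N.
pose om : R[i] := cis (2 * b * a); pose be : R[i] := om - 1.
have be_le : nrm be <= 2 * b * a.
  apply: le_trans (cis_near1 _) _; rewrite ger0_norm // mulr_ge0 ?(ltW a0) //; lra.
have a12 : a <= 1 / 2 by nra.
have be12 : nrm be <= 1 / 2.
  apply: le_trans be_le _; nra.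
pose ang k : R := - b + 2 * b * a * k%:R.
pose P j k : R[i] := (gpt s j)%:C * cis (ang k).
pose h j k := H (P j k).
have Psec j k : (k <= m)%N -> sec b (P j k).
  move=> km; exists (gpt s j), (ang k); split=> //; first exact: gpt_gt0.
  have k0 : 0 <= k%:R :> R by [].
  have km' : k%:R <= s%:R ^+ 2 :> R by rewrite -natrX ler_nat.
  have ak0 : 0 <= a * k%:R by exact: mulr_ge0 (ltW a0) k0.
  have ak1 : a * k%:R <= 1.
    by have := ler_wpM2l (ltW a0) km'; rewrite as2.
  have w1 := mulr_ge0 (ltW b0) ak0; have w2 := ler_wpM2l (ltW b0) ak1.
  have -> : ang k = - b + 2 * (b * (a * k%:R)) by rewrite /ang; ring.
  move: (b * (a * k%:R)) w1 w2 => u w1 w2.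
  by rewrite ler_norml; apply/andP; split; lra.
have PSj j k : P j.+1 k = (1 + a%:C) * P j k.
  rewrite /P gptS mulrA; congr (_ * _).
  by rewrite rmorphM /gstep rmorphD.
have PSk j k : P j k.+1 = (1 + be) * P j k.
  rewrite /P /be addrCA subrr addr0 mulrCA; congr (_ * _).
  rewrite -cisD; congr cis; rewrite /ang -natr1; ring.
(* the sum of [H] around a cell; its first-order terms cancel *)
pose E j k := (a%:C - be) *: h j k + be *: h j.+1 k - a%:C *: h j k.+1.
have EB j k : (k < m)%N -> nrm (E j k) <= 2 * L' * (b + 2 * b ^+ 2) * a ^+ 3.
  move=> km; have Sz := Psec j k (ltnW km); have [_ _ T] := HK _ Sz.
  have T1 := T a%:C; have T2 := T be.
  rewrite -PSj in T1; rewrite -PSk in T2.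
  have na : nrm a%:C = a by rewrite nrm_real gtr0_norm.
  rewrite na in T1.
  have {}T1 := T1 a12 (Psec _ _ (ltnW km)); have {}T2 := T2 be12 (Psec _ _ km).
  have -> : E j k = be *: (H (P j.+1 k) - H (P j k) - a%:C *: K (P j k))
     - a%:C *: (H (P j k.+1) - H (P j k) - be *: K (P j k)).
    by rewrite /E /h; vring.
  apply: le_trans (nrmB _ _) _; rewrite !nrmZ na.
  have u1 := ler_pM (nrm_ge0 be) (nrm_ge0 _) be_le T1.
  have u2 := ler_wpM2l (ltW a0) T2.
  apply: le_trans (lerD u1 u2) _.
  have u3 : nrm be ^+ 2 <= (2 * b * a) ^+ 2.
    by rewrite ler_sqr ?nnegrE ?nrm_ge0 // !mulr_ge0 ?(ltW a0) ?(ltW b0).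
  have u4 := ler_wpM2l (mulr_ge0 (ltW a0) L'0) u3.
  apply: (@le_trans _ _ (2 * b * a * (L' * a ^+ 2) + a * L' * (2 * b * a) ^+ 2)).
    by rewrite lerD2l mulrA.
  by rewrite le_eqVlt; apply/orP; left; apply/eqP; ring.
(* in the sum over all cells only the boundary of the mesh remains *)
have tel : a%:C *: grid s (fun x => H (x%:C * cis b) - H (x%:C * cis (- b))) =
    be *: (\sum_(k < m) (h N k - h 0%N k)) - \sum_(j < N) \sum_(k < m) E j k.
  have -> : \sum_(j < N) \sum_(k < m) E j k =
      \sum_(j < N) \sum_(k < m) (be *: (h j.+1 k - h j k))
      - \sum_(j < N) \sum_(k < m) a%:C *: (h j k.+1 - h j k).
    rewrite -sumrB; apply: eq_bigr => j _; rewrite -sumrB; apply: eq_bigr => k _.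
    by rewrite /E; vring.
  rewrite [X in _ - (X - _)]exchange_big /=.
  have -> : \sum_(k < m) \sum_(j < N) be *: (h j.+1 k - h j k) =
      be *: (\sum_(k < m) (h N k - h 0%N k)).
    rewrite scaler_sumr; apply: eq_bigr => k _; rewrite -scaler_sumr.
    rewrite -(big_mkord xpredT (fun j => h j.+1 k - h j k)).
    by rewrite (telescope_sumr (fun j => h j k)).
  rewrite opprB addrC subrK /grid scaler_sumr; apply: eq_bigr => j _.
  rewrite -scaler_sumr -(big_mkord xpredT (fun k => h j k.+1 - h j k)).
  rewrite telescope_sumr // /h /P /ang mulr0 addr0.
  congr (_ *: (H (_ * cis _) - _)).
  by rewrite natrX -mulrA as2; ring.
rewrite tel; apply: le_trans (nrmB _ _) _; rewrite nrmZ.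
(* the two arcs, at distances at least [s] and at most [1 / s] from 0 *)
have D1 : nrm (\sum_(k < m) (h N k - h 0%N k)) <= s%:R ^+ 2 * (2 * (L / s%:R)).
  apply: le_trans (nrm_sum _ _) _.
  apply: (@le_trans _ _ (\sum_(k < m) (2 * (L / s%:R)))); last first.
    by rewrite sumr_const card_ord -[leLHS]mulr_natl natrX.
  apply: ler_sum => k _; apply: le_trans (nrmB _ _) _.
  have [A1 A2] := Hd _ (Psec N k (ltnW (ltn_ord k))).
  have [B1 B2] := Hd _ (Psec 0%N k (ltnW (ltn_ord k))).
  have ex := gpt_exhaust s1.
  rewrite !nrm_polar ?gpt_gt0 // -/(h _ _) in A1 A2 B1 B2.
  rewrite gpt_last in A2; rewrite gpt0 in B1.
  have sp : 0 < s%:R :> R by lra.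
  have q0 : 0 < gstep s ^+ (s ^ 3) by lra.
  have L0 : 0 <= L.
    rewrite -(pmulr_lge0 L (_ : 0 < (gstep s ^+ (s ^ 3))^-1)) ?invr_gt0 //.
    exact: le_trans (nrm_ge0 _) B1.
  have C1 : nrm (h N k) <= L / s%:R.
    rewrite ler_pdivlMr //; apply: le_trans _ A2.
    by rewrite ler_wpM2l ?nrm_ge0.
  have C2 : nrm (h 0%N k) <= L / s%:R.
    by apply: le_trans B1 _; rewrite ler_wpM2l // lef_pV2 ?posrE.
  by have := lerD C1 C2; rewrite [2 * _]mulr_natl mulr2n.
(* the [2 s ^ 5] cells, each contributing [O(s ^ -6)] *)
have D2 : nrm (\sum_(j < N) \sum_(k < m) E j k) <=
    2 * s%:R ^+ 3 * (s%:R ^+ 2 * (2 * L' * (b + 2 * b ^+ 2) * a ^+ 3)).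
  apply: le_trans (nrm_sum _ _) _.
  apply: (@le_trans _ _ (\sum_(j < N)
      (s%:R ^+ 2 * (2 * L' * (b + 2 * b ^+ 2) * a ^+ 3)))); last first.
    by rewrite sumr_const card_ord -[leLHS]mulr_natl natrM natrX.
  apply: ler_sum => j _; apply: le_trans (nrm_sum _ _) _.
  apply: (@le_trans _ _ (\sum_(k < m) (2 * L' * (b + 2 * b ^+ 2) * a ^+ 3))).
    by apply: ler_sum => k _; exact: EB.
  by rewrite sumr_const card_ord -[leLHS]mulr_natl natrX.
have D3 : nrm be * nrm (\sum_(k < m) (h N k - h 0%N k)) <= 4 * b * L / s%:R.
  apply: le_trans (ler_pM (nrm_ge0 _) (nrm_ge0 _) be_le D1) _.
  rewrite le_eqVlt; apply/orP; left; apply/eqP.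
  by rewrite /a; field; rewrite gt_eqF //; lra.
apply: le_trans (lerD D3 D2) _.
rewrite le_eqVlt; apply/orP; left; apply/eqP.
by rewrite /a; field; rewrite gt_eqF //; lra.
Qed.
End Rotate.
End Rotation.

(** * Orders of decay and resolvent kernels *)

Section BigO.
Context {R : realType}.
Variable S : R[i] -> Prop.

(** [F] is [O(w)], uniformly on [S]. *)
Definition bigO (w : R[i] -> R) (V : normedModType R[i]) (F : R[i] -> V) :=
  exists L : R, 0 <= L /\ forall z, S z -> nrm (F z) <= L * w z.

Implicit Type w : R[i] -> R.

Lemma bigO_add w (V : normedModType R[i]) (F G : R[i] -> V) :
  bigO w F -> bigO w G -> bigO w (fun z => F z + G z).
Proof.
move=> [L [L0 h]] [L' [L'0 h']]; exists (L + L'); split=> [|z Sz].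
  exact: addr_ge0.
by rewrite mulrDl; apply: le_trans (nrmD _ _) _; apply: lerD; auto.
Qed.

Lemma bigO_mul w w' (V : normedModType R[i]) (f : R[i] -> R[i]^o) (F : R[i] -> V) :
  bigO w f -> bigO w' F -> bigO (fun z => w z * w' z) (fun z => f z *: F z).
Proof.
move=> [L [L0 h]] [L' [L'0 h']]; exists (L * L'); split=> [|z Sz].
  exact: mulr_ge0.
rewrite nrmZ mulrACA; apply: ler_pM; rewrite ?nrm_ge0 //.
  exact: h.
exact: h'.
Qed.

Lemma bigO_ext w w' (V : normedModType R[i]) (F G : R[i] -> V) :
  (forall z, S z -> F z = G z) -> (forall z, S z -> w z = w' z) ->
  bigO w F -> bigO w' G.
Proof.
move=> FG ww [L [L0 h]]; exists L; split=> // z Sz.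
by rewrite -FG // -ww //; exact: h.
Qed.

Lemma bigO_cst (V : normedModType R[i]) (v : V) : bigO (fun=> 1) (fun=> v).
Proof. by exists (nrm v); split=> [|z _]; rewrite ?nrm_ge0 ?mulr1. Qed.

Lemma nice_bigO (V : normedModType R[i]) (F : R[i] -> V) :
  nice S F -> bigO (fun=> 1) F.
Proof.
by move=> [L [K [L0 h]]]; exists L; split=> // z /h[]; rewrite mulr1.
Qed.

Lemma bigO_mulv w (V : normedModType R[i]) (f : R[i] -> R[i]^o) (v : V) :
  bigO w f -> bigO w (fun z => f z *: v).
Proof.
move=> hf; apply: bigO_ext (bigO_mul hf (bigO_cst v)) => // z _.
by rewrite mulr1.
Qed.

Lemma bigO_bmul w (V : normedModType R[i]) (f : R[i] -> R[i]^o) (F : R[i] -> V) :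
  bigO (fun=> 1) f -> bigO w F -> bigO w (fun z => f z *: F z).
Proof.
move=> hf hF; apply: bigO_ext (bigO_mul hf hF) => // z _.
by rewrite mul1r.
Qed.

(** The distance from [l] to any point of [S] is comparable to the size of
    both. *)
Definition away (l : R[i]) := exists2 c : R, 0 < c &
  forall z, S z -> c * (nrm z + nrm l) <= nrm (z - l).

Variables (l : R[i]).
Hypotheses (l0 : l != 0) (Sl : away l).

Lemma away_neq0 z : S z -> z - l != 0.
Proof.
case: Sl => c c0 h Sz; rewrite -nrm_gt0; apply: lt_le_trans (h z Sz).
by rewrite mulr_gt0 // ltr_wpDl ?nrm_ge0 // nrm_gt0.
Qed.

Lemma away_inv_bounds : exists2 c : R, 0 < c & forall z, S z ->
  nrm (z - l)^-1 <= c /\ nrm (z / (z - l)) <= c.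
Proof.
have [c c0 h] := Sl; have nl : 0 < nrm l by rewrite nrm_gt0.
have cl : 0 < (c * nrm l)^-1 by rewrite invr_gt0 mulr_gt0.
have ci : 0 < c^-1 by rewrite invr_gt0.
exists ((c * nrm l)^-1 + c^-1); first exact: addr_gt0.
move=> z Sz; have hz := h z Sz; have z0 := nrm_ge0 z.
have zl : 0 < nrm (z - l) by rewrite nrm_gt0 away_neq0.
split.
  rewrite nrmV; apply: (@le_trans _ _ (c * nrm l)^-1); last by lra.
  rewrite lef_pV2 ?posrE ?mulr_gt0 //; apply: le_trans hz.
  by rewrite ler_pM2l //; lra.
rewrite nrm_div; apply: (@le_trans _ _ c^-1); last by lra.
rewrite ler_pdivrMr // mulrC -ler_pdivrMr ?invr_gt0 // invrK mulrC.
by apply: le_trans hz; rewrite ler_pM2l //; lra.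
Qed.

Lemma nice_inv : nice S (fun z => (z - l)^-1 : R[i]^o).
Proof.
have [c c0 h] := away_inv_bounds.
exists (c + c ^+ 2 + c ^+ 3), (fun z => - (z / (z - l) ^+ 2) : R[i]^o).
split=> [|z Sz]; first by rewrite !addr_ge0 ?exprn_ge0 ?(ltW c0).
have [h1 h2] := h z Sz; have zl := away_neq0 Sz.
have c2 := exprn_gt0 2 c0; have c3 := exprn_gt0 3 c0.
split; [by lra| |].
  have -> : z / (z - l) ^+ 2 = (z / (z - l)) * (z - l)^-1.
    by field.
  rewrite nrmN nrmM; have := ler_pM (nrm_ge0 _) (nrm_ge0 _) h2 h1.
  by rewrite -expr2; lra.
move=> a _ Sa; have [g1 g2] := h _ Sa; have wl := away_neq0 Sa.
have -> : ((1 + a) * z - l)^-1 - (z - l)^-1 - a *: (- (z / (z - l) ^+ 2) : R[i]^o)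
   = a ^+ 2 * ((z / (z - l)) ^+ 2 * ((1 + a) * z - l)^-1) :> R[i].
  rewrite -[a *: _]/(a * _); field.
  by rewrite zl wl.
rewrite nrmM nrmX mulrC ler_wpM2r ?sqr_ge0 // nrmM nrmX.
have u : nrm (z / (z - l)) ^+ 2 <= c ^+ 2.
  by rewrite ler_sqr ?nnegrE ?nrm_ge0 ?(ltW c0).
have := ler_pM (sqr_ge0 _) (nrm_ge0 _) u g1.
by rewrite -exprSr => v; apply: le_trans v _; lra.
Qed.

Lemma inv_bigO_infty : (forall z, S z -> z != 0) ->
  bigO (fun z => (nrm z)^-1) (fun z => (z - l)^-1 : R[i]^o).
Proof.
move=> S0; have [c c0 h] := away_inv_bounds.
exists c; split=> [|z Sz]; first exact: ltW.
have [_] := h z Sz; rewrite nrm_div nrmV mulrC => u.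
by rewrite ler_pdivlMr ?nrm_gt0 ?S0.
Qed.
End BigO.

(** * Functional calculus on a sector *)

Section Functional.
Context {R : realType} {X : completeNormedModType R[i]}.
Variables (A : operator X).

Lemma opD x y : op_dom A x -> op_dom A y -> A (x + y) = A x + A y.
Proof. by move=> hx hy; have := op_funP 1 hx hy; rewrite !scale1r. Qed.

Lemma op_dom_add x y : op_dom A x -> op_dom A y -> op_dom A (x + y).
Proof. by move=> hx hy; have := op_domP 1 hx hy; rewrite !scale1r. Qed.

Lemma op_fun0 : A 0 = 0.
Proof.
have := op_funP 1 (op_dom0 A) (op_dom0 A).
rewrite !scale1r addr0 => h; apply: (@addrI _ (A 0)); by rewrite addr0 -h.
Qed.

Lemma op_dom_scale a x : op_dom A x -> op_dom A (a *: x).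
Proof. by move=> hx; have := op_domP a hx (op_dom0 A); rewrite addr0. Qed.

Lemma op_funZ a x : op_dom A x -> A (a *: x) = a *: A x.
Proof.
by move=> hx; have := op_funP a hx (op_dom0 A); rewrite addr0 op_fun0 addr0.
Qed.

Variables (th M : R) (T : R[i] -> X -> X).

(** [T z] is [z (z - A)^-1], bounded by [M] outside the closed sector of
    half-angle [th]. *)
Definition resolvent_family := forall z, sepf th z < 0 -> forall x,
  [/\ op_dom A (T z x), z *: T z x - A (T z x) = z *: x,
      (forall y, op_dom A y -> z *: y - A y = z *: x -> y = T z x) &
      nrm (T z x) <= M * nrm x].

Hypotheses (HT : resolvent_family) (M0 : 0 <= M).

Let out z := sepf th z < 0.

Lemma T_lin z a x y : out z -> T z (a *: x + y) = a *: T z x + T z y.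
Proof.
move=> hz; have [d1 e1 _ _] := HT hz x; have [d2 e2 _ _] := HT hz y.
have [_ _ u _] := HT hz (a *: x + y); symmetry; apply: u; first exact: op_domP.
rewrite op_funP //.
have -> : z *: (a *: T z x + T z y) - (a *: A (T z x) + A (T z y)) =
  a *: (z *: T z x - A (T z x)) + (z *: T z y - A (T z y)) by vring.
by rewrite e1 e2; vring.
Qed.

Lemma T0 z : out z -> T z 0 = 0.
Proof.
move=> hz; have := @T_lin z (-1) 0 0 hz; rewrite scaler0 addr0 => e.
by rewrite e; vring.
Qed.

Lemma TD z x y : out z -> T z (x + y) = T z x + T z y.
Proof. by move=> hz; have := @T_lin z 1 x y hz; rewrite !scale1r. Qed.

Lemma TZ z a x : out z -> T z (a *: x) = a *: T z x.
Proof. by move=> hz; have := @T_lin z a x 0 hz; rewrite !addr0 T0 // addr0. Qed.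

Lemma TB z x y : out z -> T z (x - y) = T z x - T z y.
Proof. by move=> hz; rewrite -scaleN1r addrC T_lin // scaleN1r addrC. Qed.

Lemma op_funB x y : op_dom A x -> op_dom A y -> A (x - y) = A x - A y.
Proof. by move=> hx hy; rewrite -scaleN1r addrC op_funP // scaleN1r addrC. Qed.

Lemma op_dom_sub x y : op_dom A x -> op_dom A y -> op_dom A (x - y).
Proof. by move=> hx hy; rewrite -scaleN1r addrC; exact: op_domP. Qed.

Lemma TA z x : out z -> op_dom A x -> T z (A x) = z *: (T z x - x).
Proof.
move=> hz hx; have [_ _ u _] := HT hz (A x); have [d1 e1 _ _] := HT hz x.
have dB : op_dom A (T z x - x) by exact: op_dom_sub.
symmetry; apply: u; first exact: op_dom_scale.
rewrite op_funZ // op_funB //.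
have -> : z *: (z *: (T z x - x)) - z *: (A (T z x) - A x) =
   z *: (z *: T z x - A (T z x)) - z *: (z *: x - A x) by vring.
by rewrite e1; vring.
Qed.

(** The resolvent identity, for multiplicative increments. *)
Lemma T_step z a x : 1 + a != 0 -> out z -> out ((1 + a) * z) ->
  T ((1 + a) * z) x = T z x + (a / (1 + a)) *: T ((1 + a) * z) (x - T z x).
Proof.
move=> a0 hz hw; set w := (1 + a) * z.
have [d1 e1 _ _] := HT hz x; have [d2 e2 _ _] := HT hw (x - T z x).
have [_ _ u _] := HT hw x; symmetry; apply: u.
  by rewrite addrC; exact: op_domP.
rewrite [T z x + _]addrC op_funP //.
have -> : w *: ((a / (1 + a)) *: T w (x - T z x) + T z x) -
    ((a / (1 + a)) *: A (T w (x - T z x)) + A (T z x)) =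
  (a / (1 + a)) *: (w *: T w (x - T z x) - A (T w (x - T z x))) +
    (z *: T z x - A (T z x)) + (a * z) *: T z x.
  by rewrite /w; vring.
rewrite e2 e1 /w.
by vfield.
Qed.

Lemma half_neq0 (a : R[i]) : nrm a <= 1 / 2 -> 1 + a != 0 /\ nrm (a / (1 + a)) <= 2 * nrm a.
Proof.
move=> ha; have h : 1 / 2 <= nrm (1 + a).
  have := nrmDZl 1 a; rewrite nrm1; lra.
have p : 0 < nrm (1 + a) by lra.
split; first by rewrite -nrm_gt0.
rewrite nrm_div ler_pdivrMr //; have := nrm_ge0 a; nra.
Qed.

Lemma nice_T (S : R[i] -> Prop) x : (forall z, S z -> out z) -> nice S (T^~ x).
Proof.
move=> So; have n0 := nrm_ge0 x.
have B z y : out z -> nrm (T z y) <= M * nrm y by move=> /HT /(_ y)[].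
have BB z y : out z -> nrm (y - T z y) <= (1 + M) * nrm y.
  by move=> hz; apply: le_trans (nrmB _ _) _; rewrite mulrDl mul1r lerD2l; exact: B.
have BL c d y : c <= d -> c * nrm y <= d * nrm y by move=> h; rewrite ler_wpM2r ?nrm_ge0.
have M1 : 1 <= (1 + M) ^+ 2 by rewrite exprn_ege1 // lerDl.
have M2 : (1 + M) ^+ 2 <= 6 * (1 + M) ^+ 3.
  by rewrite [_ ^+ 3]exprSr; have := mulr_ge0 (le_trans ler01 M1) M0; lra.
have M3 : M * (1 + M) <= (1 + M) ^+ 2 by rewrite expr2 ler_wpM2r // ?lerDr ?addr_ge0.
exists (6 * (1 + M) ^+ 3 * nrm x), (fun z => T z (x - T z x)).
have m3 : (1 + M) ^+ 3 = (1 + M) ^+ 2 * (1 + M) by rewrite exprSr.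
have TT z w : out z -> out w -> nrm (T w (x - T z x)) <= (1 + M) ^+ 2 * nrm x.
  move=> hz hw; apply: le_trans (B _ _ hw) _.
  apply: le_trans (ler_wpM2l M0 (BB _ x hz)) _.
  rewrite mulrA; exact: BL.
have M4 : 0 <= (1 + M) ^+ 3 by rewrite exprn_ge0 // addr_ge0.
split=> [|z Sz]; first by apply: mulr_ge0 => //; exact: mulr_ge0.
have hz := So z Sz; split.
- apply: le_trans (B _ _ hz) _; apply: BL; apply: le_trans M2; rewrite expr2; nra.
- by apply: le_trans (TT _ _ hz hz) _; exact: BL.
move=> a ha Sa; have hw := So _ Sa; have [a1 an] := half_neq0 ha.
set c := a / (1 + a) in an; set w := (1 + a) * z in hw *.
pose u := x - T z x.
have e1 : T w x = T z x + c *: T w u by exact: T_step.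
have e2 : T w u = T z u + c *: T w (u - T z u) by exact: T_step.
have -> : T w x - T z x - a *: T z u =
    (c * c) *: T w (u - T z u) + (- a * c) *: T z u.
  by rewrite e1 e2 /c; vfield.
apply: le_trans (nrmD _ _) _; rewrite !nrmZ (nrmM c c) (nrmM (- a) c) nrmN.
have b1 : nrm (T w (u - T z u)) <= (1 + M) ^+ 3 * nrm x.
  apply: le_trans (B _ _ hw) _.
  apply: le_trans (ler_wpM2l M0 (BB _ u hz)) _.
  apply: le_trans (ler_wpM2l M0 (ler_wpM2l (addr_ge0 ler01 M0) (BB _ x hz))) _.
  rewrite !mulrA; apply: BL; rewrite m3 ler_wpM2r ?addr_ge0 // expr2 ler_wpM2r ?addr_ge0 // lerDr.
have b2 : nrm (T z u) <= (1 + M) ^+ 3 * nrm x.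
  apply: le_trans (TT _ _ hz hz) _; apply: BL.
  by rewrite m3; have := mulr_ge0 (le_trans ler01 M1) M0; lra.
have c0 := nrm_ge0 c; have na := nrm_ge0 a.
have cc : nrm c * nrm c <= 4 * nrm a ^+ 2.
  have := ler_pM c0 c0 an an; nra.
have ac : nrm a * nrm c <= 2 * nrm a ^+ 2.
  by have := ler_wpM2l na an; nra.
have q1 := ler_pM (mulr_ge0 c0 c0) (nrm_ge0 _) cc b1.
have q2 := ler_pM (mulr_ge0 na c0) (nrm_ge0 _) ac b2.
by apply: le_trans (lerD q1 q2) _; lra.
Qed.

Variable be : R.
Hypotheses (th0 : 0 < th) (thbe : th < be) (bepi : be < pi / 2).

Let be0 : 0 < be := lt_trans th0 thbe.

Let S := sec be.
(** The two rays bounding the sector of half-angle [be]. *)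
Definition rays (z : R[i]) : Prop :=
  exists2 rho : R, 0 < rho & z = rho%:C * cis be \/ z = rho%:C * cis (- be).

Lemma rays_out z : rays z -> out z.
Proof.
move: th0 thbe bepi be0 => h1 h2 h3 h4.
have p := pi_gt0 R; have bn : `|- be| = be by rewrite normrN gtr0_norm.
have bp : `|be| = be by rewrite gtr0_norm.
have s0 : sin (th - be) < 0.
  by rewrite -[th - be]opprB sinN oppr_lt0 sin_gt0_pi //; lra.
move=> [rho r0 [->|->]]; rewrite /out sepf_polar ?(ltW r0) ?bn ?bp //;
  try lra; by rewrite pmulr_rlt0.
Qed.

Lemma rays_sec z : rays z -> S z.
Proof.
move=> [rho r0 [->|->]]; [exists rho, be|exists rho, (- be)]; split=> //;
  by rewrite ?normrN gtr0_norm.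
Qed.

Lemma sec_neq0 z : S z -> z != 0.
Proof. by move=> [rho [t [r0 _ ->]]]; rewrite -nrm_gt0 nrm_polar. Qed.

(** [fcalc u U u0 ui]: the operator [U] is [u(A)], where [u] is a function on
    the sector [S] with limits [u0] at the vertex and [ui] at infinity. What is
    required of [U] is that [(u(z) - U) z (z - A)^-1 x] extends from the
    bounding rays to a regular function [P] on the whole sector: the
    singularities of the resolvent cancel. The last two conditions say that
    [U - ui] maps into the domain and [U - u0] into the range of [A]. *)
Definition fcalc (u : R[i] -> R[i]) (U : X -> X) (u0 ui : R[i]) : Prop :=
  [/\ nice S (u : R[i] -> R[i]^o),
      bigO S nrm (fun z => u z - u0 : R[i]^o) /\
      bigO S (fun z => (nrm z)^-1) (fun z => u z - ui : R[i]^o),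
      (forall x, exists P : R[i] -> X, [/\ nice S P, bigO S nrm P,
        bigO S (fun z => (nrm z)^-1) (fun z => P z - (ui *: x - U x)) &
        forall z, rays z -> u z *: T z x - T z (U x) = P z]),
      (forall x, op_dom A (U x - ui *: x)) &
      (forall x, exists2 v, op_dom A v & A v = U x - u0 *: x)].

Lemma bigO0 w (V : normedModType R[i]) (v : V) : (forall z, S z -> 0 <= w z) ->
  v = 0 -> bigO S w (fun=> v).
Proof.
by move=> hw ->; exists 0; split=> // z Sz; rewrite nrm0 mul0r.
Qed.

Lemma nrm_inv_ge0 (z : R[i]) : 0 <= (nrm z)^-1.
Proof. by rewrite invr_ge0 nrm_ge0. Qed.

Lemma fcalc_cst c : fcalc (fun=> c) (fun x => c *: x) c c.
Proof.
split.
- exact: (@nice_cst _ S R[i]^o).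
- by split; apply: bigO0; rewrite ?subrr // => z _; rewrite ?nrm_ge0 ?nrm_inv_ge0.
- move=> x; exists (fun=> 0); split.
  + exact: nice_cst.
  + by apply: bigO0 => // z _; rewrite nrm_ge0.
  + by apply: bigO0; rewrite ?subrr ?subr0 // => z _; exact: nrm_inv_ge0.
  + by move=> z /rays_out hz; rewrite TZ // subrr.
- by move=> x; rewrite subrr; exact: op_dom0.
- by move=> x; exists 0; [exact: op_dom0|rewrite op_fun0 subrr].
Qed.

Lemma fcalc_add u U u0 ui v V v0 vi : fcalc u U u0 ui -> fcalc v V v0 vi ->
  fcalc (fun z => u z + v z) (fun x => U x + V x) (u0 + v0) (ui + vi).
Proof.
move=> [nu [lu0 lui] pu du ru] [nv [lv0 lvi] pv dv rv]; split.
- exact: (nice_add nu nv).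
- split; [apply: bigO_ext (bigO_add lu0 lv0)|apply: bigO_ext (bigO_add lui lvi)] => //;
    by move=> z _; rewrite addrACA -opprD.
- move=> x; have [P [nP P0 Pi eP]] := pu x; have [Q [nQ Q0 Qi eQ]] := pv x.
  exists (fun z => P z + Q z); split.
  + exact: nice_add.
  + exact: bigO_add.
  + apply: bigO_ext (bigO_add Pi Qi) => // z _; vring.
  + move=> z hz; rewrite -eP // -eQ // TD; last exact: rays_out.
    by vring.
- move=> x; have -> : U x + V x - (ui + vi) *: x = (U x - ui *: x) + (V x - vi *: x).
    by vring.
  by apply: op_dom_add.
- move=> x; have [y hy ey] := ru x; have [y' hy' ey'] := rv x.
  exists (y + y'); first exact: op_dom_add.
  by rewrite opD // ey ey'; vring.
Qed.

Lemma fcalc_mul u U u0 ui v V v0 vi : fcalc u U u0 ui -> fcalc v V v0 vi ->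
  fcalc (fun z => u z * v z) (fun x => U (V x)) (u0 * v0) (ui * vi).
Proof.
move=> [nu [lu0 lui] pu du ru] [nv [lv0 lvi] pv dv rv].
have bu := nice_bigO nu; have bv := nice_bigO nv; split.
- exact: (nice_scale nu nv).
- split.
    apply: bigO_ext (bigO_add (bigO_bmul bu lv0) (bigO_bmul (bigO_cst S (v0 : R[i]^o)) lu0)) => //.
    by move=> z _; rewrite -![_ *: _]/(_ * _); ring.
  apply: bigO_ext (bigO_add (bigO_bmul bu lvi) (bigO_bmul (bigO_cst S (vi : R[i]^o)) lui)) => //.
  by move=> z _; rewrite -![_ *: _]/(_ * _); ring.
- move=> x; have [P [nP P0 Pi eP]] := pu (V x); have [Q [nQ Q0 Qi eQ]] := pv x.
  exists (fun z => u z *: Q z + P z); split.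
  + exact: nice_add (nice_scale nu nQ) nP.
  + exact: bigO_add (bigO_bmul bu Q0) P0.
  + apply: bigO_ext (bigO_add (bigO_add (bigO_bmul bu Qi)
      (bigO_mulv (vi *: x - V x) lui)) Pi) => // z _; vring.
  + move=> z hz; rewrite -eP // -eQ //; vring.
- move=> x; have -> : U (V x) - (ui * vi) *: x =
      (U (V x) - ui *: V x) + ui *: (V x - vi *: x) by vring.
  by apply: op_dom_add => //; apply: op_dom_scale.
- move=> x; have [y hy ey] := ru (V x); have [y' hy' ey'] := rv x.
  exists (y + u0 *: y'); first by apply: op_dom_add => //; apply: op_dom_scale.
  rewrite opD // ?op_funZ // ?ey ?ey'; first by vring.
  exact: op_dom_scale.
Qed.

(** For [U = (k A - l)^-1] the extension is [P(z) = - k z / (k z - l) U x], by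
    the resolvent identity. *)
Lemma fcalc_resolvent (k : R) (l : R[i]) (U : X -> X) : 0 < k -> l != 0 ->
  away S (l / k%:C) ->
  (forall x, op_dom A (U x) /\ k%:C *: A (U x) - l *: U x = x) ->
  fcalc (fun z => (k%:C * z - l)^-1) U (- l^-1) 0.
Proof.
move=> k0 l0 aw hU; have kC : k%:C != 0 :> R[i] by rewrite eq_complex /= gt_eqF.
have lk0 : l / k%:C != 0 by rewrite mulf_neq0 ?invr_eq0.
pose m := l / k%:C; have lE : l = k%:C * m by rewrite /m; field.
have m0 : m != 0 := lk0.
have uE z : (k%:C * z - l)^-1 = k%:C^-1 * (z - m)^-1.
  by rewrite lE -mulrBr invfM.
have nz z : S z -> z - m != 0 by exact: away_neq0.
have nI := nice_inv lk0 aw; rewrite -/m in nI.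
have bI := nice_bigO nI; have cI := inv_bigO_infty lk0 aw sec_neq0.
rewrite -/m in cI.
have idO : bigO S nrm (fun z => z : R[i]^o).
  by exists 1; split=> // z _; rewrite mul1r.
split.
- apply: nice_ext (nice_scale (nice_cst S (k%:C^-1 : R[i]^o)) nI) => z Sz.
  by rewrite uE.
- split.
    apply: bigO_ext (bigO_bmul (bigO_bmul (bigO_cst S (l^-1 : R[i]^o)) bI) idO) => //.
    move=> z Sz; rewrite -![_ *: _]/(_ * _) uE opprK lE.
    by field; rewrite ?kC ?m0 ?nz.
  apply: bigO_ext (bigO_bmul (bigO_cst S (k%:C^-1 : R[i]^o)) cI) => //.
  by move=> z Sz; rewrite subr0 uE.
- move=> x; have [dx ex] := hU x; set y := U x in dx ex *.
  exists (fun z => (1 + m * (z - m)^-1) *: (- y)); split.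
  + apply: (nice_scale _ (nice_cst S (- y))).
    apply: (nice_add (nice_cst S (1 : R[i]^o))).
    exact: (nice_scale (nice_cst S (m : R[i]^o)) nI).
  + apply: (bigO_mulv (- y)).
    apply: bigO_ext (bigO_bmul bI idO) => // z Sz.
    by rewrite -![_ *: _]/(_ * _); field; exact: nz.
  + apply: bigO_ext (bigO_mulv (- m *: y) cI) => // z Sz.
    by vring.
  + move=> z hz; have ho := rays_out hz; have zm := nz _ (rays_sec hz).
    rewrite -{1}ex TB // !TZ // TA // uE lE.
    by vfield; rewrite ?kC ?zm.
- by move=> x; rewrite scale0r subr0; case: (hU x).
- move=> x; have [dx ex] := hU x; exists ((k%:C / l) *: U x).
    exact: op_dom_scale.
  rewrite op_funZ //.
  have -> : U x - - l^-1 *: x = U x + l^-1 *: (k%:C *: A (U x) - l *: U x).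
    by rewrite ex; vring.
  by vfield.
Qed.
End Functional.

(** * Scalar contour sums *)

Section Contour.
Context {R : realType}.

Lemma archi_le (al ga C : R) (s0 : nat) :
  (forall s, (s0 <= s)%N -> (0 < s)%N -> al <= ga + C / s%:R) -> al <= ga.
Proof.
move=> h; rewrite leNgt; apply/negP => lt.
have [n hn] : exists n : nat, `|C| / (al - ga) < n%:R.
  exists (Num.bound (`|C| / (al - ga))).
  by apply: archi_boundP; rewrite divr_ge0 // subr_ge0 ltW.
pose s := (s0 + n.+1)%N.
have s1 : (0 < s)%N by rewrite /s addnS.
have sR : 0 < s%:R :> R by rewrite ltr0n.
have := h s (leq_addr _ _) s1; apply/negP; rewrite -ltNge.
rewrite -ltrBrDl ltr_pdivrMr // mulrC -ltr_pdivrMr ?subr_gt0 //.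
apply: le_lt_trans (_ : _ <= `|C| / (al - ga)) _.
  by rewrite ler_wpM2r ?ler_norm // invr_ge0 subr_ge0 ltW.
apply: lt_trans hn _; by rewrite ltr_nat /s addnS ltnS leq_addl.
Qed.

(** The difference of two scalar kernels that take the value 0 at 0 and 1 at
    infinity, one with its pole in the right half-plane and the other with its
    pole in the left half-plane. *)
Definition kern (z : R[i]) : R[i] := z / (z - 1) - z / (z + 1).

Lemma Im_div (a b : R[i]) : b != 0 -> complex.Im (a / b) =
  (complex.Im a * complex.Re b - complex.Re a * complex.Im b) /
  (complex.Re b ^+ 2 + complex.Im b ^+ 2).
Proof.
move=> b0; have : complex.Re b ^+ 2 + complex.Im b ^+ 2 != 0 :> R.
  by rewrite -nrm_sqr expf_neq0 // nrm_eq0.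
case: a b {b0} => a1 a2 [b1 b2] /= h; rewrite mulrN.
by field.
Qed.

(** On a ray the imaginary part of [kern] has a constant sign and an explicit
    size. *)
Lemma Im_kern (x c s : R) : 0 < x -> c ^+ 2 + s ^+ 2 = 1 -> s != 0 ->
  exists2 D : R, 0 < D <= (1 + x ^+ 2) ^+ 2 &
  complex.Im (kern (x%:C * (c +i* s))) = - (2 * x * s * (1 + x ^+ 2) / D).
Proof.
move=> x0 cs s0; set z : R[i] := x%:C * _.
have zE : z = (x * c) +i* (x * s) by rewrite /z; simpc.
have xs : x * s != 0 by rewrite mulf_neq0 // gt_eqF.
have d1 : z - 1 != 0.
  apply: contraNneq xs => /(congr1 (@complex.Im R)).
  by rewrite zE /= oppr0 addr0 => ->; rewrite eqxx.
have d2 : z + 1 != 0.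
  apply: contraNneq xs => /(congr1 (@complex.Im R)).
  by rewrite zE /= addr0 => ->; rewrite eqxx.
have nz w : w != 0 -> complex.Re w ^+ 2 + complex.Im w ^+ 2 != 0 :> R.
  by move=> w0; rewrite -nrm_sqr expf_neq0 // nrm_eq0.
pose w : R[i] := z ^+ 2 - 1.
have w0 : w != 0.
  have -> : w = (z - 1) * (z + 1) by rewrite /w; ring.
  exact: mulf_neq0.
have -> : kern z = 2 * z / w.
  have w0b : z ^+ 2 - 1 != 0 := w0.
  rewrite /kern /w; by field; rewrite d1 d2 w0b.
have wE : w = (x ^+ 2 * (c ^+ 2 - s ^+ 2) - 1) +i* (2 * x ^+ 2 * c * s).
  rewrite /w zE expr2; simpc; congr (_ +i* _); ring.
pose D := complex.Re w ^+ 2 + complex.Im w ^+ 2.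
have D0 : 0 < D.
  by rewrite lt_def nz // addr_ge0 ?sqr_ge0.
have DE : D = (1 + x ^+ 2) ^+ 2 - 4 * x ^+ 2 * c ^+ 2.
  rewrite /D wE /=; have -> : s ^+ 2 = 1 - c ^+ 2 by rewrite -cs; ring.
  transitivity ((x ^+ 2 * (c ^+ 2 - (1 - c ^+ 2)) - 1) ^+ 2 + 4 * x ^+ 4 * c ^+ 2 * s ^+ 2).
    ring.
  have -> : s ^+ 2 = 1 - c ^+ 2 by rewrite -cs; ring.
  ring.
exists D.
  rewrite D0 DE /= lerBlDr lerDl.
  by apply: mulr_ge0 (mulr_ge0 _ (sqr_ge0 _)) (sqr_ge0 _).
rewrite Im_div // -/D -[RHS]mulNr; congr (_ / _).
rewrite [2 * z]mulr_natl mulr2n zE wE.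
simpc => /=.
have e : s ^+ 2 = 1 - c ^+ 2 by rewrite -cs; ring.
ring: e.
Qed.
End Contour.

Section ContourSum.
Context {R : realType}.

Lemma bump_grid_lower s : (1 < s)%N ->
  1 / 3 <= (s%:R ^+ 2)^-1 * grid s (fun x : R => x / (1 + x) ^+ 2).
Proof.
move=> s1; have s0 : (0 < s)%N by exact: ltnW.
pose psi (x : R) : R := x / (1 + x).
rewrite -gstep_sub1 -grid_scale.
set q := gstep s; have q1 : 1 < q by exact: gstep_gt1.
apply: (@le_trans _ _ (\sum_(j < 2 * s ^ 3) (psi (gpt s j.+1) - psi (gpt s j)))).
  rewrite -(big_mkord xpredT (fun j => psi (gpt s j.+1) - psi (gpt s j))).
  rewrite telescope_sumr // gpt_last gpt0.
  have : 2 <= gstep s ^+ (s ^ 3) :> R.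
    by apply: le_trans (gpt_exhaust s0); rewrite ler_nat.
  move: (gstep s ^+ _) => y y2; rewrite /psi.
  have -> : y / (1 + y) - y^-1 / (1 + y^-1) = (y - 1) / (y + 1).
    by field; rewrite !gt_eqF //; lra.
  by rewrite ler_pdivlMr; lra.
apply: ler_sum => j _; rewrite gptS -/q; move: (gpt s j) (@gpt_gt0 R s j) => x x0.
rewrite /psi; have h1 : 0 < 1 + x by lra.
have h2 : 0 < 1 + q * x by nra.
have -> : q * x / (1 + q * x) - x / (1 + x) =
   (q - 1) * (x / (1 + x) ^+ 2) * ((1 + x) / (1 + q * x)).
  by field; rewrite !gt_eqF.
rewrite ler_piMr //; last by rewrite ler_pdivrMr // mul1r; nra.
by rewrite mulr_ge0 ?divr_ge0 ?exprn_ge0 // ?subr_ge0; lra.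
Qed.

(** The scalar contour sum does not degenerate; no exact value is needed. *)
Lemma kern_sum (be : R) s : 0 < sin be -> (1 < s)%N ->
  4 / 3 * sin be <= nrm ((((s%:R ^+ 2)^-1)%:C : R[i]) *
    grid s (fun x => kern (x%:C * cis be) - kern (x%:C * cis (- be)))).
Proof.
move=> sb s1; set a : R := (s%:R ^+ 2)^-1.
have a0 : 0 <= a by rewrite invr_ge0 sqr_ge0.
rewrite nrmM nrm_real ger0_norm //.
set G := grid s _; apply: le_trans (_ : a * - complex.Im G <= _); last first.
  rewrite ler_wpM2l //; apply: le_trans (Im_le_nrm _); rewrite -normrN.
  exact: ler_norm.
have -> : - complex.Im G = grid s (fun x => - complex.Im
     (kern (x%:C * cis be) - kern (x%:C * cis (- be)))).
  rewrite /G /grid (big_morph (@complex.Im R) (id1 := 0) (op1 := +%R)) ?sumrN //.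
  by case=> ? ? [].
apply: le_trans (_ : a * grid s (fun x => 4 * sin be * (x / (1 + x) ^+ 2)) <= _).
  by rewrite grid_scale mulrCA; have := bump_grid_lower s1; rewrite -/a; nra.
rewrite ler_wpM2l //; apply: grid_le => x x0.
have [D1 /andP[D10 D1b] e1] := @Im_kern R x (cos be) (sin be) x0 (cos2Dsin2 _) (lt0r_neq0 sb).
have sN : sin (- be) != 0 by rewrite sinN oppr_eq0 lt0r_neq0.
have [D2 /andP[D20 D2b] e2] := @Im_kern R x (cos (- be)) (sin (- be)) x0 (cos2Dsin2 _) sN.
have -> (u v : R[i]) : - complex.Im (u - v) = complex.Im v - complex.Im u.
  by case: u v => ? ? [? ?] /=; ring.
rewrite e1 e2 sinN.
have x21 : 0 < 1 + x ^+ 2 by rewrite ltr_pwDl // sqr_ge0.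
have lb D : 0 < D -> D <= (1 + x ^+ 2) ^+ 2 ->
    2 * sin be * (x / (1 + x) ^+ 2) <= 2 * x * sin be * (1 + x ^+ 2) / D.
  move=> D0 Db; apply: (@le_trans _ _ (2 * x * sin be * (1 + x ^+ 2) / (1 + x ^+ 2) ^+ 2)); last first.
    rewrite ler_wpM2l ?lef_pV2 ?posrE ?exprn_gt0 //.
    by rewrite !mulr_ge0 // ltW.
  have -> : 2 * x * sin be * (1 + x ^+ 2) / (1 + x ^+ 2) ^+ 2 =
     2 * sin be * (x / (1 + x ^+ 2)) by field; rewrite gt_eqF.
  rewrite ler_wpM2l ?mulr_ge0 // ?(ltW sb) // ler_wpM2l ?(ltW x0) //.
  by rewrite lef_pV2 ?posrE ?exprn_gt0 //; nra.
have := lb _ D10 D1b; have := lb _ D20 D2b; lra.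
Qed.

Lemma rotation_bigO (V : normedModType R[i]) (b : R) (H : R[i] -> V) : 0 < b ->
  nice (sec b) H -> bigO (sec b) nrm H -> bigO (sec b) (fun z => (nrm z)^-1) H ->
  exists C : R, exists s0 : nat, forall s, (s0 <= s)%N -> (0 < s)%N ->
    nrm (((s%:R ^+ 2)^-1)%:C *: grid s (fun x => H (x%:C * cis b)
       - H (x%:C * cis (- b)))) <= C / s%:R.
Proof.
move=> b0 nH [L [L0 h]] [L' [L'0 h']]; apply: (@rotation _ _ b (L + L')) => // z Sz.
have z0 : 0 < nrm z by case: Sz => r [t [r0 _ ->]]; rewrite nrm_polar.
split; first by apply: le_trans (h z Sz) _; rewrite ler_wpM2r ?nrm_ge0 // lerDl.
rewrite -ler_pdivlMr //; apply: le_trans (h' z Sz) _.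
by rewrite ler_wpM2r ?invr_ge0 ?nrm_ge0 // lerDr.
Qed.

Lemma nice_opp (V : normedModType R[i]) (S S' : R[i] -> Prop) (F : R[i] -> V) :
  (forall z, S z -> S' (- z)) -> nice S' F -> nice S (fun z => F (- z)).
Proof.
move=> SS [L [K [L0 h]]]; exists L, (fun z => K (- z)); split=> // z Sz.
have [h1 h2 h3] := h _ (SS _ Sz); split=> // a ha Sa.
by rewrite -mulrN h3 // mulrN; exact: SS.
Qed.

Lemma sec_away (b rho t : R) : 0 < b -> b < `|t| <= pi -> 0 < rho ->
  away (sec b) (rho%:C * cis t).
Proof.
move=> b0 /andP[bt tp] r0; have [c c0 h] := sector_dist (ltW b0) bt tp.
exists c => // z [x [u [x0 ub ->]]].
by rewrite !nrm_polar //; apply: h; rewrite ?lexx //; exact: ltW.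
Qed.

Lemma cispi : cis pi = -1 :> R[i].
Proof. by rewrite /cis cospi sinpi; simpc. Qed.

Lemma sec_awayN1 (b : R) : 0 < b -> b < pi -> away (sec b) (-1).
Proof.
move=> b0 bp; have := @sec_away b 1 pi b0; rewrite cispi mul1r; apply=> //.
by rewrite ger0_norm ?pi_ge0 // bp lexx.
Qed.
End ContourSum.

(** * The contour estimate *)

Section MainEstimate.
Context {R : realType} {X : completeNormedModType R[i]}.
Variables (A : operator X) (th M be : R) (T : R[i] -> X -> X).
Hypotheses (HT : resolvent_family A th M T) (M0 : 0 <= M).
Hypotheses (th0 : 0 < th) (thbe : th < be) (bepi : be < pi / 2).

(** The key estimate: [g(A)] is controlled by the integral of [|g|] along the
    boundary of the sector with respect to the scale-invariant measure. With
    [y := G x], the integrand [g(z) T(z) x] on the contour is a sum of three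
    terms: [P(z) + z / (z + 1) y], which is regular to the right of the
    contour; [T(z) y - z / (z - 1) y], which is regular to its left; and
    [kern(z) y]. The first two have a vanishing integral by Cauchy's theorem,
    and the integral of [kern] is bounded below. *)
Lemma fcalc_bound g G (w : R -> R) (B : R) :
  fcalc A T be g G 0 0 ->
  (forall x : R, 0 < x -> nrm (g (x%:C * cis be)) <= w x /\
                      nrm (g (x%:C * cis (- be))) <= w x) ->
  (forall s, (0 < s)%N -> (s%:R ^+ 2)^-1 * grid s w <= B) ->
  forall x, 4 / 3 * sin be * nrm (G x) <= 2 * B * M * nrm x.
Proof.
move=> [ng _ gP gdom gran] gw wB x.
move: (th0) (thbe) (bepi) (pi_gt0 R) => h1 h2 h3 p0.
have be0 : 0 < be by lra.
pose b' : R := pi - be; have b'E : b' = pi - be by [].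
have b'0 : 0 < b' by lra.
have sb : 0 < sin be by rewrite sin_gt0_pi //; lra.
have S0 (b : R) (z : R[i]) : sec b z -> z != 0.
  by move=> [rho [t [r0 _ ->]]]; rewrite -nrm_gt0 nrm_polar.
set y := G x; have [P [nP P0 Pi eP]] := gP x.
have /= yD := gdom x; have [v vD vy] := gran x.
rewrite scale0r subr0 -/y in yD vy; rewrite -/y in Pi.
have N1 : (-1 : R[i]) != 0 by rewrite oppr_eq0 oner_neq0.
have Kn (b : R) : 0 < b -> b < pi -> [/\ nice (sec b) (fun z => 1 + -1 * (z - -1)^-1 : R[i]^o),
    bigO (sec b) nrm (fun z => 1 + -1 * (z - -1)^-1 : R[i]^o) &
    bigO (sec b) (fun z => (nrm z)^-1) (fun z => (z - -1)^-1 : R[i]^o)].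
  move=> b0 bp; have aw := sec_awayN1 b0 bp; have nI := nice_inv N1 aw.
  have nz z : sec b z -> z - -1 != 0 by exact: away_neq0.
  split.
  - apply: (nice_add (nice_cst _ (1 : R[i]^o))).
    exact: (nice_scale (nice_cst _ (-1 : R[i]^o)) nI).
  - have idO : bigO (sec b) nrm (fun z => z : R[i]^o).
      by exists 1; split=> // z _; rewrite mul1r.
    apply: bigO_ext (bigO_bmul (nice_bigO nI) idO) => // z Sz.
    by rewrite -![_ *: _]/(_ * _); field; have := nz _ Sz; rewrite opprK.
  - by apply: inv_bigO_infty => // z; exact: S0.
(* [kf z = z / (z + 1)] and [kf (- z) = z / (z - 1)] *)
pose kf (z : R[i]) : R[i] := 1 + -1 * (z - -1)^-1.
have bepi1 : be < pi by lra.
have b'pi : b' < pi by lra.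
have [k1 k2 k3] := Kn be be0 bepi1.
have [k1' k2' k3'] := Kn b' b'0 b'pi.
pose H1 (z : R[i]) := P z + kf z *: y.
have [C1 [s1 R1]] : exists C : R, exists s0 : nat, forall s, (s0 <= s)%N -> (0 < s)%N ->
    nrm (((s%:R ^+ 2)^-1)%:C *: grid s (fun x => H1 (x%:C * cis be)
       - H1 (x%:C * cis (- be)))) <= C / s%:R.
  apply: rotation_bigO => //.
  - exact: nice_add nP (nice_scale k1 (nice_cst _ y)).
  - exact: bigO_add P0 (bigO_mulv y k2).
  - apply: bigO_ext (bigO_add Pi (bigO_mulv (- y) k3)) => // z _.
    by rewrite /H1 /kf; vring.
(* the second term, in the variable [- z] *)
pose H2 (z : R[i]) := T (- z) y - kf z *: y.
have out (z : R[i]) : sec b' z -> sepf th (- z) < 0.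
  move=> [rho [t [r0 tb ->]]]; have tpi : `|t| <= pi by lra.
  have := @sepfN R (pi - th) (rho%:C * cis t).
  rewrite opprB addrC subrK => ->; rewrite oppr_lt0 (sepf_polar _ (ltW r0) tpi).
  rewrite mulr_gt0 // sin_gt0_pi //; have := normr_ge0 t; lra.
have TB (z : R[i]) (u : X) : sepf th z < 0 -> nrm (T z u) <= M * nrm u.
  by move=> /HT /(_ u)[].
have [C2 [s2 R2]] : exists C : R, exists s0 : nat, forall s, (s0 <= s)%N -> (0 < s)%N ->
    nrm (((s%:R ^+ 2)^-1)%:C *: grid s (fun x => H2 (x%:C * cis b')
       - H2 (x%:C * cis (- b')))) <= C / s%:R.
  apply: rotation_bigO => //.
  - apply: nice_add.
      apply: (@nice_opp _ _ _ (fun z => sepf th z < 0) (T^~ y)) => //.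
      exact: (nice_T HT).
    apply: nice_ext (nice_scale k1' (nice_cst _ (- y))) => z _.
    by rewrite scalerN.
  - apply: bigO_add; last first.
      apply: bigO_ext (bigO_mulv (- y) k2') => // z _; by rewrite scalerN.
    exists (M * nrm v + nrm v); split=> [|z Sz].
      by rewrite addr_ge0 ?mulr_ge0 ?nrm_ge0.
    rewrite -vy (TA HT) //; last exact: out.
    rewrite nrmZ nrmN mulrC ler_wpM2r ?nrm_ge0 //.
    by apply: le_trans (nrmB _ _) _; rewrite lerD2r; apply: TB; exact: out.
  - have tO : bigO (sec b') (fun z => (nrm z)^-1) (fun z => T (- z) y - y).
      exists (M * nrm (A y)); split=> [|z Sz]; first by rewrite mulr_ge0 ?nrm_ge0.
      have := TA HT (out _ Sz) yD; have := TB _ (A y) (out _ Sz) => hb e.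
      move: hb; rewrite e nrmZ nrmN => hb.
      by rewrite ler_pdivlMr ?nrm_gt0 ?(S0 _ _ Sz) // mulrC.
    apply: bigO_ext (bigO_add tO (bigO_mulv y k3')) => // z _.
    by rewrite /H2 /kf; vring.
apply: (@archi_le _ _ _ (C1 + C2) (maxn 2 (maxn s1 s2))) => s.
rewrite !geq_max => /and3P[s_2 s_s1 s_s2] spos.
have {}R1 := R1 s s_s1 spos; have {}R2 := R2 s s_s2 spos.
set a : R := (s%:R ^+ 2)^-1 in R1 R2.
have a0 : 0 <= a by rewrite invr_ge0 sqr_ge0.
have ks := kern_sum sb s_2; rewrite -/a in ks.
have rp (t : R) : 0 < t -> rays be (t%:C * cis be) by exists t => //; left.
have rm (t : R) : 0 < t -> rays be (t%:C * cis (- be)) by exists t => //; right.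
have cb : cis b' = - cis (- be) by rewrite /b' cisD cispi mulN1r.
have cb' : cis (- b') = - cis be.
  have -> : - b' = - pi + be by rewrite b'E; ring.
  have -> : be = pi + (be - pi) by ring.
  by rewrite cisD cispi mulN1r opprK; congr cis; ring.
pose Z (z : R[i]) := g z *: T z x.
have dec (z : R[i]) : rays be z -> Z z = H1 z + H2 (- z) + kern z *: y.
  move=> rz; have := eP z rz; rewrite -/y => e.
  have -> : Z z = P z + T z y by rewrite -e /Z subrK.
  rewrite /H1 /H2 opprK.
  have n1 := away_neq0 N1 (sec_awayN1 be0 bepi1) (rays_sec th0 thbe rz).
  have n2 : - z - -1 != 0.
    apply: (away_neq0 N1 (sec_awayN1 b'0 b'pi)).
    case: rz => t t0 [->|->]; [exists t, (- b')|exists t, b'].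
      by split=> //; rewrite ?normrN ?gtr0_norm // cb' mulrN.
    by split=> //; rewrite ?gtr0_norm // cb mulrN.
  rewrite opprK in n1; rewrite opprK addrC in n2.
  have n3 : z - 1 != 0 by rewrite -oppr_eq0 opprB.
  have -> : kern z = kf (- z) - kf z.
    rewrite /kern /kf !opprK addrC [- z + 1]addrC; field.
    by rewrite ?n1 ?n2 ?n3.
  by vring.
have split_sum : grid s (fun t => Z (t%:C * cis be) - Z (t%:C * cis (- be))) =
    grid s (fun t => H1 (t%:C * cis be) - H1 (t%:C * cis (- be)))
    - grid s (fun t => H2 (t%:C * cis b') - H2 (t%:C * cis (- b')))
    + grid s (fun t => kern (t%:C * cis be) - kern (t%:C * cis (- be))) *: y.
  rewrite /grid scaler_suml -sumrB -big_split /=; apply: eq_bigr => j _.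
  have t0 := @gpt_gt0 R s j; rewrite (dec _ (rp _ t0)) (dec _ (rm _ t0)).
  rewrite cb cb' !mulrN.
  set zp := (gpt s j)%:C * cis be; set zm := (gpt s j)%:C * cis (- be).
  by move: (H1 zp) (H1 zm) (H2 (- zp)) (H2 (- zm)) (kern zp) (kern zm) => *; vring.
have ub : nrm (a%:C *: grid s (fun t => Z (t%:C * cis be) - Z (t%:C * cis (- be))))
    <= 2 * B * M * nrm x.
  rewrite nrmZ nrm_real ger0_norm //.
  apply: le_trans (ler_wpM2l a0 (grid_nrm _ _)) _.
  apply: (@le_trans _ _ (a * grid s (fun t => 2 * M * nrm x * w t))).
    rewrite ler_wpM2l //; apply: grid_le => t t0.
    have [g1 g2] := gw t t0; apply: le_trans (nrmB _ _) _; rewrite !nrmZ.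
    have o1 := rays_out th0 thbe bepi (rp _ t0); have o2 := rays_out th0 thbe bepi (rm _ t0).
    have u1 := ler_pM (nrm_ge0 _) (nrm_ge0 _) g1 (TB _ x o1).
    have u2 := ler_pM (nrm_ge0 _) (nrm_ge0 _) g2 (TB _ x o2).
    by apply: le_trans (lerD u1 u2) _; rewrite le_eqVlt; apply/orP; left; apply/eqP; ring.
  rewrite grid_scale mulrCA; have := wB s spos; rewrite -/a => wb.
  have mx : 0 <= 2 * M * nrm x by rewrite !mulr_ge0 ?nrm_ge0.
  by apply: le_trans (ler_wpM2l mx wb) _; rewrite le_eqVlt; apply/orP; left; apply/eqP; ring.
have e : (a%:C * grid s (fun t => kern (t%:C * cis be) - kern (t%:C * cis (- be)))) *: y =
   a%:C *: grid s (fun t => Z (t%:C * cis be) - Z (t%:C * cis (- be)))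
   - a%:C *: grid s (fun t => H1 (t%:C * cis be) - H1 (t%:C * cis (- be)))
   + a%:C *: grid s (fun t => H2 (t%:C * cis b') - H2 (t%:C * cis (- b'))).
  by rewrite split_sum; vring.
apply: le_trans (ler_wpM2r (nrm_ge0 y) ks) _.
rewrite -nrmZ e; apply: le_trans (nrmD _ _) _.
rewrite [(C1 + C2) / _]mulrDl addrA; apply: lerD R2; apply: le_trans (nrmB _ _) _.
exact: lerD.
Qed.
End MainEstimate.

(** * Values and growth of rational functions *)

Section Evaluation.
Context {R : realType}.
Implicit Types (r f g : {fraction {poly R[i]}}) (z v w : R[i]).

(** [v] is the value at [z] of the rational function [f], which has no pole
    at [z]. *)
Definition evals f z v := exists n d : {poly R[i]},
  [/\ d.[z] != 0, f = n%:F / d%:F & v = n.[z] / d.[z]].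

Lemma evals_inj f z v w : evals f z v -> evals f z w -> v = w.
Proof.
move=> [n [d [d0 -> ->]]] [n' [d' [d'0 e ->]]].
have nz p : p.[z] != 0 -> p%:F != 0 :> {fraction {poly R[i]}}.
  by move=> p0; rewrite tofrac_eq0; apply: contraNneq p0 => ->; rewrite horner0.
have /eqP : n%:F * d'%:F = n'%:F * d%:F.
  apply/eqP; rewrite -eqr_div ?nz //; exact/eqP.
rewrite -!rmorphM tofrac_eq => /eqP /(congr1 (fun p => p.[z])).
by rewrite !hornerM => h; apply/eqP; rewrite eqr_div // h.
Qed.

Lemma evals_add f g z v w : evals f z v -> evals g z w -> evals (f + g) z (v + w).
Proof.
move=> [n [d [d0 -> ->]]] [n' [d' [d'0 -> ->]]].
have nz p : p.[z] != 0 -> p%:F != 0 :> {fraction {poly R[i]}}.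
  by move=> p0; rewrite tofrac_eq0; apply: contraNneq p0 => ->; rewrite horner0.
exists (n * d' + n' * d), (d * d'); split.
- by rewrite hornerM mulf_neq0.
- by rewrite rmorphD !rmorphM addf_div ?nz.
- by rewrite hornerD !hornerM addf_div.
Qed.

Lemma evals_cst c z : evals (c%:P)%:F z c.
Proof.
exists c%:P, 1; split; rewrite ?hornerC ?hornerE ?oner_neq0 //.
  by rewrite rmorph1 divr1.
by rewrite divr1.
Qed.

Lemma evals_sum (I : eqType) (s : seq I) (F : I -> {fraction {poly R[i]}})
    (V : I -> R[i]) z : (forall i, i \in s -> evals (F i) z (V i)) ->
  evals (\sum_(i <- s) F i) z (\sum_(i <- s) V i).
Proof.
elim: s => [|i s IH] h.
  by rewrite !big_nil; have := evals_cst 0 z; rewrite !rmorph0.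
rewrite !big_cons; apply: evals_add; first by apply: h; rewrite mem_head.
by apply: IH => j js; apply: h; rewrite in_cons js orbT.
Qed.

Lemma mem_rat_poles r l : (l \in rat_poles r) = root (rat_den r) l.
Proof.
rewrite /rat_poles mem_undup; case: closed_field_poly_normal => s /= e.
by rewrite [in RHS]e rootZ ?root_prod_XsubC // lead_coef_eq0 rat_den_neq0.
Qed.

Lemma rat_eval_pf r (d : R[i] * (R[i] -> nat -> R[i])) z :
  is_partial_fraction r d -> (rat_den r).[z] != 0 ->
  rat_eval r z = d.1 + \sum_(l <- rat_poles r)
     \sum_(1 <= m < (mup l (rat_den r)).+1) d.2 l m * (z - l)^-1 ^+ m.
Proof.
move=> pf dz; apply: (@evals_inj r z).
  by exists (rat_num r), (rat_den r); split=> //; exact: rat_numdenE.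
rewrite [X in evals X](pf); apply: evals_add; first exact: evals_cst.
apply: evals_sum => l; rewrite mem_rat_poles => rl; apply: evals_sum => m _.
have zl : z - l != 0.
  by apply: contraNneq dz => /subr0_eq ->; rewrite -rootE.
exists (d.2 l m)%:P, (('X - l%:P) ^+ m); split.
- by rewrite horner_exp hornerXsubC expf_neq0.
- by [].
- by rewrite hornerC horner_exp hornerXsubC exprVn.
Qed.
End Evaluation.

Section PolyGrowth.
Context {R : realType}.
Implicit Types (p : {poly R[i]}) (z : R[i]).

Lemma poly_lead p m : (size p <= m.+1)%N -> exists2 C : R, 0 <= C &
  forall z, 1 <= nrm z -> nrm (p.[z] - p`_m * z ^+ m) * nrm z <= C * nrm z ^+ m.
Proof.
move=> sp; exists (\sum_(i < m) nrm p`_i).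
  by apply: sumr_ge0 => i _; exact: nrm_ge0.
move=> z z1; rewrite (horner_coef_wide z sp) big_ord_recr /= addrK.
apply: le_trans (ler_wpM2r (nrm_ge0 z) (nrm_sum _ _)) _.
rewrite !mulr_suml; apply: ler_sum => i _.
rewrite nrmM nrmX -mulrA ler_wpM2l ?nrm_ge0 // -exprSr.
by rewrite ler_weXn2l.
Qed.

Lemma poly_lip p z0 : exists2 C : R, 0 <= C &
  forall z, nrm (z - z0) <= 1 -> nrm (p.[z] - p.[z0]) <= C * nrm (z - z0).
Proof.
have bnd q : exists2 C : R, 0 <= C &
    forall z, nrm (z - z0) <= 1 -> nrm q.[z] <= C.
  exists (\sum_(i < size q) nrm q`_i * (1 + nrm z0) ^+ i).
    apply: sumr_ge0 => i _; rewrite mulr_ge0 ?nrm_ge0 // exprn_ge0 //.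
    by rewrite addr_ge0 // nrm_ge0.
  move=> z z1; rewrite horner_coef; apply: le_trans (nrm_sum _ _) _.
  apply: ler_sum => i _; rewrite nrmM nrmX ler_wpM2l ?nrm_ge0 //.
  rewrite lerXn2r ?nnegrE ?nrm_ge0 ?addr_ge0 ?nrm_ge0 //.
  rewrite -[z in leLHS](subrK z0); apply: le_trans (nrmD _ _) _.
  by rewrite lerD2r.
have /factor_theorem[q qE] : root (p - p.[z0]%:P) z0 by rewrite rootE !hornerE subrr.
have [C C0 h] := bnd q; exists C => // z z1.
have -> : p.[z] - p.[z0] = (p - p.[z0]%:P).[z] by rewrite !hornerE.
by rewrite qE !hornerE nrmM ler_wpM2r ?nrm_ge0 // h.
Qed.
End PolyGrowth.

Section Stable.
Context {R : realType}.
Variables (psi : R) (r : {fraction {poly R[i]}}).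
Hypotheses (psi0 : 0 < psi) (psipi : psi < pi) (rst : Astable psi r).

Let n := rat_num r.
Let d := rat_den r.

Lemma pos_sector (x : R) : 0 < x -> sector psi x%:C.
Proof.
move=> x0; apply/sectorP; first by rewrite psi0.
rewrite /sepf /= normr0 mulr0 subr0 mulr_gt0 // sin_gt0_pi //.
by rewrite psi0.
Qed.

Lemma num_le_den z : sector psi z -> d.[z] != 0 /\ nrm n.[z] <= nrm d.[z].
Proof.
move=> /rst[d0]; rewrite /rat_eval -/n -/d nrmE -[1]/(1%:C) lecR nrm_div => h.
by split=> //; rewrite -[leRHS]mul1r -ler_pdivrMr // nrm_gt0.
Qed.

(** Along the positive half-line [r] would otherwise be unbounded. *)
Lemma stable_size : (size n <= size d)%N.
Proof.
rewrite leqNgt; apply/negP => lt.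
have n0 : n != 0 by rewrite -size_poly_gt0 (leq_ltn_trans _ lt).
have sn : size n = (size n).-1.+1 by rewrite prednK // size_poly_gt0.
move: (size n).-1 sn => m sn; rewrite sn in lt.
have [C C0 hn] := @poly_lead _ n m (eq_leq sn).
have sd : (size d <= m)%N by rewrite -ltnS.
have [C' C'0 hd] := @poly_lead _ d m (leqW sd).
have dm : d`_m = 0 by rewrite nth_default.
have nm : 0 < nrm n`_m by rewrite nrm_gt0 (_ : n`_m = lead_coef n) ?lead_coef_eq0 // /lead_coef sn.
have q0 : 0 <= (C + C') / nrm n`_m by rewrite divr_ge0 ?addr_ge0 ?nrm_ge0.
pose q : R := (C + C') / nrm n`_m; rewrite -/q in q0; pose x : R := 1 + q + 1.
have x1 : 1 <= x by rewrite /x; lra.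
have x0 : 0 < x by lra.
have nx : nrm (x%:C : R[i]) = x by rewrite nrm_real gtr0_norm.
have [dx ndx] := num_le_den (pos_sector x0).
have h1 := hn x%:C; have h2 := hd x%:C.
rewrite nx in h1; rewrite nx dm mul0r subr0 in h2.
have {}h1 := h1 x1; have {}h2 := h2 x1.
have h3 : nrm (n`_m * x%:C ^+ m) * x <= (C + C') * x ^+ m.
  have -> : n`_m * x%:C ^+ m = n.[x%:C] - (n.[x%:C] - n`_m * x%:C ^+ m).
    by rewrite opprB addrC subrK.
  apply: le_trans (ler_wpM2r (ltW x0) (nrmB _ _)) _.
  rewrite !mulrDl [leRHS]addrC; apply: lerD => //.
  by apply: le_trans h2; rewrite ler_wpM2r // ltW.
move: h3; rewrite nrmM nrmX nx mulrAC ler_pM2r ?exprn_gt0 //.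
rewrite mulrC -ler_pdivlMr // leNgt => /negP; apply.
by rewrite -/q /x -addrA addrCA ltrDl addr_gt0.
Qed.

Lemma stable_den0 : d.[0] != 0.
Proof.
apply/negP => /eqP d0.
have n0 : n.[0] != 0.
  have := coprime_rat_num_den r; rewrite -/n -/d coprimep_sym => cop.
  by have := coprimep_root cop; apply; rewrite /root d0.
have [C C0 hn] := @poly_lip _ n 0; have [C' C'0 hd] := @poly_lip _ d 0.
have nn : 0 < nrm n.[0] by rewrite nrm_gt0.
(* near 0 the denominator would be smaller than the numerator *)
pose y : R := nrm n.[0] / (C + C' + nrm n.[0]) / 2.
have Cp : 0 < C + C' + nrm n.[0] by lra.
have y0 : 0 < y by rewrite !divr_gt0.
have yE : y * (C + C' + nrm n.[0]) * 2 = nrm n.[0].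
  by rewrite /y; field; rewrite gt_eqF.
have y1 : y <= 1 by nra.
have ny : nrm (y%:C - 0 : R[i]) = y by rewrite subr0 nrm_real gtr0_norm.
have [_ le] := num_le_den (pos_sector y0).
have h1 := hn y%:C; have h2 := hd y%:C; rewrite ny in h1; rewrite ny d0 subr0 in h2.
have {}h1 := h1 y1; have {}h2 := h2 y1.
have : nrm n.[0] - nrm n.[y%:C] <= nrm (n.[y%:C] - n.[0]).
  by rewrite nrm_distC; have := nrmDZl n.[0] (- n.[y%:C]); rewrite nrmN.
nra.
Qed.

Lemma stable_pole l : root d l -> l != 0 /\ psi <= `|carg l|.
Proof.
move=> dl; have l0 : l != 0.
  by apply: contraTneq dl => ->; rewrite /root stable_den0.
split=> //; rewrite leNgt; apply/negP => lpsi.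
have [] := @num_le_den l; first by split.
by move: dl; rewrite /root => ->.
Qed.

(** The value at infinity, as a quotient of coefficients of the same degree;
    the one of the numerator may vanish. *)
Let m := (size d).-1.
Definition rat_lim : R[i] := n`_m / d`_m.

Let dm0 : d`_m != 0.
Proof. by rewrite -/(lead_coef d) lead_coef_eq0 rat_den_neq0. Qed.

Lemma rat_lim_rate : exists C Z : R, [/\ 0 <= C, 1 <= Z & forall z, Z <= nrm z ->
  d.[z] != 0 /\ nrm (rat_eval r z - rat_lim) * nrm z <= C].
Proof.
have sd : size d = m.+1 by rewrite prednK // size_poly_gt0 rat_den_neq0.
rewrite /rat_lim; move: (m) sd dm0 => k sd dk0.
pose e : {poly R[i]} := d`_k *: n - n`_k *: d.
have em : e`_k = 0 by rewrite coefB !coefZ mulrC subrr.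
have se : (size e <= k.+1)%N.
  rewrite (leq_trans (size_polyD _ _)) // geq_max size_polyN -sd.
  rewrite (leq_trans (size_scale_leq _ _) stable_size) /=.
  exact: size_scale_leq.
have [C C0 he] := poly_lead se; have [C' C'0 hd] := poly_lead (eq_leq sd).
have D0 : 0 < nrm d`_k by rewrite nrm_gt0.
pose Z : R := 1 + 2 * C' / nrm d`_k.
have ZE : nrm d`_k * (Z - 1) = 2 * C' by rewrite /Z; field; rewrite gt_eqF.
have Z1 : 1 <= Z by nra.
exists (2 * C / nrm d`_k ^+ 2), Z; split=> //.
  by rewrite divr_ge0 ?mulr_ge0 ?exprn_ge0 // ltW.
move=> z zZ; have z1 : 1 <= nrm z by lra.
have {}he := he z z1; have {}hd := hd z z1; rewrite em mul0r subr0 in he.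
have zm : 0 < nrm z ^+ k by rewrite exprn_gt0 //; lra.
have low : nrm d`_k / 2 * nrm z ^+ k <= nrm d.[z].
  have h : nrm d`_k * nrm z ^+ k - nrm (d.[z] - d`_k * z ^+ k) <= nrm d.[z].
    have := nrmDZl (d`_k * z ^+ k) (d.[z] - d`_k * z ^+ k).
    by rewrite [d`_k * _ + _]addrC subrK nrmM nrmX.
  suff : nrm (d.[z] - d`_k * z ^+ k) <= nrm d`_k / 2 * nrm z ^+ k by lra.
  rewrite -(ler_pM2r (_ : 0 < nrm z)); last by lra.
  apply: le_trans hd _; rewrite mulrAC ler_pM2r //.
  nra.
have dz : 0 < nrm d.[z] by apply: lt_le_trans low; rewrite mulr_gt0 ?divr_gt0.
have dz0 : d.[z] != 0 by rewrite -nrm_gt0.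
split=> //; have -> : rat_eval r z - n`_k / d`_k = e.[z] / (d`_k * d.[z]).
  rewrite /rat_eval -/n -/d /e hornerD hornerN !hornerZ; field.
  by rewrite dk0 dz0.
rewrite nrm_div nrmM mulrAC ler_pdivrMr ?mulr_gt0 //.
apply: le_trans he _.
have -> : 2 * C / nrm d`_k ^+ 2 * (nrm d`_k * nrm d.[z]) = C / (nrm d`_k / 2) * nrm d.[z].
  by field; rewrite gt_eqF.
rewrite -mulrA ler_wpM2l // mulrC ler_pdivlMr ?divr_gt0 // mulrC //.
Qed.

Lemma cinfty_filter : ProperFilter (@cinfty R).
Proof.
apply: filter_from_proper; last first.
  move=> M _; exists ((`|M| + 1)%:C) => /=.
  rewrite nrmE nrm_real ltcR ger0_norm ?addr_ge0 //.
  by rewrite ltr_pwDr // ler_norm.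
apply: filter_from_filter; first by exists 0.
move=> M N _ _; exists (Num.max M N) => //= z /=.
by rewrite nrmE !ltcR gt_max => /andP[].
Qed.

Lemma rat_inftyE : rat_infty r = rat_lim.
Proof.
have PF := cinfty_filter.
apply: (@cvg_lim R[i]^o) => //; apply/cvgrPdist_le => /= eps eps0.
have [C [Z [C0 Z1 h]]] := rat_lim_rate.
have eE : eps = (complex.Re eps)%:C by rewrite RRe_real // gtr0_real.
have e0 : 0 < complex.Re eps by rewrite -ltcR -eE.
exists (Num.max Z (C / complex.Re eps)) => //= z /=.
rewrite nrmE ltcR gt_max => /andP[z1 z2].
have [_ hz] := h z (ltW z1); rewrite eE.
rewrite nrmE lecR nrm_distC.
have nz : 0 < nrm z by lra.
rewrite -(ler_pM2r nz); apply: le_trans hz _.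
by rewrite mulrC -ler_pdivrMr // ltW.
Qed.
End Stable.

(** * Sectorial operators *)

Section Sectorial.
Context {R : realType} {X : completeNormedModType R[i]}.
Implicit Types (A : operator X) (l z : R[i]).

Lemma shift_solve l A : set_surj (op_dom A) setT (shift_op l A) -> forall x,
  op_dom A (op_inv (shift_op l A) x) /\
  l *: op_inv (shift_op l A) x + A (op_inv (shift_op l A) x) = x.
Proof.
move=> sj x; split.
  by apply: (@surjpinv_image_sub _ _ (fun=> point) _ _ _ sj); exists x.
exact: (surjpK _ sj (mem_set (I : setT x))).
Qed.

Lemma sepf_lt0P (th : R) z : 0 < th -> th < pi -> z != 0 -> th < `|carg z| ->
  sepf th z < 0.
Proof.
move=> th0 thpi z0 za; have [t [tp te ->]] := polarP z0.
rewrite (sepf_polar _ (nrm_ge0 z) tp) pmulr_rlt0 ?nrm_gt0 //.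
rewrite -[th - _]opprB sinN oppr_lt0 sin_gt0_pi //.
by rewrite te in tp *; lra.
Qed.

Lemma notin_closed_sector (phi th : R) z : 0 < phi -> phi < th -> th < pi ->
  sepf th z < 0 -> ~ closed_sector phi z.
Proof.
move=> p0 pt tpi hz cl.
pose eta : R := - sepf th z / 2; have e0 : 0 < eta by rewrite /eta; lra.
have eC : 0 < eta%:C :> R[i] by rewrite ltcR.
have [w [[w0 wphi] bw]] := cl _ (nbhsx_ballx (z : R[i]^o) _ eC).
have {}bw : nrm (z - w) < eta by rewrite -ltcR -nrmE; exact: bw.
have [t [tp te we]] := polarP w0.
have : 0 < sepf th w.
  rewrite we (sepf_polar _ (nrm_ge0 w) tp) mulr_gt0 ?nrm_gt0 //.
  by rewrite sin_gt0_pi // te; have := normr_ge0 (carg w); lra.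
have := sepf_lip th w z; rewrite nrm_distC; rewrite /eta in bw; lra.
Qed.

Section Resolvent.
Variables (A : operator X) (phi th : R).
Hypotheses (phi0 : 0 < phi) (phith : phi < th) (thpi : th < pi).
Hypothesis Asect : sectorial phi A.

(** [z (z - A)^-1]. *)
Definition resT z x : X := (- z) *: op_inv (shift_op (- z) A) x.

(** The sectoriality constant as a real number; it is finite by [MsectE]. *)
Definition Mth : R := fine (Msect th A).

Lemma sectorial_inv z : sepf th z < 0 -> boundedly_invertible (shift_op (- z) A).
Proof.
move=> hz; apply: contrapT => nb; have [_ _ sp _] := Asect.
exact: (notin_closed_sector phi0 phith thpi hz (sp z nb)).
Qed.

Lemma opnorm_ge0 (f : X -> X) : (0 <= opnorm f)%E.
Proof.
apply: le_trans (_ : (complex.Re `|f 0|)%:E <= _)%E; first by rewrite lee_fin nrm_ge0.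
by apply: ereal_sup_ubound; exists 0 => //=; rewrite normr0.
Qed.

Lemma Msect_ge z : sector (pi - th) z ->
  (opnorm (fun x => z *: op_inv (shift_op z A) x) <= Msect th A)%E.
Proof. by move=> hz; apply: ereal_sup_ubound; exists z. Qed.

Lemma sector_opp z : sepf th z < 0 -> sector (pi - th) (- z).
Proof.
move=> hz; apply/sectorP; first by move: phi0 phith thpi => *; lra.
by rewrite sepfN oppr_gt0.
Qed.

Lemma MsectE : Msect th A = (Mth)%:E.
Proof.
have [_ _ _ h] := Asect; rewrite /Mth fineK // ge0_fin_numE.
  by apply: h; rewrite phith thpi.
apply: le_trans (opnorm_ge0 _) (@Msect_ge 1 _).
apply/sectorP; first by move: phi0 phith thpi => *; lra.
rewrite /sepf /= normr0 mulr0 subr0 mulr1 sin_gt0_pi //.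
by move: phi0 phith thpi => *; lra.
Qed.

Lemma Mth_ge0 : 0 <= Mth.
Proof.
rewrite -lee_fin -MsectE; apply: le_trans (opnorm_ge0 _) (@Msect_ge 1 _).
apply/sectorP; first by move: phi0 phith thpi => *; lra.
rewrite /sepf /= normr0 mulr0 subr0 mulr1 sin_gt0_pi //.
by move: phi0 phith thpi => *; lra.
Qed.

Lemma resT_family : resolvent_family A th Mth resT.
Proof.
move=> z hz x; have [[h1 h2 h3] _] := sectorial_inv hz.
have zn : z != 0.
  by apply: contraTneq hz => ->; rewrite /sepf /= normr0 !mulr0 subrr ltxx.
have [dx ex] := @shift_solve (- z) A h3 x.
set w := op_inv (shift_op (- z) A) x in dx ex.
have uniq v y : op_dom A y -> - z *: y + A y = v -> y = op_inv (shift_op (- z) A) v.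
  move=> dy ey; have [dv ev] := @shift_solve (- z) A h3 v.
  by apply: h2; rewrite ?inE // /= ey ev.
have hom a v : op_inv (shift_op (- z) A) (a *: v) = a *: op_inv (shift_op (- z) A) v.
  have [dv ev] := @shift_solve (- z) A h3 v.
  symmetry; apply: uniq; first exact: op_dom_scale.
  by rewrite op_funZ // -[in RHS]ev; vring.
split.
- exact: op_dom_scale.
- rewrite /resT -/w op_funZ //; rewrite -[in RHS]ex; vring.
- move=> y dy ey; rewrite /resT -hom; apply: uniq => //.
  by rewrite [RHS]scaleNr -ey; vring.
- have [->|x0] := eqVneq x 0.
    have -> : resT z 0 = 0.
      by have h0 := hom 0 0; rewrite !scale0r in h0; rewrite /resT h0 scaler0.
    by rewrite !nrm0 mulr0.
  have nx : 0 < nrm x by rewrite nrm_gt0.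
  have nC : (nrm x)%:C != 0 :> R[i] by rewrite eq_complex /= gt_eqF.
  pose v := (nrm x)%:C^-1 *: x.
  have xE : x = (nrm x)%:C *: v by rewrite /v scalerA divff // scale1r.
  have nv : `|v| <= 1.
    rewrite nrmE /v nrmZ nrmV nrm_real gtr0_norm // mulVf ?gt_eqF //.
  have : nrm (resT z v) <= Mth.
    rewrite -lee_fin -MsectE; apply: le_trans (Msect_ge (sector_opp hz)).
    by apply: ereal_sup_ubound; exists v.
  move=> h; have -> : resT z x = (nrm x)%:C *: resT z v.
    by rewrite {1}xE /resT hom; vring.
  rewrite nrmZ nrm_real gtr0_norm // mulrC.
  by rewrite ler_wpM2r // ltW.
Qed.
End Resolvent.
End Sectorial.

Section RatOp.
Context {R : realType} {X : completeNormedModType R[i]}.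
Variables (A : operator X) (phi th be : R).
Hypotheses (phi0 : 0 < phi) (phith : phi < th) (thbe : th < be) (bepi : be < pi / 2).
Hypothesis Asect : sectorial phi A.

Let th0 : 0 < th := lt_trans phi0 phith.
Let thpi : th < pi.
Proof. by move: th0 thbe bepi (pi_gt0 R) => *; lra. Qed.
Let HT := resT_family phi0 phith thpi Asect.
Let T := resT A.

(** [fcalc] with unspecified limits, for the operator [A]. *)
Definition fcalcE (u : R[i] -> R[i]) (U : X -> X) :=
  exists u0 ui, fcalc A T be u U u0 ui.

Lemma fcalcE_ext u U v V : (forall z, sec be z -> u z = v z) ->
  (forall x, U x = V x) -> fcalcE u U -> fcalcE v V.
Proof.
move=> uv UV [u0 [ui [nu [l0 li] p d1 d2]]]; exists u0, ui; split.
- exact: nice_ext nu.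
- split; [apply: bigO_ext l0|apply: bigO_ext li] => // z Sz; by rewrite uv.
- move=> x; have [P [h1 h2 h3 h4]] := p x; exists P; split=> //.
    by rewrite -UV.
  by move=> z hz; rewrite -UV -uv ?h4 //; exact: (rays_sec th0 thbe).
- by move=> x; rewrite -UV.
- by move=> x; rewrite -UV.
Qed.

Lemma fcalcE_cst c : fcalcE (fun=> c) (fun x => c *: x).
Proof. by exists c, c; exact: (fcalc_cst HT th0 thbe bepi). Qed.

Lemma fcalcE_add u U v V : fcalcE u U -> fcalcE v V ->
  fcalcE (fun z => u z + v z) (fun x => U x + V x).
Proof.
move=> [u0 [ui hu]] [v0 [vi hv]]; exists (u0 + v0), (ui + vi).
exact: (fcalc_add HT th0 thbe bepi hu hv).
Qed.

Lemma fcalcE_mul u U v V : fcalcE u U -> fcalcE v V ->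
  fcalcE (fun z => u z * v z) (fun x => U (V x)).
Proof.
move=> [u0 [ui hu]] [v0 [vi hv]]; exists (u0 * v0), (ui * vi).
exact: (fcalc_mul hu hv).
Qed.

Lemma fcalcE_scale c u U : fcalcE u U ->
  fcalcE (fun z => c * u z) (fun x => c *: U x).
Proof. exact: fcalcE_mul (fcalcE_cst c). Qed.

Lemma fcalcE_sum (I : eqType) (s : seq I) (u : I -> R[i] -> R[i]) (U : I -> X -> X) :
  (forall i, i \in s -> fcalcE (u i) (U i)) ->
  fcalcE (fun z => \sum_(i <- s) u i z) (fun x => \sum_(i <- s) U i x).
Proof.
elim: s => [|i s IH] h.
  apply: fcalcE_ext (fcalcE_cst 0) => [z _|x]; first by rewrite big_nil.
  by rewrite big_nil scale0r.
have hi := h i (mem_head _ _).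
have hs : fcalcE (fun z => \sum_(i <- s) u i z) (fun x => \sum_(i <- s) U i x).
  by apply: IH => j js; apply: h; rewrite in_cons js orbT.
by apply: fcalcE_ext (fcalcE_add hi hs) => [z _|x]; rewrite big_cons.
Qed.

Lemma fcalcE_iter u U m : fcalcE u U -> fcalcE (fun z => u z ^+ m) (iter m U).
Proof.
move=> h; elim: m => [|m IH].
  by apply: fcalcE_ext (fcalcE_cst 1) => [z _|x]; rewrite ?expr0 ?scale1r.
by apply: fcalcE_ext (fcalcE_mul h IH) => [z _|x] //; rewrite exprS.
Qed.

Lemma away_scale (k : R) l : 0 < k -> l != 0 -> be < `|carg l| ->
  away (sec be) (l / k%:C).
Proof.
move=> k0 l0 la; have [t [tp te lE]] := polarP l0.
have -> : l / k%:C = (nrm l / k)%:C * cis t.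
  by rewrite {1}lE rmorphM fmorphV /= mulrAC.
apply: sec_away; first exact: lt_trans th0 thbe.
  by rewrite tp te la.
by rewrite divr_gt0 // nrm_gt0.
Qed.

Lemma scaled_resolvent (k : R) (l : R[i]) : 0 < k -> l != 0 -> be < `|carg l| ->
  let U := op_inv (shift_op (- l) (scale_op k%:C A)) in
  fcalcE (fun z => (k%:C * z - l)^-1) U /\
  forall x, op_dom A (U x) /\ k%:C *: A (U x) - l *: U x = x.
Proof.
move=> k0 l0 la U; have kC : k%:C != 0 :> R[i] by rewrite eq_complex /= gt_eqF.
have sl : sepf th (l / k%:C) < 0.
  rewrite mulrC -fmorphV /= sepfZ ?invr_ge0 ?(ltW k0) // pmulr_rlt0 ?invr_gt0 //.
  by apply: sepf_lt0P => //; apply: lt_trans la.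
have [[_ _ sj] _] := sectorial_inv phi0 phith thpi Asect sl.
have sU : set_surj (op_dom (scale_op k%:C A)) setT (shift_op (- l) (scale_op k%:C A)).
  move=> x _; have [y dy ey] := sj (k%:C^-1 *: x) I; exists y => //=.
  have -> : - l *: y + k%:C *: A y = k%:C *: (- (l / k%:C) *: y + A y) by vfield.
  by rewrite [X in _ *: X](ey) scalerA divff // scale1r.
have hU x : op_dom A (U x) /\ k%:C *: A (U x) - l *: U x = x.
  have [d e] := shift_solve (l := - l) (A := scale_op k%:C A) sU x; split=> //.
  by move: e; rewrite -/(U x) /= => e; rewrite -[RHS]e scaleNr addrC.
split=> //; exists (- l^-1), 0.
by apply: (fcalc_resolvent HT th0 thbe bepi) => //; exact: away_scale.
Qed.

Variables (psi : R) (r : {fraction {poly R[i]}}).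
Hypotheses (bepsi : be < psi) (psipi : psi <= pi / 2) (rst : Astable psi r).

Let psi0 : 0 < psi := lt_trans th0 (lt_trans thbe bepsi).
Let psipi' : psi < pi.
Proof. by move: psipi (pi_gt0 R) => *; lra. Qed.

Lemma sec_sector z (k : R) : 0 < k -> sec be z -> sector psi (k%:C * z).
Proof.
move=> k0 [rho [t [r0 tb ->]]]; apply/sectorP; first by rewrite psi0 psipi'.
move: bepsi psi0 psipi' => h1 h2 h3; rewrite sepfZ ?(ltW k0) // pmulr_rgt0 //.
rewrite sepf_polar ?(ltW r0) //; last by lra.
rewrite mulr_gt0 // sin_gt0_pi //; have := normr_ge0 t; lra.
Qed.

Lemma rat_op_fcalc (k : R) : 0 < k ->
  fcalcE (fun z => rat_eval r (k%:C * z)) (rat_op r (scale_op k%:C A)).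
Proof.
move=> k0; have pf := partial_fraction_exists (stable_size psi0 psipi' rst).
set d := partial_fraction r in pf.
pose U l := op_inv (shift_op (- l) (scale_op k%:C A)).
have hl l : l \in rat_poles r -> fcalcE (fun z => (k%:C * z - l)^-1) (U l).
  rewrite mem_rat_poles => rl; have [l0 la] := stable_pole psi0 psipi' rst rl.
  by have [] := scaled_resolvent k0 l0 (lt_le_trans bepsi la).
have hm l m : l \in rat_poles r ->
    fcalcE (fun z => d.2 l m * (k%:C * z - l)^-1 ^+ m) (fun x => d.2 l m *: iter m (U l) x).
  by move=> lp; apply: fcalcE_scale; apply: fcalcE_iter; exact: hl.
have hs := fcalcE_add (fcalcE_cst d.1) (fcalcE_sum (fun l lp =>
   @fcalcE_sum _ (index_iota 1 (mup l (rat_den r)).+1) _ _ (fun m _ => hm l m lp))).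
apply: fcalcE_ext hs => [z Sz|x].
  rewrite (rat_eval_pf pf) //.
  by have [] := rst (sec_sector k0 Sz).
by rewrite /rat_op -/d; case: (d).
Qed.

Lemma prod_fcalc (I : Type) (s : seq I) (k : I -> R) : (forall i, 0 < k i) ->
  fcalcE (fun z => \prod_(i <- s) rat_eval r ((k i)%:C * z))
    (\big[comp/idfun]_(i <- s) rat_op r (scale_op (k i)%:C A)).
Proof.
move=> k0; elim: s => [|i s IH].
  by apply: fcalcE_ext (fcalcE_cst 1) => [z _|x]; rewrite big_nil ?scale1r.
by apply: fcalcE_ext (fcalcE_mul (rat_op_fcalc (k0 i)) IH) => [z _|x]; rewrite big_cons.
Qed.
End RatOp.

(** * Stable rational functions on rays *)

Section LocalBehaviour.
Context {R : realType}.
Variables (r : {fraction {poly R[i]}}).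
Let n := rat_num r.
Let d := rat_den r.

Lemma den_near z0 : d.[z0] != 0 -> exists2 e : R, 0 < e <= 1 &
  forall z, nrm (z - z0) <= e -> nrm d.[z0] / 2 <= nrm d.[z] /\ d.[z] != 0.
Proof.
move=> d0; have [C C0 h] := poly_lip d z0; have D0 : 0 < nrm d.[z0] by rewrite nrm_gt0.
have K0 : 0 < 2 * C + nrm d.[z0] by rewrite ltr_wpDl ?mulr_ge0 // nrm_gt0.
pose e : R := nrm d.[z0] / (2 * C + nrm d.[z0]).
have eE : e * (2 * C + nrm d.[z0]) = nrm d.[z0] by rewrite divfK // gt_eqF.
have e0 : 0 < e by rewrite divr_gt0.
have e1 : e <= 1 by rewrite ler_pdivrMr // mul1r lerDr mulr_ge0.
exists e; first by rewrite e0.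
move=> z ze; have {}h := h z (le_trans ze e1).
have ze' := ler_wpM2l C0 ze.
have lb : nrm d.[z0] / 2 <= nrm d.[z].
  have := nrmDZl d.[z0] (d.[z] - d.[z0]); rewrite [d.[z0] + _]addrC subrK => h2.
  have := mulr_ge0 (ltW e0) (ltW D0); clearbody e; lra.
by split=> //; rewrite -nrm_gt0; apply: lt_le_trans lb; rewrite divr_gt0.
Qed.

(** The leading term of [r] at a point that is not a pole: either [r] is
    constant, or [r(z) = r(z0) + kap (z - z0)^p + ...]. *)
Lemma local_expansion z0 : d.[z0] != 0 ->
  (forall z, d.[z] != 0 -> rat_eval r z = rat_eval r z0) \/
  exists (p : nat) (kap : R[i]) (C e : R), [/\ (0 < p)%N, kap != 0, 0 <= C, 0 < e <= 1 &
    forall z, nrm (z - z0) <= e -> d.[z] != 0 /\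
      nrm (rat_eval r z - rat_eval r z0 - kap * (z - z0) ^+ p)
        <= C * nrm (z - z0) ^+ p.+1].
Proof.
move=> d0; pose E : {poly R[i]} := d.[z0] *: n - n.[z0] *: d.
have EE z : E.[z] = d.[z0] * n.[z] - n.[z0] * d.[z].
  by rewrite /E hornerD hornerN !hornerZ.
have diff z : d.[z] != 0 -> rat_eval r z - rat_eval r z0 = E.[z] / (d.[z] * d.[z0]).
  by move=> dz; rewrite /rat_eval -/n -/d EE; field; rewrite dz d0.
have [E0|E0] := eqVneq E 0.
  left=> z dz; apply/eqP; rewrite -subr_eq0 diff // E0 horner0 mul0r //.
right; have [p [q q0 qE]] := multiplicity_XsubC E z0.
rewrite E0 /= in q0.
have p0 : (0 < p)%N.
  rewrite lt0n; apply: contraNneq q0 => p0.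
  have := EE z0; rewrite mulrC subrr qE p0 expr0 mulr1 => qz.
  by rewrite /root qz.
have qz : q.[z0] != 0 by [].
pose kap := q.[z0] / d.[z0] ^+ 2.
have [e e01 near] := den_near d0.
pose m : {poly R[i]} := d.[z0] *: q - q.[z0] *: d.
have [C C0 hm] := poly_lip m z0.
have mz : m.[z0] = 0 by rewrite /m hornerD hornerN !hornerZ mulrC subrr.
have D0 : 0 < nrm d.[z0] by rewrite nrm_gt0.
exists p, kap, (2 * C / nrm d.[z0] ^+ 3), e; split=> //.
- by rewrite mulf_neq0 ?invr_eq0 ?expf_neq0.
- by rewrite divr_ge0 ?mulr_ge0 ?exprn_ge0 // ltW.
move=> z ze; have [lb dz] := near z ze; split=> //.
have -> : rat_eval r z - rat_eval r z0 - kap * (z - z0) ^+ p =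
   (z - z0) ^+ p * (m.[z] / (d.[z] * d.[z0] ^+ 2)).
  rewrite diff // qE hornerM horner_exp hornerXsubC /kap /m hornerD hornerN !hornerZ.
  by field; rewrite dz d0.
rewrite nrmM nrmX [_ ^+ p.+1]exprS mulrA [leRHS]mulrC.
rewrite ler_wpM2l ?exprn_ge0 ?nrm_ge0 // nrm_div nrmM nrmX.
have e1 : e <= 1 by case/andP: e01.
have {}hm := hm z (le_trans ze e1); rewrite mz subr0 in hm.
have dp : 0 < nrm d.[z] by rewrite nrm_gt0.
rewrite ler_pdivrMr ?mulr_gt0 ?exprn_gt0 //; apply: le_trans hm _.
have -> : 2 * C / nrm d.[z0] ^+ 3 * nrm (z - z0) * (nrm d.[z] * nrm d.[z0] ^+ 2) =
  (C * nrm (z - z0)) * (nrm d.[z] / (nrm d.[z0] / 2)).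
  by field; rewrite gt_eqF.
by rewrite ler_peMr ?mulr_ge0 ?nrm_ge0 // ler_pdivlMr ?divr_gt0 // mul1r.
Qed.

Lemma local_lip z0 : d.[z0] != 0 -> exists C e : R, [/\ 0 <= C, 0 < e <= 1 &
    forall z, nrm (z - z0) <= e -> d.[z] != 0 /\
      nrm (rat_eval r z - rat_eval r z0) <= C * nrm (z - z0)].
Proof.
move=> d0; have [cst|[p [kap [C [e [p0 k0 C0 e01 h]]]]]] := local_expansion d0.
  have [e e01 near] := den_near d0; exists 0, e; split=> // z ze.
  by have [_ dz] := near z ze; rewrite cst // subrr nrm0 mul0r.
exists (C + nrm kap), e; split=> //; first by rewrite addr_ge0 ?nrm_ge0.
move=> z ze; have [dz hz] := h z ze; split=> //.
have x1 : nrm (z - z0) <= 1 by case/andP: e01 => _; apply: le_trans.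
move: p p0 h hz => [//|p] _ _ hz.
rewrite -[X in nrm X](subrK (kap * (z - z0) ^+ p.+1)).
apply: le_trans (nrmD _ _) _; rewrite mulrDl; apply: lerD.
  apply: le_trans hz _; rewrite ler_wpM2l // exprS ler_piMr ?nrm_ge0 //.
  by rewrite exprn_ile1 ?nrm_ge0.
rewrite nrmM nrmX ler_wpM2l ?nrm_ge0 // exprS ler_piMr ?nrm_ge0 //.
by rewrite exprn_ile1 ?nrm_ge0.
Qed.
End LocalBehaviour.

Section RealEstimates.
Context {R : realType}.

Lemma small_radius (e D s : R) : 0 < e -> 0 <= D -> 0 < s ->
  exists2 h : R, 0 < h <= e & forall rho : R, rho <= h -> D * rho <= s.
Proof.
move=> e0 D0 s0; exists (Num.min e (s / (D + 1))).
  by rewrite lt_min e0 ge_min lexx divr_gt0 // ltr_wpDl.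
move=> rho; rewrite le_min => /andP[_ h]; apply: le_trans (ler_wpM2l D0 h) _.
rewrite mulrA ler_pdivrMr ?ltr_wpDl //; nra.
Qed.

Lemma min_pos (a b : R) : 0 < a -> 0 < b -> exists m : R, [/\ 0 < m, m <= a & m <= b].
Proof.
by move=> a0 b0; exists (Num.min a b); rewrite lt_min a0 b0 !ge_min !lexx orbT.
Qed.

Lemma nrm1D_le (u : R[i]) : nrm (1 + u) <= 1 + complex.Re u + nrm u ^+ 2.
Proof.
have uu := nrm_sqr u; have u2 := nrm_sqr (1 + u).
have E1 : complex.Re (1 + u) = 1 + complex.Re u by case: (u).
have E2 : complex.Im (1 + u) = complex.Im u by case: (u) => ? ? /=; rewrite add0r.
rewrite E1 E2 in u2; rewrite uu.
move: (nrm (1 + u)) (nrm_ge0 (1 + u)) u2 => N N0.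
move: (complex.Re u) (complex.Im u) => a b {uu E1 E2} u2.
have s1 := sqr_ge0 (a + 1 / 2); have s2 := sqr_ge0 b.
have p0' : 0 <= 1 + a + (a ^+ 2 + b ^+ 2) by lra.
rewrite -(ler_sqr N0 p0') u2.
have := sqr_ge0 (a + (a ^+ 2 + b ^+ 2)); have := sqr_ge0 a; lra.
Qed.

Lemma one_sub_le_inv (x : R) : 0 <= x -> 1 - x <= (1 + x)^-1.
Proof.
move=> x0; have x1 : 0 < 1 + x by lra.
rewrite -(ler_pM2r x1) mulVf ?gt_eqF //; nra.
Qed.

Lemma vertex_arith_lt1 (D P rho s V x y : R) : D * P <= D * rho ->
  s / 2 * P <= s / 2 * 1 -> y <= D * P -> x - y <= V -> D * rho <= s / 2 ->
  s = 1 - V -> x <= 1 - s / 2 * P.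
Proof. lra. Qed.

Lemma vertex_arith_eq1 (P k C rho eta Q : R) : P * ((k + C) * rho) <= P * (eta / 2) ->
  P ^+ 2 * k <= P * rho * k -> P * Q <= P * - eta ->
  1 + P * Q + P ^+ 2 * k + C * (P * rho) <= 1 - eta / 2 * P.
Proof. lra. Qed.
End RealEstimates.

Section RayBounds.
Context {R : realType}.
Variables (psi : R) (r : {fraction {poly R[i]}}).
Hypotheses (psi0 : 0 < psi) (psipi : psi < pi) (rst : Astable psi r).
Hypothesis rinf : nrm (rat_lim r) < 1.

Let d := rat_den r.

Lemma stable_le1 z : sector psi z -> nrm (rat_eval r z) <= 1.
Proof. by move=> /rst[_]; rewrite nrmE -[1]/(1%:C) lecR. Qed.

Lemma polar_sector (rho t : R) : 0 < rho -> `|t| < psi -> sector psi (rho%:C * cis t).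
Proof.
move=> r0 tb; apply/sectorP; first by rewrite psi0 psipi.
move: psi0 psipi => h1 h2.
rewrite sepf_polar ?(ltW r0) //; last by lra.
rewrite mulr_gt0 // sin_gt0_pi //; have := normr_ge0 t; lra.
Qed.

Lemma const_lt1 z0 : (forall z, d.[z] != 0 -> rat_eval r z = rat_eval r z0) ->
  nrm (rat_eval r z0) < 1.
Proof.
move=> cst; have [C [Z [C0 Z1 h]]] := rat_lim_rate psi0 psipi rst.
suff : nrm (rat_eval r z0 - rat_lim r) <= 0.
  have := nrmDZl (rat_eval r z0) (rat_lim r - rat_eval r z0).
  rewrite [_ + (rat_lim r - _)]addrC subrK [nrm (rat_lim r - _)]nrm_distC.
  by move: rinf; lra.
apply: (@archi_le _ _ _ C (Num.bound Z)) => s sZ s0; rewrite add0r.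
have sR : 0 < s%:R :> R by rewrite ltr0n.
have Zs : Z <= s%:R.
  by apply: ltW; apply: lt_le_trans (archi_boundP _) _; rewrite ?ler_nat //; lra.
have ns : nrm (s%:R%:C : R[i]) = s%:R by rewrite nrm_real gtr0_norm.
have Zn : Z <= nrm (s%:R%:C : R[i]) by rewrite ns.
have [ds hs] := h _ Zn.
by rewrite ler_pdivlMr // -(cst _ ds) -[X in _ * X]ns.
Qed.

(** Maximum modulus principle. *)
Lemma stable_lt1 z0 : sector psi z0 -> nrm (rat_eval r z0) < 1.
Proof.
move=> sz0; have [dz0 _] := rst sz0.
have [cst|[p [kap [C [e [p0 k0 C0 /andP[e0 e1] h]]]]]] := local_expansion dz0.
  exact: const_lt1.
rewrite lt_neqAle stable_le1 // andbT; apply/eqP => n1.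
set v := rat_eval r z0 in n1 h.
(* a direction in which the leading term of the expansion is a positive
   multiple of [v] *)
pose w : R[i] := p.-root (v / kap).
have wp : kap * w ^+ p = v by rewrite rootCK // mulrC divfK.
have w0 : 0 <= nrm w := nrm_ge0 w.
have sep : 0 < sepf psi z0 by apply/sectorP; rewrite ?psi0.
pose W : R := C * nrm w ^+ p.+1.
have W0 : 0 <= W by rewrite mulr_ge0 ?exprn_ge0.
pose K : R := 1 + nrm w / e + 3 * nrm w / sepf psi z0 + 2 * W.
have a1 : 0 <= nrm w / e by rewrite divr_ge0 // ltW.
have a2 : 0 <= 3 * nrm w / sepf psi z0 by rewrite divr_ge0 ?mulr_ge0 // ltW.
have K1 : 1 <= K by rewrite /K; lra.
pose eta : R := K^-1; have K0 : 0 < K by lra.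
have eta0 : 0 < eta by rewrite invr_gt0.
have bnd (x : R) : x <= K -> eta * x <= 1.
  by move=> xK; rewrite mulrC ler_pdivrMr // mul1r.
have b1 : eta * nrm w <= e.
  have : eta * (nrm w / e) <= 1 by apply: bnd; rewrite /K; lra.
  by rewrite mulrA ler_pdivrMr // mul1r.
have b2 : eta * (3 * nrm w) <= sepf psi z0.
  have : eta * (3 * nrm w / sepf psi z0) <= 1 by apply: bnd; rewrite /K; lra.
  by rewrite mulrA ler_pdivrMr // mul1r.
have b3 : eta * (2 * W) <= 1 by apply: bnd; rewrite /K; lra.
have en : nrm (eta%:C : R[i]) = eta by rewrite nrm_real gtr0_norm.
pose z := z0 + eta%:C * w.
have zz : z - z0 = eta%:C * w by rewrite /z addrC addKr.
have [dz hz] : d.[z] != 0 /\ nrm (rat_eval r z - v - kap * (z - z0) ^+ p)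
    <= C * nrm (z - z0) ^+ p.+1 by apply: h; rewrite zz nrmM en.
have sz : sector psi z.
  apply/sectorP; first by rewrite psi0 psipi.
  have := sepf_lip psi z0 z; rewrite nrm_distC zz nrmM en.
  move: b2 sep w0 eta0; clear; nra.
have le1 := stable_le1 sz.
rewrite zz exprMn mulrCA wp nrmM en exprMn in hz.
have big : nrm (v + eta%:C ^+ p * v) = 1 + eta ^+ p.
  have -> : v + eta%:C ^+ p * v = (1 + eta ^+ p)%:C * v.
    by rewrite rmorphD rmorphXn /= mulrDl mul1r.
  by rewrite nrmM n1 mulr1 nrm_real ger0_norm // addr_ge0 // exprn_ge0 // ltW.
have : nrm (v + eta%:C ^+ p * v) <= nrm (rat_eval r z) + C * (eta ^+ p.+1 * nrm w ^+ p.+1).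
  have -> : v + eta%:C ^+ p * v =
     rat_eval r z - (rat_eval r z - v - eta%:C ^+ p * v) by ring.
  by apply: le_trans (nrmB _ _) _; rewrite lerD2l.
rewrite big mulrCA -/W exprSr -mulrA.
have ep : 0 < eta ^+ p by rewrite exprn_gt0.
have := ler_wpM2l (ltW ep) b3; rewrite mulr1 mulrA.
by lra.
Qed.

Variable be : R.
Hypotheses (be0 : 0 < be) (bepsi : be < psi).

(** Behaviour at the vertex: if [|r(0)| = 1], then the leading coefficient of
    [r - r(0)] has to point strictly into the disc along rays inside the
    sector, since [r] maps the sector into the disc. *)
Lemma vertex_bound : exists (p : nat) (C del rho0 : R),
  [/\ (0 < p)%N, 0 <= C, 0 < del, 0 < rho0 <= 1 & forall rho t : R, 0 < rho -> rho <= rho0 ->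
     `|t| = be ->
     nrm (rat_eval r (rho%:C * cis t) - rat_eval r 0) <= C * rho ^+ p /\
     nrm (rat_eval r (rho%:C * cis t)) <= (1 + del * rho ^+ p)^-1].
Proof.
have d0 : d.[0] != 0 := stable_den0 psi0 psipi rst.
set v := rat_eval r 0.
have npol (rho t : R) : 0 < rho -> nrm (rho%:C * cis t - 0 : R[i]) = rho.
  by move=> r0; rewrite subr0 nrm_polar.
have [cst|[p [kap [C [e [p0 k0 C0 /andP[e0 e1] h]]]]]] := local_expansion d0.
  have v1 : nrm v < 1 := const_lt1 cst.
  exists 1%N, 0, (1 - nrm v), 1; split=> //; rewrite ?subr_gt0 ?ltr01 ?lexx //.
  move=> rho t r0 r1 tb.
  have tpsi : `|t| < psi by rewrite tb.
  have [dz _] := rst (polar_sector r0 tpsi).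
  rewrite cst // subrr nrm0 mul0r expr1; split=> //; rewrite -/v.
  have v10 : 0 <= 1 - nrm v by rewrite subr_ge0 ltW.
  apply: le_trans (one_sub_le_inv (mulr_ge0 v10 (ltW r0))).
  have := ler_wpM2l v10 r1; move: (nrm v) => V; lra.
have k0n : 0 < nrm kap by rewrite nrm_gt0.
pose D : R := nrm kap + C; have D0 : 0 <= D by rewrite addr_ge0 // ltW.
have rp1 (rho : R) : 0 < rho -> rho <= 1 -> 0 < rho ^+ p <= rho.
  move=> r0 r1; rewrite exprn_gt0 //=; move: p p0 {h} => [//|q] _.
  by rewrite exprS ler_piMr ?(ltW r0) // exprn_ile1 // ltW.
(* the expansion along rays *)
have near (rho t : R) : 0 < rho -> rho <= e ->
    nrm (rat_eval r (rho%:C * cis t) - v - kap * (rho%:C * cis t) ^+ p) <= C * (rho ^+ p * rho).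
  move=> r0 re; have [] := h (rho%:C * cis t); rewrite npol //.
  by rewrite subr0 exprSr.
have f2 (rho t : R) : 0 < rho -> rho <= e ->
    nrm (rat_eval r (rho%:C * cis t) - v) <= D * rho ^+ p.
  move=> r0 re; have := near rho t r0 re => hz; have r1 : rho <= 1 by lra.
  rewrite -[X in nrm X](subrK (kap * (rho%:C * cis t) ^+ p)).
  apply: le_trans (nrmD _ _) _; rewrite nrmM nrmX nrm_polar // /D mulrDl addrC lerD2l.
  have /andP[q0 q1] := rp1 rho r0 r1.
  by apply: le_trans hz _; rewrite ler_wpM2l // ler_piMr // ltW.
have evt (s : nat) : e^-1 <= s%:R -> 0 < (s%:R : R)^-1 <= e.
  move=> es; have ei : 0 < e^-1 by rewrite invr_gt0.
  have sR : 0 < s%:R :> R by lra.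
  by rewrite invr_gt0 sR /= -[e]invrK lef_pV2 ?posrE.
have evs (s : nat) : (Num.bound e^-1 <= s)%N -> e^-1 <= s%:R.
  move=> bs; apply: ltW; apply: lt_le_trans (archi_boundP _) _.
    by rewrite invr_ge0 ltW.
  by rewrite ler_nat.
have v1 : nrm v <= 1.
  apply: (@archi_le _ _ _ D (Num.bound e^-1)) => s /evs /evt /andP[r0 re] _.
  have tpsi : `|be| < psi by rewrite gtr0_norm.
  have := stable_le1 (polar_sector r0 tpsi).
  have := f2 _ be r0 re; have r1 : s%:R^-1 <= 1 :> R by lra.
  have /andP[_ q1] := rp1 _ r0 r1; have := ler_wpM2l D0 q1.
  have := nrmDZl v (rat_eval r ((s%:R^-1)%:C * cis be) - v).
  rewrite [v + _]addrC subrK; lra.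
have {v1} [v1|v1] : nrm v < 1 \/ nrm v = 1.
  by move: v1; rewrite le_eqVlt => /predU1P[]; [right|left].
  pose s : R := 1 - nrm v; have s0 : 0 < s by rewrite subr_gt0.
  have s2 : 0 < s / 2 by rewrite divr_gt0.
  have [rho0 /andP[rho00 rho0e] Dr] := small_radius e0 D0 s2.
  exists p, D, (s / 2), rho0; split=> //; first by rewrite rho00 (le_trans rho0e).
  move=> rho t r0 rK tb; have re : rho <= e := le_trans rK rho0e.
  have hf := f2 rho t r0 re; split=> //.
  have r1 : rho <= 1 := le_trans re e1.
  have /andP[q0 q1] := rp1 rho r0 r1.
  have {}Dr := Dr rho rK.
  have := nrmDZl (rat_eval r (rho%:C * cis t)) (v - rat_eval r (rho%:C * cis t)).
  rewrite [_ + (v - _)]addrC subrK nrm_distC => h2.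
  apply: le_trans (one_sub_le_inv (mulr_ge0 (ltW s2) (ltW q0))).
  have u1 := ler_wpM2l D0 q1; have sE : s = 1 - nrm v by [].
  have u2 := ler_wpM2l (ltW s2) (le_trans q1 r1).
  exact: vertex_arith_lt1 u1 u2 hf h2 Dr sE.
have v0 : v != 0 by rewrite -nrm_gt0 v1.
pose kv := kap / v; have kvn : nrm kv = nrm kap by rewrite nrm_div v1 divr1.
pose q (t : R) : R := complex.Re (kv * cis t ^+ p).
have expn (rho t : R) : 0 < rho -> rho <= e -> exists2 E : R[i],
    rat_eval r (rho%:C * cis t) / v = 1 + (rho ^+ p)%:C * (kv * cis t ^+ p) + E &
    nrm E <= C * (rho ^+ p * rho).
  move=> r0 re; have hz := near rho t r0 re.
  exists ((rat_eval r (rho%:C * cis t) - v - kap * (rho%:C * cis t) ^+ p) / v).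
    by rewrite exprMn rmorphXn /= /kv; field.
  by rewrite nrm_div v1 divr1.
have ReZ (x : R) (a : R[i]) : complex.Re (x%:C * a) = x * complex.Re a.
  by case: a => a1 a2; simpc.
have ReD (a b : R[i]) : complex.Re (a + b) = complex.Re a + complex.Re b.
  by case: a b => ? ? [].
have ReN (a : R[i]) : - nrm a <= complex.Re a.
  by have := Re_le_nrm a; rewrite ler_norml => /andP[].
(* the limit [rho -> 0] of [|r| <= 1]: the leading term points into the disc *)
have qle (t : R) : `|t| < psi -> q t <= 0.
  move=> tb; apply: (@archi_le _ _ _ C (Num.bound e^-1)) => s /evs /evt /andP[r0 re] _.
  have [E eE nE] := expn _ t r0 re; rewrite add0r.
  have le1 := stable_le1 (polar_sector r0 tb).
  have : complex.Re (rat_eval r ((s%:R^-1)%:C * cis t) / v) <= 1.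
    apply: le_trans (ler_norm _) _; apply: le_trans (Re_le_nrm _) _.
    by rewrite nrm_div v1 divr1.
  rewrite eE !ReD ReZ -/(q t) /= => h1; have h2 := ReN E.
  have r1 : s%:R^-1 <= 1 :> R by lra.
  have /andP[q0 _] := rp1 _ r0 r1.
  rewrite -(ler_pM2l q0) mulrCA; lra.
(* strictly so, since turning the ray slightly would otherwise make it point
   out of the disc *)
have qlt (t : R) : `|t| = be -> q t < 0.
  move=> tb; rewrite lt_neqAle qle ?tb // andbT; apply/eqP => q0.
  have cN : cis t ^+ p != 0 by rewrite expf_neq0 // -nrm_gt0 nrm_cis.
  have kN : kv * cis t ^+ p != 0 by rewrite !mulf_neq0 ?invr_eq0.
  set y := complex.Im (kv * cis t ^+ p).
  have y0 : y != 0.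
    apply: contra_neq kN => y0; apply/eqP; rewrite eq_complex /=.
    by rewrite -/(q t) -/y q0 y0 eqxx.
  pose sg : R := (psi - be) / (2 * p%:R).
  have pR : 0 < p%:R :> R by rewrite ltr0n.
  have p1 : 1 <= p%:R :> R by rewrite ler1n.
  have sE : p%:R * sg = (psi - be) / 2 by rewrite /sg; field; rewrite gt_eqF.
  have sg0 : 0 < sg by rewrite divr_gt0 ?subr_gt0 ?mulr_gt0.
  have sgle : sg <= (psi - be) / 2 by rewrite -sE ler_peMl // ltW.
  have spos : 0 < sin (p%:R * sg).
    rewrite sE sin_gt0_pi // divr_gt0 ?subr_gt0 //= ltr_pdivrMr //.
    apply: lt_le_trans (_ : psi <= _); first by rewrite gtrBl.
    by rewrite (le_trans (ltW psipi)) // ler_peMr ?pi_ge0 // ler1n.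
  have shift (x : R) : q (t + x) = - (y * sin (p%:R * x)).
    rewrite /q cisD exprMn mulrA [cis x ^+ p]cisX; move: q0; rewrite /q /y.
    by case: (kv * _) => a b /= ->; simpc => /=; ring.
  have tle (x : R) : `|x| <= (psi - be) / 2 -> `|t + x| < psi.
    move=> xb; apply: le_lt_trans (ler_normD _ _) _; rewrite tb.
    apply: le_lt_trans (lerD (lexx _) xb) _.
    by rewrite -ltrBrDl gtr_pMr ?subr_gt0 // invf_lt1 // ltr1n.
  have [yp|yn] := ltP 0 y.
    have := qle (t - sg); rewrite shift mulrN sinN mulrN opprK => hq.
    have /hq : `|t - sg| < psi by apply: tle; rewrite normrN gtr0_norm.
    by apply/negP; rewrite -ltNge mulr_gt0.
  have {}yn : y < 0 by rewrite lt_neqAle y0.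
  have := qle (t + sg); rewrite shift => hq.
  have /hq : `|t + sg| < psi by apply: tle; rewrite gtr0_norm.
  by apply/negP; rewrite -ltNge -mulNr mulr_gt0 // oppr_gt0.
have [eta eta0 qeta] : exists2 eta : R, 0 < eta &
    forall t : R, `|t| = be -> q t <= - eta.
  have qb : 0 < - q be by rewrite oppr_gt0; apply: qlt; rewrite gtr0_norm.
  have qb' : 0 < - q (- be).
    by rewrite oppr_gt0; apply: qlt; rewrite normrN gtr0_norm.
  have [eta [eta0 h1 h2]] := min_pos qb qb'; exists eta => // t tb.
  have neg (x : R) : eta <= - x -> x <= - eta by rewrite lerNr.
  have [t0|t0] := leP 0 t.
    have -> : t = be by rewrite -tb ger0_norm.
    exact: neg.
  have -> : t = - be by rewrite -tb ltr0_norm // opprK.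
  exact: neg.
pose B : R := nrm kap ^+ 2 + C; have B0 : 0 <= B by rewrite addr_ge0 // sqr_ge0.
have e2 : 0 < eta / 2 by rewrite divr_gt0.
have [rho0 /andP[rho00 rho0e] Br] := small_radius e0 B0 e2.
exists p, D, (eta / 2), rho0; split=> //; first by rewrite rho00 (le_trans rho0e).
move=> rho t r0 rK tb; have re : rho <= e := le_trans rK rho0e.
have hf := f2 rho t r0 re; split=> //.
have r1 : rho <= 1 := le_trans re e1.
have /andP[q0 q1] := rp1 rho r0 r1.
have {}Br := Br rho rK.
have [E eE nE] := expn rho t r0 re.
apply: le_trans (one_sub_le_inv (mulr_ge0 (ltW e2) (ltW q0))).
have -> : nrm (rat_eval r (rho%:C * cis t)) = nrm (rat_eval r (rho%:C * cis t) / v).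
  by rewrite [RHS]nrm_div v1 divr1.
rewrite eE; apply: le_trans (nrmD _ _) _.
apply: le_trans (lerD (nrm1D_le _) nE) _.
rewrite ReZ -/(q t) nrmM nrm_real ger0_norm ?(ltW q0) // nrmM nrmX nrm_cis expr1n mulr1 kvn.
have w1 := qeta t tb; have w2 := ler_wpM2l (ltW q0) Br; rewrite /B in w2.
have k2 := sqr_ge0 (nrm kap); rewrite exprMn.
have pp : (rho ^+ p) ^+ 2 <= rho ^+ p * rho by rewrite expr2 ler_wpM2l // ltW.
have w3 := ler_wpM2r k2 pp; have w4 := ler_wpM2l (ltW q0) w1.
exact: vertex_arith_eq1 w2 w3 w4.
Qed.
End RayBounds.

Section GlobalRayBounds.
Context {R : realType}.
Variables (psi : R) (r : {fraction {poly R[i]}}).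
Hypotheses (psi0 : 0 < psi) (psipi : psi < pi) (rst : Astable psi r).
Hypothesis rinf : nrm (rat_lim r) < 1.
Variable be : R.
Hypotheses (be0 : 0 < be) (bepsi : be < psi).

Lemma ray_max (t rho0 : R) : `|t| = be -> 0 < rho0 -> rho0 <= 1 ->
  exists2 m : R, m < 1 & forall rho : R, rho0 <= rho -> rho <= 1 ->
    nrm (rat_eval r (rho%:C * cis t)) <= m.
Proof.
move=> tb r0 r1; have tpsi : `|t| < psi by rewrite tb.
pose f (x : R) : R := nrm (rat_eval r (x%:C * cis t)).
have ct (x : R) : 0 < x -> {for x, continuous f}.
  move=> x0; have [dx _] := rst (polar_sector psi0 psipi x0 tpsi).
  have [C [e [C0 /andP[e0 e1] h]]] := local_lip dx.
  apply/cvgrPdist_le => /= eps eps0; apply/nbhs_ballP.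
  have [del /andP[del0 dele] hd] := small_radius e0 C0 eps0.
  exists del => //= y; rewrite /ball /= => yx.
  have nyx : nrm (y%:C * cis t - x%:C * cis t) = `|x - y|.
    by rewrite -mulrBl nrmM nrm_cis mulr1 -rmorphB nrm_real distrC.
  have ye : nrm (y%:C * cis t - x%:C * cis t) <= e.
    by rewrite nyx; apply: le_trans (ltW yx) _.
  have [_ hy] := h _ ye.
  rewrite nyx in hy; apply: le_trans (hd _ (ltW yx)).
  apply: le_trans hy; rewrite /f ler_norml.
  have u1 := nrmDZl (rat_eval r (x%:C * cis t)) (rat_eval r (y%:C * cis t) - rat_eval r (x%:C * cis t)).
  have u2 := nrmDZl (rat_eval r (y%:C * cis t)) (rat_eval r (x%:C * cis t) - rat_eval r (y%:C * cis t)).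
  rewrite [_ + (_ - _)]addrC subrK in u1.
  rewrite [_ + (_ - _)]addrC subrK nrm_distC in u2.
  by apply/andP; split; [rewrite lerNl opprB|]; rewrite lerBlDr -lerBlDl.
have [|c] := @EVT_max R f rho0 1 r1.
  apply: continuous_in_subspaceT => x; rewrite inE /= in_itv /= => /andP[x0 _].
  by apply: ct; apply: lt_le_trans x0.
rewrite in_itv /= => /andP[c0 c1] fc; exists (f c).
  apply: (stable_lt1 psi0 psipi rst rinf); apply: polar_sector => //.
  exact: lt_le_trans c0.
by move=> rho rho1 rho2; apply: fc; rewrite in_itv /= rho1.
Qed.

(** All that is needed about [r] on the rays at angle [be]: its deviation from
    the values at the vertex and at infinity, and its strict decrease in
    modulus away from the vertex. *)
Lemma ray_bounds : exists (p : nat) (C del : R),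
  [/\ (0 < p)%N, 0 <= C, 0 < del & forall rho t : R, 0 < rho -> `|t| = be ->
   [/\ nrm (rat_eval r (rho%:C * cis t) - rat_eval r 0) <= C * rho ^+ p,
       nrm (rat_eval r (rho%:C * cis t) - rat_lim r) * rho <= C,
       nrm (rat_eval r (rho%:C * cis t)) <= 1 &
       rho <= 1 -> nrm (rat_eval r (rho%:C * cis t)) <= (1 + del * rho ^+ p)^-1]].
Proof.
have [p [C [del [rho0 [p0 C0 del0 /andP[r00 r01] h]]]]] :=
  vertex_bound psi0 psipi rst rinf be0 bepsi.
have bb : `|be| = be by rewrite gtr0_norm.
have bb' : `|- be| = be by rewrite normrN.
have [m1 m11 hm1] := ray_max bb r00 r01; have [m2 m21 hm2] := ray_max bb' r00 r01.
have m1' : 0 < 1 - m1 by rewrite subr_gt0.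
have m2' : 0 < 1 - m2 by rewrite subr_gt0.
have [e1 [e10 e1d e1m]] := min_pos del0 m1'.
have [e2 [e20 e2e1 e2m]] := min_pos e10 m2'.
have [C' [Z [C'0 Z1 hZ]]] := rat_lim_rate psi0 psipi rst.
have r0p : 0 < rho0 ^+ p by rewrite exprn_gt0.
set v := rat_eval r 0 in h *.
have Ca0 : 0 <= (1 + nrm v) / rho0 ^+ p.
  by rewrite divr_ge0 ?addr_ge0 ?nrm_ge0 // ltW.
pose CC : R := C + (1 + nrm v) / rho0 ^+ p + (C' + 2 * Z).
have CC1 : C <= CC by rewrite /CC; move: Ca0; move: (_ / _) => X; lra.
have CC2 : (1 + nrm v) / rho0 ^+ p <= CC.
  by rewrite /CC; move: Ca0; move: (_ / _) => X; lra.
have CC3 : C' + 2 * Z <= CC.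
  by rewrite /CC; move: Ca0; move: (_ / _) => X; lra.
exists p, CC, e2; split=> //; first exact: le_trans CC1.
move=> rho t rp tb; have tpsi : `|t| < psi by rewrite tb.
have sz := polar_sector psi0 psipi rp tpsi.
have le1 := stable_le1 rst sz.
have rhop : 0 < rho ^+ p by rewrite exprn_gt0.
set z := rho%:C * cis t in sz le1 *; have nz : nrm z = rho by rewrite nrm_polar.
split=> //.
- have [rr|rr] := leP rho rho0.
    have [hz _] := h rho t rp rr tb; apply: le_trans hz _.
    by rewrite ler_wpM2r // ltW.
  apply: le_trans (nrmB _ _) _; apply: le_trans (lerD le1 (lexx _)) _.
  apply: le_trans (ler_wpM2r (ltW rhop) CC2).
  rewrite -mulrA ler_peMr ?addr_ge0 ?nrm_ge0 // mulrC ler_pdivlMr // mul1r.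
  by rewrite lerXn2r ?nnegrE ?ltW.
- apply: le_trans CC3; have [rr|rr] := leP Z rho.
    have zn : Z <= nrm z by rewrite nz.
    have [_ hz] := hZ z zn; rewrite nz in hz.
    apply: le_trans hz _; rewrite lerDl mulr_ge0 //; lra.
  have lt2 : nrm (rat_eval r z - rat_lim r) <= 2.
    by apply: le_trans (nrmB _ _) _; move: rinf => ri; lra.
  apply: le_trans (ler_pM (nrm_ge0 _) (ltW rp) lt2 (ltW rr)) _.
  by rewrite lerDr.
move=> rho1; have [rr|rr] := leP rho rho0.
  have [_ hz] := h rho t rp rr tb; apply: le_trans hz _.
  have d1 : e2 <= del := le_trans e2e1 e1d.
  have p1 : 0 < 1 + e2 * rho ^+ p by rewrite addr_gt0 ?mulr_gt0.
  rewrite lef_pV2 ?posrE //; last by rewrite addr_gt0 ?mulr_gt0.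
  by rewrite lerD2l ler_wpM2r // ltW.
apply: le_trans (one_sub_le_inv (mulr_ge0 (ltW e20) (ltW rhop))).
have rhop1 : rho ^+ p <= 1 by rewrite exprn_ile1 // ltW.
have ez : e2 * rho ^+ p <= e2 by rewrite ler_piMr // ltW.
have [tE|tE] : t = be \/ t = - be.
  have [t0|t0] := leP 0 t; first by left; rewrite -tb ger0_norm.
  by right; rewrite -tb ltr0_norm // opprK.
- apply: le_trans (_ : m1 <= _); first by rewrite /z tE; apply: hm1 => //; exact: ltW.
  by rewrite lerBrDr -lerBrDl; apply: le_trans ez _; exact: le_trans e1m.
- apply: le_trans (_ : m2 <= _); first by rewrite /z tE; apply: hm2 => //; exact: ltW.
  by rewrite lerBrDr -lerBrDl; apply: le_trans ez _.
Qed.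
End GlobalRayBounds.

(** * Products over the time steps *)

Section StepEstimates.
Context {R : realType}.
Implicit Types C del x Q K : R.

(** A crude constant that dominates all the cases of [largest_step]. *)
Definition stepC C del : R :=
  4 * (2 * C + 4) + 4 * (2 * (1 + del) / del + 4) + 16 + 4 * C.

Lemma stepC_ge C del : 0 <= C -> 0 < del -> [/\ 0 <= 2 * (1 + del) / del,
  4 * (2 * C + 4) <= stepC C del,
  4 * (2 * (1 + del) / del + 4) <= stepC C del, 16 <= stepC C del &
  4 * C <= stepC C del].
Proof.
move=> C0 del0; have X0 : 0 <= 2 * (1 + del) / del.
  by rewrite divr_ge0 ?mulr_ge0 ?addr_ge0 // ltW.
by rewrite /stepC; move: X0; move: (2 * _ / del) => X X0; split=> //; lra.
Qed.

Lemma nrm_sub_le2 (a b : R[i]) : nrm a <= 1 -> nrm b <= 1 -> nrm (a - b) <= 2.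
Proof. by move=> ha hb; apply: le_trans (nrmB _ _) _; lra. Qed.

Lemma inv1D_le x : 1 <= x -> 2 * (2 / (1 + x)) <= 4 * x^-1.
Proof.
move=> x1; have x0 : 0 < x by lra.
have h : 0 < 1 + x by lra.
rewrite -[4 * _]/(4 / x) mulrA ler_pdivrMr // mulrAC ler_pdivlMr //; lra.
Qed.

Lemma below_scale_le C x P Q K : 0 <= C -> 0 <= K -> P = K + Q -> P <= x ->
  C * K + 2 * (C * Q) + 2 * (2 * x) <= (2 * C + 4) * x.
Proof.
move=> C0 K0 -> h; have := ler_wpM2l C0 h; have := mulr_ge0 C0 K0; lra.
Qed.

Lemma above_scale_le del x P Q : 0 < del -> 0 < x -> x <= P -> P - 1 <= Q ->
  0 <= Q -> 2 * (1 + del * Q)^-1 <= 2 * (1 + del) / del * x^-1.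
Proof.
move=> D0 x0 xP sg s0; have DQ : 0 <= del * Q by rewrite mulr_ge0 // ltW.
have q0 : 0 < 1 + del * Q by lra.
rewrite ler_pdivrMr //.
have -> : 2 * (1 + del) / del / x * (1 + del * Q) =
   2 * ((1 + del) * (1 + del * Q) / (del * x)) by field; rewrite !gt_eqF.
rewrite ler_peMr // ler_pdivlMr ?mulr_gt0 // mul1r.
have xQ : x <= Q + 1 by lra.
have := ler_wpM2l (ltW D0) xQ; have := mulr_ge0 (ltW D0) DQ; lra.
Qed.
End StepEstimates.

Section Decomposition.
Context {R : realType}.
Variables (f : R[i] -> R[i]) (v0 vi : R[i]) (p : nat) (C del be : R).
Hypotheses (p0 : (0 < p)%N) (C0 : 0 <= C) (del0 : 0 < del).
Hypotheses (be0 : 0 < be) (bepi : be < pi / 2).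
Hypotheses (v0le : nrm v0 <= 1) (vilt : nrm vi < 1).
Hypothesis fb : forall rho t : R, 0 < rho -> `|t| = be ->
   [/\ nrm (f (rho%:C * cis t) - v0) <= C * rho ^+ p,
       nrm (f (rho%:C * cis t) - vi) * rho <= C,
       nrm (f (rho%:C * cis t)) <= 1 &
       rho <= 1 -> nrm (f (rho%:C * cis t)) <= (1 + del * rho ^+ p)^-1].

(** An integrable weight for the scale-invariant measure, comparable to
    [min (tau rho) (tau rho)^-1]. *)
Definition bump (tau rho : R) : R := tau * rho / (1 + tau * rho) ^+ 2.

Lemma bump_small (tau rho : R) : 0 < tau -> 0 < rho -> tau * rho <= 1 ->
  tau * rho <= 4 * bump tau rho.
Proof.
move=> t0 r0; rewrite /bump; have x0 : 0 < tau * rho by exact: mulr_gt0.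
move: (tau * rho) x0 => x x0 x1; have h : 0 < 1 + x by lra.
rewrite mulrA ler_pdivlMr ?exprn_gt0 // [4 * x]mulrC ler_pM2l //; nra.
Qed.

Lemma bump_large (tau rho : R) : 0 < tau -> 0 < rho -> 1 <= tau * rho ->
  (tau * rho)^-1 <= 4 * bump tau rho.
Proof.
move=> t0 r0; rewrite /bump; have x0 : 0 < tau * rho by exact: mulr_gt0.
move: (tau * rho) x0 => x x0 x1; have h : 0 < 1 + x by lra.
rewrite mulrA ler_pdivlMr ?exprn_gt0 // mulrC ler_pdivrMr //; nra.
Qed.

Lemma bump_ge0 (tau rho : R) : 0 < tau -> 0 < rho -> 0 <= bump tau rho.
Proof.
by move=> t0 r0; rewrite divr_ge0 ?exprn_ge0 ?addr_ge0 ?mulr_ge0 // ltW.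
Qed.

Lemma bump_bounds (tau rho : R) : 0 < tau -> 0 < rho ->
  bump tau rho <= (tau + tau^-1) * rho /\ bump tau rho * rho <= tau + tau^-1.
Proof.
move=> t0 r0; have x0 : 0 < tau * rho by exact: mulr_gt0.
have ti : 0 < tau^-1 by rewrite invr_gt0.
have h1 : bump tau rho <= tau * rho.
  rewrite /bump; move: (tau * rho) x0 => x x0; have h : 0 < 1 + x by lra.
  by rewrite ler_pdivrMr ?exprn_gt0 //; nra.
have h2 : bump tau rho * rho <= tau^-1.
  rewrite -(ler_pM2l t0) divff ?gt_eqF // mulrCA /bump -/(tau * rho).
  move: (tau * rho) x0 => x x0; have h : 0 < 1 + x by lra.
  rewrite mulrAC ler_pdivrMr ?exprn_gt0 // mul1r; nra.
by split; nra.
Qed.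

Lemma ray_resolvent_bound (tau rho t : R) : 0 < tau -> 0 < rho -> `|t| = be ->
  [/\ 1 + tau%:C * (rho%:C * cis t) != 0,
   nrm (1 + tau%:C * (rho%:C * cis t))^-1 <= 2 / (1 + tau * rho) &
   nrm (1 - (1 + tau%:C * (rho%:C * cis t))^-1) <= 2 * (tau * rho)].
Proof.
move=> t0 r0 tb; have x0 : 0 < tau * rho by exact: mulr_gt0.
rewrite mulrA -rmorphM /=; move: (tau * rho) x0 => x x0.
have ct : 0 <= cos t.
  rewrite -cos_norm tb cos_ge0_pihalf //; move: be0 bepi => *; lra.
set z := 1 + _; have zE : z = (1 + x * cos t) +i* (x * sin t).
  by rewrite /z /cis; simpc.
have nz : nrm z ^+ 2 = 1 + 2 * x * cos t + x ^+ 2.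
  rewrite nrm_sqr zE /=; have := cos2Dsin2 t.
  move: (cos t) (sin t) => c s e.
  have e' : s ^+ 2 = 1 - c ^+ 2 by rewrite -e; ring.
  ring: e'.
have n0 := nrm_ge0 z; have xc : 0 <= x * cos t by rewrite mulr_ge0 // ltW.
have n1 : (1 + x) / 2 <= nrm z.
  have h : 0 <= (1 + x) / 2 by lra.
  rewrite -(ler_sqr h n0) nz; move: xc; move: (cos t) => c xc.
  have := sqr_ge0 (x - 1); nra.
have np : 0 < nrm z by lra.
have z0 : z != 0 by rewrite -nrm_gt0.
have inv : nrm z^-1 <= 2 / (1 + x).
  rewrite nrmV -[2 / _]invf_div lef_pV2 ?posrE //; lra.
split=> //; have -> : 1 - z^-1 = x%:C * cis t * z^-1.
  have -> : x%:C * cis t = z - 1 by rewrite /z addrC addKr.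
  by field.
rewrite !nrmM nrm_cis nrm_real gtr0_norm // mulr1.
have i1 : nrm z^-1 <= 2.
  by apply: le_trans inv _; rewrite ler_pdivrMr; lra.
by rewrite mulrC ler_wpM2r // ltW.
Qed.

Lemma prod_ray_le1 (ks : seq R) (rho t : R) : 0 < rho -> `|t| = be ->
  all (fun k => 0 < k) ks ->
  nrm (\prod_(k <- ks) f (k%:C * (rho%:C * cis t))) <= 1.
Proof.
move=> r0 tb; elim: ks => [|k ks IH] /=; first by rewrite big_nil nrm1.
move=> /andP[k0 ks0]; rewrite big_cons nrmM.
have [_ _ h _] := fb (mulr_gt0 k0 r0) tb.
by rewrite mulrA -rmorphM -[leRHS]mulr1 ler_pM ?nrm_ge0 ?IH.
Qed.

Lemma prod_ray_vertex (ks : seq R) (rho t : R) : 0 < rho -> `|t| = be ->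
  all (fun k => 0 < k) ks ->
  nrm (\prod_(k <- ks) f (k%:C * (rho%:C * cis t)) - v0 ^+ size ks)
    <= C * \sum_(k <- ks) (k * rho) ^+ p.
Proof.
move=> r0 tb; elim: ks => [|k ks IH] /=.
  by rewrite !big_nil expr0 subrr nrm0 mulr0.
move=> /andP[k0 ks0]; rewrite !big_cons exprS.
have [h _ _ _] := fb (mulr_gt0 k0 r0) tb.
have {}IH := IH ks0; have le1 := prod_ray_le1 r0 tb ks0.
rewrite mulrA -rmorphM /=; set P := \prod_(j <- ks) _ in IH le1 *.
set u := f _ in h *.
have -> : u * P - v0 * v0 ^+ size ks = (u - v0) * P + v0 * (P - v0 ^+ size ks) by ring.
apply: le_trans (nrmD _ _) _; rewrite !nrmM mulrDr; apply: lerD.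
  by rewrite -[leRHS]mulr1 ler_pM ?nrm_ge0.
by rewrite -[leRHS]mul1r ler_pM ?nrm_ge0.
Qed.

Lemma prod_ray_decay (ks : seq R) (rho t : R) : 0 < rho -> `|t| = be ->
  all (fun k => (0 < k) && (k * rho <= 1)) ks ->
  nrm (\prod_(k <- ks) f (k%:C * (rho%:C * cis t)))
    <= (1 + del * \sum_(k <- ks) (k * rho) ^+ p)^-1.
Proof.
move=> r0 tb; elim: ks => [|k ks IH] /=.
  by rewrite !big_nil mulr0 addr0 invr1 nrm1.
move=> /andP[/andP[k0 k1] ks0]; rewrite !big_cons nrmM.
have [_ _ _ h] := fb (mulr_gt0 k0 r0) tb; have {}h := h k1.
have {}IH := IH ks0; rewrite mulrA -rmorphM /=.
have S0 : 0 <= \sum_(j <- ks) (j * rho) ^+ p.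
  rewrite big_seq sumr_ge0 // => j jk; have /andP[j0 _] := allP ks0 j jk.
  by rewrite exprn_ge0 // mulr_ge0 // ltW.
have k0' : 0 <= (k * rho) ^+ p by rewrite exprn_ge0 // mulr_ge0 // ltW.
apply: le_trans (ler_pM (nrm_ge0 _) (nrm_ge0 _) h IH) _.
move: (\sum_(j <- ks) _) ((k * rho) ^+ p) S0 k0' => S K S0 K0.
have dS : 0 <= del * S by rewrite mulr_ge0 // ltW.
have dK : 0 <= del * K by rewrite mulr_ge0 // ltW.
have a1 : 0 < 1 + del * S by rewrite ltr_pwDl.
have a2 : 0 < 1 + del * K by rewrite ltr_pwDl.
rewrite -invfM lef_pV2 ?posrE ?mulr_gt0 //; last first.
  by rewrite ltr_pwDl // mulrDr addr_ge0.
rewrite mulrDr; nra.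
Qed.

(** The step that makes the sum over the time steps harmless: with the factor
    of the largest step replaced by its deviation from the value at infinity,
    the product is close to a single resolvent, up to a function that is
    integrable along the rays for the scale-invariant measure. The scale [tau]
    of the resolvent is the one at which the product leaves its value at the
    vertex. *)
Lemma largest_step (k : R) (ks : seq R) : 0 < k ->
  all (fun j => (0 < j) && (j <= k)) ks ->
  exists (tau : R) (c : R[i]), [/\ 0 < tau, nrm c <= 2 &
   forall rho t : R, 0 < rho -> `|t| = be ->
   let z := rho%:C * cis t in
   nrm ((f (k%:C * z) - vi) * \prod_(j <- ks) f (j%:C * z)
        - c * (1 + tau%:C * z)^-1) <= stepC C del * (bump tau rho + bump k rho)].
Proof.
move=> k0 ksk.
have ks0 : all (fun j => 0 < j) ks by apply: sub_all ksk => j /andP[].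
pose S : R := k ^+ p + \sum_(j <- ks) j ^+ p.
have Sk : k ^+ p <= S.
  rewrite lerDl big_seq sumr_ge0 // => j jk; have j0 := allP ks0 j jk.
  by rewrite exprn_ge0 // ltW.
have S0 : 0 < S by apply: lt_le_trans Sk; rewrite exprn_gt0.
pose tau : R := S `^ (p%:R^-1).
have tau0 : 0 < tau by exact: powR_gt0.
have tauE : tau ^+ p = S.
  rewrite -powR_mulrn ?ltW // -powRrM mulVf ?powRr1 ?ltW //.
  by rewrite pnatr_eq0 -lt0n.
have ktau : k <= tau.
  rewrite -(@ler_pXn2r _ p) ?nnegrE ?(ltW k0) ?(ltW tau0) //.
  by rewrite tauE.
exists tau, ((v0 - vi) * v0 ^+ size ks).
have c2 : nrm ((v0 - vi) * v0 ^+ size ks) <= 2.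
  rewrite nrmM nrmX -[2]mulr1 ler_pM ?exprn_ge0 ?nrm_ge0 ?exprn_ile1 ?nrm_ge0 //.
  exact: nrm_sub_le2 v0le (ltW vilt).
split=> // rho t r0 tb /=; set z := rho%:C * cis t.
set c := _ * _ in c2 *.
set P := \prod_(j <- ks) _; set u := f (k%:C * z).
have uE : u = f ((k * rho)%:C * cis t) by rewrite /u /z mulrA -rmorphM.
have [h1 h2 h3 h4] := fb (mulr_gt0 k0 r0) tb; rewrite -uE in h1 h2 h3 h4.
have [n0 n1 n2] := ray_resolvent_bound tau0 r0 tb; rewrite -/z in n0 n1 n2.
set y := (1 + tau%:C * z)^-1 in n1 n2 *.
have P1 : nrm P <= 1 := prod_ray_le1 r0 tb ks0.
have x0 : 0 < tau * rho by exact: mulr_gt0.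
have bt0 := bump_ge0 tau0 r0; have bk0 := bump_ge0 k0 r0.
have uvi : nrm (u - vi) <= 2 := nrm_sub_le2 h3 (ltW vilt).
have [d20 sC1 sC2 sC3 sC4] := stepC_ge C0 del0.
have sC0 : 0 <= stepC C del := le_trans (ler0n _ 16) sC3.
have xinv : 1 <= tau * rho -> nrm (c * y) <= 4 * (tau * rho)^-1.
  move=> x1; rewrite nrmM; apply: le_trans (ler_pM (nrm_ge0 _) (nrm_ge0 _) c2 n1) _.
  exact: inv1D_le.
have goalT (a b : R) : 0 <= a -> a <= b * bump tau rho -> b <= stepC C del ->
    a <= stepC C del * (bump tau rho + bump k rho).
  move=> a0 ab bs; apply: le_trans ab _.
  by apply: le_trans (ler_wpM2r bt0 bs) _; rewrite ler_wpM2l // lerDl.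
have [kr|kr] := leP (k * rho) 1; last first.
  have x1 : 1 <= tau * rho.
    by apply: le_trans (ltW kr) _; rewrite ler_wpM2r // ltW.
  apply: le_trans (nrmB _ _) _; rewrite mulrDr addrC; apply: lerD.
    apply: le_trans (xinv x1) _.
    apply: le_trans (ler_wpM2l (ler0n _ 4) (bump_large tau0 r0 x1)) _.
    by rewrite mulrA -natrM; exact: ler_wpM2r.
  have kr0 : 0 < k * rho by exact: mulr_gt0.
  rewrite nrmM; apply: (@le_trans _ _ (C * (k * rho)^-1)).
    rewrite -[leRHS]mulr1 ler_pM ?nrm_ge0 //.
    by rewrite -(ler_pM2r kr0) divfK // gt_eqF.
  apply: le_trans (ler_wpM2l C0 (bump_large k0 r0 (ltW kr))) _.
  by rewrite mulrCA mulrA; exact: ler_wpM2r.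
have kle j : j \in ks -> (0 < j) && (j * rho <= 1).
  move=> /(allP ksk) /andP[j0 jk]; rewrite j0 /=.
  by apply: le_trans kr; rewrite ler_wpM2r // ltW.
have sumE : (tau * rho) ^+ p = (k * rho) ^+ p + \sum_(j <- ks) (j * rho) ^+ p.
  rewrite exprMn tauE /S mulrDl mulr_suml exprMn; congr (_ + _).
  by apply: eq_bigr => j _; rewrite exprMn.
have krp : 0 <= (k * rho) ^+ p <= 1.
  by rewrite exprn_ge0 ?exprn_ile1 ?mulr_ge0 // ltW.
have [x1|x1] := leP (tau * rho) 1.
  (* below the scale [1 / tau] both terms are close to their value at 0 *)
  apply: (@goalT _ (4 * (2 * C + 4))) => //; first exact: nrm_ge0.
  have xp : (tau * rho) ^+ p <= tau * rho.
    move: p p0 => [//|q] _; rewrite exprS ler_piMr ?(ltW x0) //.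
    by rewrite exprn_ile1 // ltW.
  have Pv := prod_ray_vertex r0 tb ks0; rewrite -/z -/P in Pv.
  have -> : (u - vi) * P - c * y =
    (u - v0) * P + (v0 - vi) * (P - v0 ^+ size ks) + c * (1 - y).
    by rewrite /c; ring.
  have w1 : nrm ((u - v0) * P) <= C * (k * rho) ^+ p.
    by rewrite nrmM -[leRHS]mulr1 ler_pM ?nrm_ge0.
  have vv : nrm (v0 - vi) <= 2 := nrm_sub_le2 v0le (ltW vilt).
  have w2 : nrm ((v0 - vi) * (P - v0 ^+ size ks)) <=
      2 * (C * \sum_(j <- ks) (j * rho) ^+ p) by rewrite nrmM ler_pM ?nrm_ge0.
  have w3 : nrm (c * (1 - y)) <= 2 * (2 * (tau * rho)) by rewrite nrmM ler_pM ?nrm_ge0.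
  have hs := bump_small tau0 r0 x1.
  apply: (@le_trans _ _ ((2 * C + 4) * (tau * rho))); last first.
    by rewrite [4 * _]mulrC -mulrA ler_wpM2l // addr_ge0 // mulr_ge0.
  apply: le_trans (nrmD _ _) _; apply: le_trans (lerD (nrmD _ _) (lexx _)) _.
  apply: le_trans (lerD (lerD w1 w2) w3) _.
  by have /andP[kp _] := krp; exact: below_scale_le C0 kp sumE xp.
(* above it, the product has decayed *)
apply: (@goalT _ (4 * (2 * (1 + del) / del + 4))) => //; first exact: nrm_ge0.
have hb := bump_large tau0 r0 (ltW x1).
apply: (@le_trans _ _ ((2 * (1 + del) / del + 4) * (tau * rho)^-1)); last first.
  by rewrite [4 * _]mulrC -[leRHS]mulrA ler_wpM2l // addr_ge0.
apply: le_trans (nrmB _ _) _; rewrite [leRHS]mulrDl; apply: lerD; last exact/xinv/ltW.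
have ksr : all (fun j => (0 < j) && (j * rho <= 1)) ks by apply/allP => j /kle.
have Pd := prod_ray_decay r0 tb ksr; rewrite -/z -/P in Pd.
rewrite nrmM; apply: le_trans (ler_pM (nrm_ge0 _) (nrm_ge0 _) uvi Pd) _.
have xp : tau * rho <= (tau * rho) ^+ p.
  move: p p0 => [//|q] _; rewrite exprS ler_peMr ?(ltW x0) //.
  by rewrite exprn_ege1 // ltW.
have sg : (tau * rho) ^+ p - 1 <= \sum_(j <- ks) (j * rho) ^+ p.
  by have /andP[_ kp] := krp; rewrite sumE addrAC gerDr subr_le0.
have s0 : 0 <= \sum_(j <- ks) (j * rho) ^+ p.
  rewrite big_seq sumr_ge0 // => j /kle /andP[j0 _].
  by rewrite exprn_ge0 // mulr_ge0 // ltW.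
exact: above_scale_le del0 x0 xp sg s0.
Qed.
End Decomposition.

Section SortedDecomposition.
Context {R : realType}.
Variables (f : R[i] -> R[i]) (v0 vi : R[i]) (p : nat) (C del be : R).
Hypotheses (p0 : (0 < p)%N) (C0 : 0 <= C) (del0 : 0 < del).
Hypotheses (be0 : 0 < be) (bepi : be < pi / 2).
Hypotheses (v0le : nrm v0 <= 1) (vilt : nrm vi < 1).
Hypothesis fb : forall rho t : R, 0 < rho -> `|t| = be ->
   [/\ nrm (f (rho%:C * cis t) - v0) <= C * rho ^+ p,
       nrm (f (rho%:C * cis t) - vi) * rho <= C,
       nrm (f (rho%:C * cis t)) <= 1 &
       rho <= 1 -> nrm (f (rho%:C * cis t)) <= (1 + del * rho ^+ p)^-1].

Lemma grid_bump_le s (tau : R) : (0 < s)%N -> 0 < tau ->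
  (s%:R ^+ 2)^-1 * grid s (bump tau) <= 2.
Proof. exact: grid_bump. Qed.

(** Peeling off the largest step [k] from the product replaces [f(k z)] by
    its value [vi] at infinity, and [|vi| < 1] makes the errors summable. *)
Lemma sorted_decomposition : exists B1 B2 : R, [/\ 0 <= B1, 0 <= B2 &
  forall ks : seq R, all (fun k => 0 < k) ks -> sorted (fun x y => y <= x) ks ->
  exists (c : R[i]) (L : seq (R[i] * R)) (w : R -> R),
  [/\ nrm c <= 1, all (fun i => 0 < i.2) L, \sum_(i <- L) nrm i.1 <= B1,
   (exists K : R, forall rho : R, 0 < rho -> w rho <= K * rho /\ w rho * rho <= K) &
   (forall s, (0 < s)%N -> (s%:R ^+ 2)^-1 * grid s w <= B2) /\
   forall rho t : R, 0 < rho -> `|t| = be ->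
     nrm (\prod_(k <- ks) f (k%:C * (rho%:C * cis t)) - c -
          \sum_(i <- L) i.1 * (1 + i.2%:C * (rho%:C * cis t))^-1) <= w rho]].
Proof.
have [_ _ _ sC _] := stepC_ge C0 del0.
have D0 : 0 <= stepC C del := le_trans (ler0n _ 16) sC.
move: (stepC C del) (largest_step p0 C0 del0 be0 bepi v0le vilt fb) D0 => D step D0.
have om : 0 < 1 - nrm vi by rewrite subr_gt0.
have nv := nrm_ge0 vi.
exists (2 / (1 - nrm vi)), (4 * D / (1 - nrm vi)); split.
- by rewrite divr_ge0 // ltW.
- by rewrite divr_ge0 ?mulr_ge0 // ltW.
have B1E : nrm vi * (2 / (1 - nrm vi)) + 2 = 2 / (1 - nrm vi).
  by field; rewrite gt_eqF.
have B2E : nrm vi * (4 * D / (1 - nrm vi)) + 4 * D = 4 * D / (1 - nrm vi).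
  by field; rewrite gt_eqF.
move: (2 / _) (4 * D / _) B1E B2E => B1 B2 B1E B2E.
have B10 : 0 <= B1 by nra.
have B20 : 0 <= B2 by nra.
elim=> [_ _|k ks IH /= /andP[k0 ks0] kks].
  exists 1, [::], (fun=> 0); split=> //.
  - by rewrite nrm1.
  - by rewrite big_nil.
  - by exists 0 => rho _; rewrite mul0r.
  split; first by move=> s _; rewrite /grid big1 // mulr0.
  by move=> rho t _ _; rewrite !big_nil subrr subr0 nrm0.
have [c [L [w [c1 L0 LB [K wK] [wB wf]]]]] := IH ks0 (path_sorted kks).
have kmax : all (fun j => (0 < j) && (j <= k)) ks.
  apply/allP => j jk; rewrite (allP ks0 j jk) /=.
  by apply: (allP (order_path_min _ kks)) => // x y z h1 h2; apply: le_trans h1.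
have [tau [c' [tau0 c'2 hs]]] := step k ks k0 kmax.
exists (vi * c), ((c', tau) :: [seq (vi * i.1, i.2) | i <- L]),
  (fun rho => nrm vi * w rho + D * (bump tau rho + bump k rho)); split.
- rewrite nrmM -[leRHS]mulr1 ler_pM ?nrm_ge0 // ltW //.
- rewrite /= tau0 all_map; exact: sub_all L0.
- rewrite big_cons big_map /= addrC -B1E; apply: lerD => //.
  rewrite (eq_bigr (fun i => nrm vi * nrm i.1)); last by move=> i _; rewrite nrmM.
  by rewrite -mulr_sumr ler_wpM2l.
- exists (nrm vi * K + D * ((tau + tau^-1) + (k + k^-1))) => rho r0.
  have [w1 w2] := wK rho r0; have [t1 t2] := bump_bounds tau0 r0.
  have [k1 k2] := bump_bounds k0 r0.
  rewrite !mulrDl; split.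
    rewrite -mulrA; apply: lerD; first by rewrite ler_wpM2l.
    by rewrite -mulrA ler_wpM2l // mulrDl lerD.
  rewrite -mulrA; apply: lerD; first by rewrite ler_wpM2l.
  by rewrite -mulrA ler_wpM2l // mulrDl lerD.
split=> [s s0|rho t r0 tb].
  rewrite grid_add !grid_scale grid_add mulrDr mulrCA [X in _ + X]mulrCA mulrDr -B2E.
  apply: lerD; first by rewrite ler_wpM2l // wB.
  rewrite [4 * D]mulrC ler_wpM2l //.
  have := grid_bump_le s0 tau0; have := grid_bump_le s0 k0; lra.
have := hs rho t r0 tb; have := wf rho t r0 tb => /=.
rewrite !big_cons big_map /=; set z := rho%:C * cis t.
set P := \prod_(j <- ks) _; set Sm := \sum_(i <- L) _; set u := f _.
have -> : \sum_(i <- L) vi * i.1 * (1 + i.2%:C * z)^-1 = vi * Sm.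
  by rewrite /Sm mulr_sumr; apply: eq_bigr => i _; rewrite mulrA.
move=> h1 h2.
have -> : u * P - vi * c - (c' * (1 + tau%:C * z)^-1 + vi * Sm) =
   vi * (P - c - Sm) + ((u - vi) * P - c' * (1 + tau%:C * z)^-1) by ring.
by apply: le_trans (nrmD _ _) _; rewrite nrmM; apply: lerD => //; rewrite ler_wpM2l.
Qed.
End SortedDecomposition.

(** * The bound for products of rational functions *)

Section Main.
Context {R : realType}.

Lemma cargN1 : carg (-1 : R[i]) = pi.
Proof.
rewrite /carg; have -> : Normc.normc (-1 : R[i]) = 1.
  by rewrite -nrmEnormc nrmN nrm1.
by rewrite /= divr1 oppr0 lexx acosN1.
Qed.

Lemma opnorm_le (X : completeNormedModType R[i]) (F : X -> X) (c : R) :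
  (forall x, nrm (F x) <= c * nrm x) -> 0 <= c -> (opnorm F <= c%:E)%E.
Proof.
move=> h c0; apply: ge_ereal_sup => _ [x /= x1 <-]; rewrite lee_fin.
apply: le_trans (h x) _; rewrite -[leRHS]mulr1 ler_wpM2l //.
by rewrite -lecR -nrmE.
Qed.

Section Bound.
Variables (X : completeNormedModType R[i]) (A : operator X) (phi th be psi : R).
Variable r : {fraction {poly R[i]}}.
Hypotheses (phi0 : 0 < phi) (phith : phi < th) (thbe : th < be) (bepsi : be < psi).
Hypotheses (psipi : psi <= pi / 2) (Asect : sectorial phi A).

Let th0 : 0 < th := lt_trans phi0 phith.
Let be0 : 0 < be := lt_trans th0 thbe.
Let bepi : be < pi / 2 := lt_le_trans bepsi psipi.
Let thpi : th < pi.
Proof. by move: th0 thbe bepi (pi_gt0 R) => *; lra. Qed.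

(** The sectoriality constant of an operator on a nonzero space is at least 1. *)
Lemma le_Mth (x : X) : nrm x <= Mth A th * nrm x.
Proof.
have [->|x0] := eqVneq x 0; first by rewrite nrm0 mulr0.
have nx : 0 < nrm x by rewrite nrm_gt0.
rewrite ler_peMl ?(ltW nx) //.
(* [z (z - A)^-1 y] tends to [y] along the negative half-line, for a nonzero
   vector [y] of the domain *)
have [y yA y0] : exists2 y, op_dom A y & y != 0.
  have [_ dn _ _] := Asect.
  have op : open (ball x (nrm x)%:C) by apply: ball_open; rewrite ltcR.
  have [|y [yb yd]] := dn _ _ op; first by exists x; apply: ballxx; rewrite ltcR.
  exists y => //; apply/eqP => y0; move: yb.
  by rewrite y0 -ball_normE /ball_ /= subr0 nrmE ltxx.
have ny : 0 < nrm y by rewrite nrm_gt0.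
rewrite -(ler_pM2r ny) mul1r.
have HT := resT_family phi0 phith thpi Asect.
apply: (@archi_le _ _ _ (Mth A th * nrm (A y)) 0) => s _ s0.
have sR : 0 < s%:R :> R by rewrite ltr0n.
pose z : R[i] := (- s%:R)%:C.
have hz : sepf th z < 0.
  rewrite /sepf /= normr0 mulr0 subr0 mulrN oppr_lt0 mulr_gt0 // sin_gt0_pi //.
  by rewrite th0.
have nz : nrm z = s%:R by rewrite nrm_real normrN gtr0_norm.
have e := TA HT hz yA.
have [_ _ _ b1] := HT z hz y; have [_ _ _ b2] := HT z hz (A y).
have d : nrm (resT A z y - y) * s%:R <= Mth A th * nrm (A y).
  by rewrite -nz mulrC -nrmZ -e.
have yE : nrm y = nrm (resT A z y - (resT A z y - y)) by rewrite opprB addrC subrK.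
rewrite [leLHS]yE.
apply: le_trans (nrmB _ _) _; apply: lerD => //.
by rewrite ler_pdivlMr.
Qed.

Lemma resolvent_bound (tau : R) : 0 < tau -> exists2 U : X -> X,
  fcalcE A be (fun z => (1 + tau%:C * z)^-1) U &
  forall x, nrm (U x) <= Mth A th * nrm x.
Proof.
move=> tau0; have N1 : (-1 : R[i]) != 0 by rewrite oppr_eq0 oner_neq0.
have cN : be < `|carg (-1 : R[i])|.
  by rewrite cargN1 ger0_norm ?pi_ge0 //; move: bepi (pi_gt0 R) => *; lra.
have [fU hU] := scaled_resolvent phi0 phith thbe bepi Asect tau0 N1 cN.
set U := op_inv _ in fU hU; exists U.
  by apply: (fcalcE_ext phi0 phith thbe _ _ fU) => [z _|x] //; rewrite opprK addrC.
move=> x; have [dx ex] := hU x.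
pose z : R[i] := (- tau^-1)%:C.
have ti : 0 < tau^-1 by rewrite invr_gt0.
have hz : sepf th z < 0.
  rewrite /sepf /= normr0 mulr0 subr0 mulrN oppr_lt0 mulr_gt0 // sin_gt0_pi //.
  by rewrite th0.
have [_ _ u b] := resT_family phi0 phith thpi Asect hz x.
rewrite (u (U x)) //.
have tC : tau%:C != 0 :> R[i] by rewrite eq_complex /= gt_eqF.
have zE : z = - tau%:C^-1 by rewrite /z rmorphN fmorphV.
rewrite zE -[in RHS]ex; by vfield.
Qed.

Hypotheses (psi0 : 0 < psi) (rst : Astable psi r).

(** If the scalar product is, on the rays, a constant plus a combination of
    resolvents up to an integrable error, then the operator product is
    bounded. *)
Lemma product_bound (I : Type) (s : seq I) (k : I -> R) (c : R[i])
    (L : seq (R[i] * R)) (w : R -> R) (K B1 B2 : R) :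
  (forall i, 0 < k i) -> nrm c <= 1 -> all (fun i => 0 < i.2) L ->
  \sum_(i <- L) nrm i.1 <= B1 ->
  (forall rho : R, 0 < rho -> w rho <= K * rho /\ w rho * rho <= K) ->
  (forall n, (0 < n)%N -> (n%:R ^+ 2)^-1 * grid n w <= B2) ->
  (forall rho t : R, 0 < rho -> `|t| = be ->
     nrm (\prod_(i <- s) rat_eval r ((k i)%:C * (rho%:C * cis t)) - c -
          \sum_(i <- L) i.1 * (1 + i.2%:C * (rho%:C * cis t))^-1) <= w rho) ->
  forall x, nrm ((\big[comp/idfun]_(i <- s) rat_op r (scale_op (k i)%:C A)) x) <=
    (1 + B1 + 2 * B2 / (4 / 3 * sin be)) * Mth A th * nrm x.
Proof.
move=> k0 c1 L0 LB wK wB wf x.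
have HT := resT_family phi0 phith thpi Asect.
have M0 := Mth_ge0 phi0 phith thpi Asect.
have hF := prod_fcalc phi0 phith thbe bepi Asect bepsi psipi rst s k0.
set F := \big[comp/idfun]_(i <- s) _ in hF *.
(* the resolvents of the decomposition *)
have [V fV VB] : exists2 V : X -> X,
    fcalcE A be (fun z => \sum_(i <- L) i.1 * (1 + i.2%:C * z)^-1) V &
    forall x, nrm (V x) <= (\sum_(i <- L) nrm i.1) * (Mth A th * nrm x).
  elim: L L0 {LB wf} => [_|[a tau] L IH /= /andP[t0 L0]].
    exists (fun y => (0 : R[i]) *: y).
      apply: (fcalcE_ext phi0 phith thbe _ _ (fcalcE_cst phi0 phith thbe bepi Asect 0)) => // z _.
      by rewrite big_nil.
    by move=> y; rewrite big_nil scale0r nrm0 mul0r.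
  have [V fV VB] := IH L0; have [U fU UB] := resolvent_bound t0.
  exists (fun y => a *: U y + V y).
    apply: (fcalcE_ext phi0 phith thbe _ _ (fcalcE_add phi0 phith thbe bepi Asect
      (fcalcE_scale phi0 phith thbe bepi Asect a fU) fV)) => // z _.
    by rewrite big_cons.
  move=> y; rewrite big_cons mulrDl; apply: le_trans (nrmD _ _) _.
  by apply: lerD => //; rewrite nrmZ ler_wpM2l ?nrm_ge0.
pose g (z : R[i]) : R[i] := \prod_(i <- s) rat_eval r ((k i)%:C * z) +
   (-1 * (c + \sum_(i <- L) i.1 * (1 + i.2%:C * z)^-1)).
pose G (y : X) : X := F y + -1 *: (c *: y + V y).
have hG : fcalcE A be g G.
  apply: (fcalcE_add phi0 phith thbe bepi Asect hF).
  apply: (fcalcE_scale phi0 phith thbe bepi Asect).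
  apply: (fcalcE_add phi0 phith thbe bepi Asect _ fV).
  exact: (fcalcE_cst phi0 phith thbe bepi Asect).
have gw (rho t : R) : 0 < rho -> `|t| = be -> nrm (g (rho%:C * cis t)) <= w rho.
  move=> r0 tb; apply: le_trans (wf rho t r0 tb).
  by rewrite /g mulN1r opprD addrA.
have bb : `|be| = be by rewrite gtr0_norm.
have Sb (rho : R) : 0 < rho -> sec be (rho%:C * cis be).
  by move=> r0; exists rho, be; rewrite bb.
have {hG} hG : fcalc A (resT A) be g G 0 0.
  case: hG => u0 [ui hG]; have [_ [[L1 [L10 l1]] [L2 [L20 l2]]] _ _ _] := hG.
  have u00 : u0 = 0.
    apply/eqP; rewrite -nrm_eq0 eq_le nrm_ge0 andbT.
    apply: (@archi_le _ _ _ (K + L1) 0) => n _ n0; rewrite add0r.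
    have nR : 0 < (n%:R : R)^-1 by rewrite invr_gt0 ltr0n.
    have h1 := l1 _ (Sb _ nR); rewrite nrm_polar // in h1.
    have h2 := gw _ be nR bb; have [h3 _] := wK _ nR.
    have h4 := nrmB (g (n%:R^-1%:C * cis be)) (g (n%:R^-1%:C * cis be) - u0).
    rewrite opprB addrC subrK in h4; rewrite mulrDl.
    by apply: le_trans h4 _; apply: lerD => //; apply: le_trans h3.
  have ui0 : ui = 0.
    apply/eqP; rewrite -nrm_eq0 eq_le nrm_ge0 andbT.
    apply: (@archi_le _ _ _ (K + L2) 0) => n _ n0; rewrite add0r.
    have nR : 0 < (n%:R : R) by rewrite ltr0n.
    have h1 := l2 _ (Sb _ nR); rewrite nrm_polar // in h1.
    have h2 := gw _ be nR bb; have [_ h3] := wK _ nR.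
    have h4 := nrmB (g (n%:R%:C * cis be)) (g (n%:R%:C * cis be) - ui).
    rewrite opprB addrC subrK in h4; rewrite mulrDl.
    apply: le_trans h4 _; apply: lerD => //.
    by rewrite ler_pdivlMr //; apply: le_trans h3; rewrite ler_wpM2r // ltW.
  by rewrite -{1}u00 -ui0.
have sb : 0 < sin be.
  by rewrite sin_gt0_pi //; move: be0 bepi (pi_gt0 R) => *; lra.
have := @fcalc_bound R X A th (Mth A th) be (resT A) HT M0 th0 thbe bepi g G w B2 hG.
move=> /(_ _ wB x) hb.
have {}hb : nrm (G x) <= 2 * B2 / (4 / 3 * sin be) * (Mth A th * nrm x).
  have e : 0 < 4 / 3 * sin be by rewrite mulr_gt0.
  rewrite mulrAC ler_pdivlMr // mulrC; apply: le_trans (hb _) _; last by rewrite !mulrA.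
  by move=> y y0; split; apply: gw; rewrite ?normrN.
have -> : F x = G x + c *: x + V x by rewrite /G; vring.
have MX : 0 <= Mth A th * nrm x by rewrite mulr_ge0 // nrm_ge0.
have cx : nrm (c *: x) <= Mth A th * nrm x.
  rewrite nrmZ; apply: le_trans (le_Mth x).
  by rewrite -[leRHS]mul1r ler_wpM2r ?nrm_ge0.
have Vx : nrm (V x) <= B1 * (Mth A th * nrm x).
  by apply: le_trans (VB x) _; rewrite ler_wpM2r.
apply: le_trans (nrmD _ _) _; apply: le_trans (lerD (nrmD _ _) (lexx _)) _.
apply: le_trans (lerD (lerD hb cx) Vx) _.
by rewrite le_eqVlt; apply/orP; left; apply/eqP; ring.
Qed.
End Bound.
End Main.

Theorem theorem4p2 (R : realType) (psi : R) (r : {fraction {poly R[i]}})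
    (theta : R) :
  0 < psi <= pi / 2 ->
  Astable psi r ->
  `|rat_infty r| < 1 ->
  0 < theta < psi ->
  exists C : R,
    forall (X : completeNormedModType R[i]) (A : operator X),
      (exists phi : R, 0 < phi < theta /\ sectorial phi A) ->
      forall (n : nat) (k : 'I_n -> R),
        (0 < n)%N -> (forall j, 0 < k j) ->
        (opnorm (\big[comp/idfun]_(j < n) rat_op r (scale_op (k j)%:C A))
          <= C%:E * Msect theta A)%E.
Proof.
move=> /andP[psi0 psipi] rst rinf /andP[th0 thpsi].
have pp := pi_gt0 R.
have psipi' : psi < pi by lra.
pose be : R := (theta + psi) / 2.
have thbe : theta < be by rewrite /be; lra.
have bepsi : be < psi by rewrite /be; lra.
have be0 : 0 < be := lt_trans th0 thbe.
have bepi : be < pi / 2 := lt_le_trans bepsi psipi.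
have thpi : theta < pi by lra.
have rl : nrm (rat_lim r) < 1.
  by rewrite -(rat_inftyE psi0 psipi' rst) -ltcR -nrmE.
have [p [C0 [del [p0 C00 del0 rb]]]] := ray_bounds psi0 psipi' rst rl be0 bepsi.
have v0le : nrm (rat_eval r 0) <= 1.
  apply: (@archi_le _ _ _ C0 0) => n _ n0.
  have nR : 0 < (n%:R : R)^-1 by rewrite invr_gt0 ltr0n.
  have n1 : (n%:R : R)^-1 <= 1 by rewrite invf_le1 ?ltr0n // ler1n.
  have [h1 _ h2 _] := rb _ be nR (gtr0_norm be0).
  have h3 := nrmDZl (rat_eval r 0) (rat_eval r (n%:R^-1%:C * cis be) - rat_eval r 0).
  rewrite [_ + (_ - _)]addrC subrK lerBlDr in h3.
  apply: le_trans h3 _; apply: lerD => //; apply: le_trans h1 _.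
  rewrite ler_wpM2l //; move: p p0 {rb} => [//|q] _.
  by rewrite exprS ler_piMr ?(ltW nR) // exprn_ile1 // (ltW nR).
have [B1 [B2 [B10 B20 dec]]] :=
  sorted_decomposition p0 C00 del0 be0 bepi v0le rl rb.
exists (1 + B1 + 2 * B2 / (4 / 3 * sin be)) => X A [phi [/andP[phi0 phith] Asect]] n k _ k0.
have sb : 0 < sin be by rewrite sin_gt0_pi //; lra.
rewrite (MsectE phi0 phith thpi Asect) -EFinM; apply: opnorm_le; last first.
  rewrite mulr_ge0 ?(Mth_ge0 phi0 phith thpi Asect) //.
  have X0 : 0 <= 2 * B2 / (4 / 3 * sin be).
    by rewrite divr_ge0 ?mulr_ge0 // ltW.
  by move: X0; move: (_ / (_ * sin be)) => Y; lra.
pose ks := [seq k j | j <- index_enum 'I_n].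
pose ss := sort (fun x y => y <= x) ks.
have ssp : all (fun x => 0 < x) ss.
  by rewrite all_sort all_map; apply/allP => j _; exact: k0.
have sss : sorted (fun x y => y <= x) ss by apply: sort_sorted => x y; exact: le_total.
have [c [L [w [c1 L0 LB [K wK] [wB wf]]]]] := dec ss ssp sss.
have wf' (rho t : R) : 0 < rho -> `|t| = be ->
    nrm (\prod_(i <- index_enum 'I_n) rat_eval r ((k i)%:C * (rho%:C * cis t)) - c -
          \sum_(i <- L) i.1 * (1 + i.2%:C * (rho%:C * cis t))^-1) <= w rho.
  move=> r0 tb; have := wf rho t r0 tb.
  by rewrite (perm_big ks) ?perm_sort //= big_map.
by move=> x; exact: (product_bound phi0 phith thbe bepsi psipi Asect rst k0 c1 L0 LB wK wB wf' x).
Qed.
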